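(* Let $(X,\mathcal{X},\mu,T)$ be an invertible measure preserving system (not assumed ergodic), let $p_1,\ldots,p_k$ be rationally independent integer polynomials with $p_i(0)=0$ for $i=1,\ldots,k$, and let $A\in\mathcal{X}$. Then for every $\varepsilon>0$, the set $$\left\{n\in\mathbb{N}\colon \mu\left(A\cap T^{p_1(n)}A\cap\cdots\cap T^{p_k(n)}A\right)\geq\mu(A)^{k+1}-\varepsilon\right\}$$ is syndetic.
   Context: A measure preserving system is a quadruple $(X,\mathcal{X},\mu,T)$ where $(X,\mathcal{X},\mu)$ is a probability space and $T\colon X\to X$ is measurable with $\mu(T^{-1}A)=\mu(A)$ for all $A\in\mathcal{X}$. An integer polynomial is a polynomial taking integer values on the integers. A family $p_1,\ldots,p_k$ of integer polynomials is rationally independent if every nontrivial integer combination of them is not constant. $\mathbb{N}=\{1,2,\ldots\}$. A set $\Lambda\subset\mathbb{N}$ is syndetic if there exists $M\in\mathbb{N}$ such that every interval (in $\mathbb{N}$) of length greater than $M$ intersects $\Lambda$ nontrivially. *)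

(* Defs.v *)
From mathcomp Require Export all_boot all_order all_algebra.
From mathcomp Require Export all_classical all_reals all_analysis.

Set Implicit Arguments.
Unset Strict Implicit.
Unset Printing Implicit Defensive.

Import Order.TTheory GRing.Theory Num.Theory.

Local Open Scope classical_set_scope.
Local Open Scope ring_scope.

Record measure_preserving (d : measure_display) (X : measurableType d)
    (R : realType) (mu : probability X R) (T : X -> X) : Prop := {
  mp_measurable : measurable_fun setT T;
  mp_preserving : forall A : set X, measurable A -> mu (T @^-1` A) = mu A }.

Record measurable_inverse (d : measure_display) (X : measurableType d)
    (T Tinv : X -> X) : Prop := {
  inv_measurable : measurable_fun setT Tinv;
  inv_cancel_l : cancel T Tinv;
  inv_cancel_r : cancel Tinv T }.

(* [iterz T Tinv m] is the m-th power of T in the group of bijections of X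
   when Tinv is the inverse of T; recall that [Negz n] is -(n+1). *)
Definition iterz (X : Type) (T Tinv : X -> X) (m : int) : X -> X :=
  match m with
  | Posz n => iter n T
  | Negz n => iter n.+1 Tinv
  end.

Definition integer_poly (R : realType) (p : {poly R}) : Prop :=
  forall z : int, p.[z%:~R] \is a Num.int.

(* The value of p at n, as an integer; the floor loses nothing when p is an
   integer polynomial. *)
Definition poly_int_val (R : realType) (p : {poly R}) (n : nat) : int :=
  Num.floor p.[n%:R].

Definition rationally_independent (R : realType) (k : nat)
    (p : 'I_k -> {poly R}) : Prop :=
  forall c : 'I_k -> int, (exists i, c i != 0) ->
    ~ exists a : R, \sum_(i < k) (c i)%:~R *: p i = a%:P.

(* The intervals of {1, 2, ...} are the [a, a + l[ with 0 < a, and l is the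
   number of integers in such an interval. *)
Definition syndetic (L : set nat) : Prop :=
  exists2 M : nat, (0 < M)%N &
    forall a l : nat, (0 < a)%N -> (M < l)%N ->
      exists n : nat, (a <= n < a + l)%N /\ L n.

(* Main.v *)
Require Import Defs.
From HB Require Import structures.
From mathcomp Require Import all_boot all_order all_algebra.
From mathcomp Require Import all_classical all_reals all_analysis.
From mathcomp Require Import measurable_realfun.
From mathcomp Require Import ring lra zify.

(** Why the theorem holds.  For a suitable [q], the average of the measures of the
    intersections over the multiples of [q] is at least [mu A ^+ k.+1 - eps / 2]
    (recurrence_along_progression).  Averages are taken with invariant means, and
    the bound holds for every mean.  If the set of good [n] were not syndetic, its
    complement would contain arbitrarily long runs of consecutive multiples of [q];
    a mean concentrated on these runs (interval_mean) would be at most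
    [mu A ^+ k.+1 - eps], a contradiction.

    The average is large because a correlation of functions [F i] along polynomials
    [a i] that are affinely independent only sees, up to a small error, the
    projections of the [F i] to the functions invariant under some power [T^r]
    (correlation_periodic).  Hence the indicator of [A] may be replaced in every
    slot by its projection [u].  If [q] is such that [r] divides all the values
    [p_i (q n)] (pval_multiples), then the translates of [u] involved are [u]
    itself, and the correlation is the integral of [u ^+ k.+1], which is at least
    the power of the integral of [u], that is, of [mu A] (moment_ge).  The step
    needed for the error depends on the polynomials [p_i (q n)], hence on [q]; so
    [r] is chosen beforehand such that larger multiples of it hardly enlarge the
    projection (proj_stable).

    That only projections matter is proved by removing the slots one at a time.
    Van der Corput's inequality and an induction on the polynomials bound the
    correlation by a uniformity seminorm of the function in a slot [j]
    (polynomials_controlled).  Applied to the function that the remaining slots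
    present to [j], the dual function, it shows that this dual function has a large
    seminorm of some order.  Degree lowering (lowering) reduces the order: the part
    of the seminorm that concerns the last two directions is tested against dual
    functions of the second order seminorm, and with these in slot [j] the
    correlation has one slot less to be understood.  In the end the dual function
    has a large projection to the functions invariant under some [T^r], and
    this projection may take the place of the function in slot [j].

    For the induction the functions put into the slots must belong to a class for
    which polynomial correlations can be computed directly.  In an ergodic system
    these would be the combinations of eigenfunctions; in general they are the
    functions called tame, whose orbit is dominated by that of a tensor product
    over the invariant functions.  When all slots but one hold tame functions, the
    correlation is dominated by a positive definite kernel on a lattice, evaluated
    along a vector of polynomials (joint_dominated); Weyl's equidistribution
    theorem for unitary representations (weyl_orbit) then replaces the polynomial
    orbit by a lattice of finite index, and so the functions by their projections
    (periodic_part_large_base).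

    All constants depend on [eps] and on the polynomials only, not on the functions
    nor on the mean.  This is what allows the constants of one step to be fed into
    the next, and the functions to change between steps. *)

Set Implicit Arguments.
Unset Strict Implicit.
Unset Printing Implicit Defensive.
Import Order.TTheory GRing.Theory Num.Theory.
Import numFieldNormedType.Exports.
Local Open Scope ring_scope.

(** * Finite averages and invariant means *)

Section Averages.
Context {R : realType}.

Definition avg (I : Type) (s : seq I) (x : I -> R) : R :=
  (size s)%:R^-1 * \sum_(i <- s) x i.

Context {I J : Type}.
Implicit Types (s : seq I) (x y : I -> R).

Lemma avgD s x y : avg s (fun i => x i + y i) = avg s x + avg s y.
Proof. by rewrite /avg big_split /= mulrDr. Qed.

Lemma avgZ s c x : avg s (fun i => c * x i) = c * avg s x.
Proof. by rewrite /avg -mulr_sumr mulrCA. Qed.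

Lemma eq_avg s x y : (forall i, x i = y i) -> avg s x = avg s y.
Proof. by move=> e; rewrite /avg; congr (_ * _); apply: eq_bigr => i _. Qed.

Lemma avg_cst s c : (0 < size s)%N -> avg s (fun=> c) = c.
Proof.
move=> s0; rewrite /avg big_const_seq count_predT iter_addr_0.
by rewrite -[c *+ _]mulr_natl mulrA mulVf ?mul1r // pnatr_eq0 -lt0n.
Qed.

Lemma avg_le s x y : (forall i, x i <= y i) -> avg s x <= avg s y.
Proof. by move=> h; rewrite ler_wpM2l ?invr_ge0 // ler_sum. Qed.

Lemma avg_ge0 s x : (forall i, 0 <= x i) -> 0 <= avg s x.
Proof. by move=> h; rewrite mulr_ge0 ?invr_ge0 // sumr_ge0. Qed.

Lemma avg_norm s x : `|avg s x| <= avg s (fun i => `|x i|).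
Proof.
by rewrite normrM ger0_norm ?invr_ge0 // ler_wpM2l ?invr_ge0 // ler_norm_sum.
Qed.

Lemma avg_bound s x C : 0 <= C -> (forall i, `|x i| <= C) -> `|avg s x| <= C.
Proof.
move=> C0 h; apply: le_trans (avg_norm _ _) _.
case: (posnP (size s)) => s0; first by rewrite /avg s0 invr0 mul0r.
by rewrite -[leRHS](avg_cst C s0); exact: avg_le.
Qed.

Lemma avg_exists s x c :
  (0 < size s)%N -> c <= avg s x -> exists i, c <= x i.
Proof.
move=> s0 h; apply: contrapT => /forallNP H; move: h; apply/negP; rewrite -ltNge.
rewrite -[ltRHS](avg_cst c s0) /avg ltr_pM2l ?invr_gt0 ?ltr0n //.
case: s s0 => // a s _; rewrite !big_cons ltr_leD //; first by rewrite ltNge; apply/negP.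
by apply: ler_sum => i _; rewrite ltW // ltNge; apply/negP.
Qed.

Lemma avg_cauchy s x y :
  avg s (fun i => x i * y i) ^+ 2 <= avg s (fun i => x i ^+ 2) * avg s (fun i => y i ^+ 2).
Proof.
set a := avg _ _; set b := avg _ _; set c := avg _ _.
have q t : 0 <= b * t ^+ 2 + 2 * a * t + c.
  have -> : b * t ^+ 2 + 2 * a * t + c = avg s (fun i => (t * x i + y i) ^+ 2).
    transitivity (avg s (fun i => (t ^+ 2 * x i ^+ 2 + (2 * t) * (x i * y i)) + y i ^+ 2)).
      by rewrite !avgD !avgZ -/a -/b -/c; ring.
    by apply: eq_avg => i; ring.
  by apply: avg_ge0 => i; exact: sqr_ge0.
have b0 : 0 <= b by apply: avg_ge0 => i; exact: sqr_ge0.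
have c0 : 0 <= c by apply: avg_ge0 => i; exact: sqr_ge0.
have [b1|b1] := ltP 0 b.
  have := q (- a / b); have bn : b != 0 by rewrite gt_eqF.
  have -> : b * (- a / b) ^+ 2 + 2 * a * (- a / b) + c = (b * c - a ^+ 2) / b by field.
  by rewrite pmulr_lge0 ?invr_gt0 // subr_ge0.
have b2 : b = 0 by apply/eqP; rewrite eq_le b1 b0.
rewrite b2 mul0r; case: (eqVneq a 0) => [->|an]; first by rewrite expr0n.
have := q (- (c + 1) / (2 * a)); rewrite b2.
have -> : 0 * (- (c + 1) / (2 * a)) ^+ 2 + 2 * a * (- (c + 1) / (2 * a)) + c = -1.
  by field.
by rewrite oppr_ge0 ler10.
Qed.

Lemma avg_sq s x : avg s x ^+ 2 <= avg s (fun i => x i ^+ 2).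
Proof.
case: (posnP (size s)) => s0; first by rewrite /avg s0 invr0 !mul0r expr0n.
have := avg_cauchy s x (fun=> 1); rewrite expr1n (avg_cst _ s0) mulr1.
by under eq_avg do rewrite mulr1.
Qed.

Lemma avg_pow2 s x t : avg s x ^+ (2 ^ t) <= avg s (fun i => x i ^+ (2 ^ t)).
Proof.
elim: t x => [|t IH] x.
  by rewrite expn0 expr1; under [leRHS]eq_avg do rewrite expr1.
rewrite expnS exprM; apply: le_trans (_ : avg s (fun i => x i ^+ 2) ^+ (2 ^ t) <= _).
  by rewrite lerXn2r ?nnegrE ?sqr_ge0 ?avg_sq // avg_ge0 // => i; exact: sqr_ge0.
by apply: le_trans (IH _) _; apply: avg_le => i; rewrite -exprM.
Qed.

Lemma avg_exchange s (u : seq J) (z : I -> J -> R) :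
  avg s (fun i => avg u (z i)) = avg u (fun j => avg s (z^~ j)).
Proof.
rewrite /avg -!mulr_sumr exchange_big /= mulrCA.
by [].
Qed.

Lemma avg_map (f : J -> I) (u : seq J) x : avg (map f u) x = avg u (x \o f).
Proof. by rewrite /avg size_map big_map. Qed.

Lemma avg_seq1 i x : avg [:: i] x = x i.
Proof. by rewrite /avg big_seq1 invr1 mul1r. Qed.

Lemma avg_sum s (u : seq J) (z : J -> I -> R) :
  avg s (fun i => \sum_(j <- u) z j i) = \sum_(j <- u) avg s (z j).
Proof. by rewrite /avg exchange_big mulr_sumr. Qed.

Lemma norm_le_sqr (a z : R) : 0 <= a -> z ^+ 2 <= a ^+ 2 -> `|z| <= a.
Proof.
by move=> a0 h; rewrite -(ler_pXn2r (n := 2)) ?nnegrE // -normrX ger0_norm ?sqr_ge0.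
Qed.

Lemma sqr_le_norm (a z : R) : 0 <= a -> a <= `|z| -> a ^+ 2 <= z ^+ 2.
Proof.
by move=> a0 h; rewrite -[leRHS]ger0_norm ?sqr_ge0 // normrX lerXn2r ?nnegrE.
Qed.

Lemma le_of_eq (x y : R) : x = y -> x <= y. Proof. by move=> ->. Qed.

Lemma natural_bound (C e : R) : 0 < e -> exists2 n : nat, (0 < n)%N & C <= n%:R * e.
Proof.
move=> e0; exists (Num.truncn (C / e)).+1; first by [].
by rewrite -ler_pdivrMr // ltW // truncnS_gt.
Qed.

Lemma norm_le_succ (a z : R) : 0 <= a -> z ^+ 2 <= a -> `|z| <= a + 1.
Proof. by move=> a0 h; apply: norm_le_sqr; nra. Qed.

End Averages.

Section AveragesEq.
Context {R : realType} {I : eqType}.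
Implicit Types (s : seq I) (x y : I -> R).

Lemma avg_le_in s x y : {in s, forall i, x i <= y i} -> avg s x <= avg s y.
Proof.
by move=> h; rewrite ler_wpM2l ?invr_ge0 // big_seq [leRHS]big_seq ler_sum.
Qed.

Lemma eq_avg_in s x y : {in s, forall i, x i = y i} -> avg s x = avg s y.
Proof.
move=> h; rewrite /avg; congr (_ * _).
by rewrite big_seq [RHS]big_seq; apply: eq_bigr.
Qed.

Lemma avg_exists_in s x c :
  (0 < size s)%N -> c <= avg s x -> exists2 i, i \in s & c <= x i.
Proof.
move=> s0 h; apply: contrapT => H; move: h; apply/negP; rewrite -ltNge.
have xc i : i \in s -> x i < c.
  by move=> si; rewrite ltNge; apply/negP => ci; apply: H; exists i.
rewrite -[ltRHS](avg_cst c s0) /avg ltr_pM2l ?invr_gt0 ?ltr0n //.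
case: s s0 xc {H} => // a s _ xc; rewrite !big_cons ltr_leD ?xc ?mem_head //.
rewrite big_seq [leRHS]big_seq; apply: ler_sum => i si.
by rewrite ltW // xc // in_cons si orbT.
Qed.

End AveragesEq.

Section BoundedSequences.
Context {R : realType}.
Implicit Types x y : int -> R.

Definition bounded x := exists C, forall n, `|x n| <= C.

Lemma bounded_cst c : bounded (fun=> c). Proof. by exists `|c|. Qed.

Lemma boundedD x y : bounded x -> bounded y -> bounded (fun n => x n + y n).
Proof.
move=> [C xC] [D yD]; exists (C + D) => n.
by apply: le_trans (ler_normD _ _) _; exact: lerD.
Qed.

Lemma boundedN x : bounded x -> bounded (fun n => - x n).
Proof. by move=> [C xC]; exists C => n; rewrite normrN. Qed.

Lemma boundedB x y : bounded x -> bounded y -> bounded (fun n => x n - y n).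
Proof. by move=> bx /boundedN; exact: boundedD. Qed.

Lemma boundedM x y : bounded x -> bounded y -> bounded (fun n => x n * y n).
Proof.
move=> [C xC] [D yD]; exists (C * D) => n; rewrite normrM.
by apply: ler_pM.
Qed.

Lemma boundedX x k : bounded x -> bounded (fun n => x n ^+ k).
Proof.
by move=> [C xC]; exists (C ^+ k) => n; rewrite normrX lerXn2r ?nnegrE // (le_trans _ (xC n)).
Qed.

Lemma bounded_comp x (f : int -> int) : bounded x -> bounded (fun n => x (f n)).
Proof. by move=> [C xC]; exists C => n. Qed.

Lemma bounded_sum I (s : seq I) (x : I -> int -> R) :
  (forall i, bounded (x i)) -> bounded (fun n => \sum_(i <- s) x i n).
Proof.
move=> bx; elim: s => [|a s IH].
  by exists 0 => n; rewrite big_nil normr0.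
have [C h] := boundedD (bx a) IH.
by exists C => n; rewrite big_cons.
Qed.

Lemma bounded_avg I (s : seq I) (x : I -> int -> R) :
  (forall i, bounded (x i)) -> bounded (fun n => avg s (x^~ n)).
Proof. by move=> bx; apply: boundedM; [exact: bounded_cst|exact: bounded_sum]. Qed.

Lemma bounded_avg2 I (s : seq I) (y : I -> I -> int -> R) : (forall i j, bounded (y i j)) ->
  bounded (fun n => avg s (fun i => avg s (fun j => y i j n))).
Proof.
move=> b_y; apply: (@bounded_avg _ s (fun i n => avg s (fun j => y i j n))) => i.
exact: bounded_avg.
Qed.

Lemma bounded_norm x : bounded x -> bounded (fun n => `|x n|).
Proof. by move=> [C xC]; exists C => n; rewrite normr_id. Qed.

End BoundedSequences.

#[global] Hint Resolve bounded_cst boundedD boundedN boundedB boundedM boundedX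
  bounded_sum bounded_avg bounded_norm : bdd.
Ltac bdd := by eauto 20 with bdd.

(** Limits of averages along the integers need not exist.  An invariant mean
    assigns a value to every bounded sequence instead, and the bounds for
    correlations below hold for all means at once. *)
Record mean (R : realType) := Mean {
  mean_fun :> (int -> R) -> R ;
  mean_add : forall x y, bounded x -> bounded y ->
    mean_fun (fun n => x n + y n) = mean_fun x + mean_fun y ;
  mean_scale : forall c x, bounded x -> mean_fun (fun n => c * x n) = c * mean_fun x ;
  mean_mono : forall x y, bounded x -> bounded y -> (forall n, x n <= y n) ->
    mean_fun x <= mean_fun y ;
  mean_const : forall c, mean_fun (fun=> c) = c ;
  mean_shift : forall x k, bounded x -> mean_fun (fun n => x (n + k)) = mean_fun x }.

Section Means.
Context {R : realType} (m : mean R).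
Implicit Types x y : int -> R.

Lemma eq_mean x y : (forall n, x n = y n) -> m x = m y.
Proof. by move=> /funext ->. Qed.

Lemma meanB x y : bounded x -> bounded y -> m (fun n => x n - y n) = m x - m y.
Proof.
move=> bx b_y; rewrite mean_add //; last bdd.
congr (_ + _); rewrite -[RHS]mulN1r -mean_scale //.
by apply: eq_mean => n; rewrite mulN1r.
Qed.

Lemma mean_ge0 x : bounded x -> (forall n, 0 <= x n) -> 0 <= m x.
Proof. by move=> bx h; rewrite -(mean_const m 0) mean_mono //; bdd. Qed.

Lemma mean_le c x : bounded x -> (forall n, x n <= c) -> m x <= c.
Proof. by move=> bx h; rewrite -(mean_const m c) mean_mono //; bdd. Qed.

Lemma mean_ge c x : bounded x -> (forall n, c <= x n) -> c <= m x.
Proof. by move=> bx h; rewrite -(mean_const m c) mean_mono //; bdd. Qed.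

Lemma mean_near c e x : bounded x -> (forall n, `|x n - c| <= e) -> `|m x - c| <= e.
Proof.
move=> bx h; rewrite ler_norml; apply/andP; split.
  rewrite lerBrDl; apply: mean_ge => // n.
  by have := h n; rewrite ler_norml => /andP[]; lra.
rewrite lerBlDl; apply: mean_le => // n.
by have := h n; rewrite ler_norml => /andP[]; lra.
Qed.

Lemma mean_bound C x : (forall n, `|x n| <= C) -> `|m x| <= C.
Proof.
by move=> h; rewrite -[m x]subr0; apply: mean_near => [|n]; [exists C|rewrite subr0].
Qed.

Lemma mean_exists c x : bounded x -> 0 < c -> c <= m x -> exists n, c / 2 <= x n.
Proof.
move=> bx c0 h; apply: contrapT => /forallNP H.
have : m x <= c / 2 by apply: mean_le => // n; rewrite ltW // ltNge; apply/negP.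
by lra.
Qed.

Lemma mean_sum I (s : seq I) (x : I -> int -> R) : (forall i, bounded (x i)) ->
  m (fun n => \sum_(i <- s) x i n) = \sum_(i <- s) m (x i).
Proof.
move=> bx; elim: s => [|a s IH].
  by rewrite big_nil -[RHS](mean_const m); apply: eq_mean => n; rewrite big_nil.
rewrite big_cons -IH -mean_add //; last bdd.
by apply: eq_mean => n; rewrite big_cons.
Qed.

Lemma mean_avg I (s : seq I) (x : I -> int -> R) : (forall i, bounded (x i)) ->
  m (fun n => avg s (x^~ n)) = avg s (fun i => m (x i)).
Proof. by move=> bx; rewrite mean_scale ?mean_sum //; bdd. Qed.

Lemma mean_avg2 I (s : seq I) (y : I -> I -> int -> R) : (forall i j, bounded (y i j)) ->
  m (fun n => avg s (fun i => avg s (fun j => y i j n))) =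
  avg s (fun i => avg s (fun j => m (y i j))).
Proof.
move=> b_y; rewrite (mean_avg s (x := fun i n => avg s (fun j => y i j n))) => [|i].
  by apply: eq_avg => i; rewrite mean_avg.
exact: bounded_avg.
Qed.

Lemma mean_sq x : bounded x -> m x ^+ 2 <= m (fun n => x n ^+ 2).
Proof.
move=> bx; rewrite -subr_ge0.
have -> : m (fun n => x n ^+ 2) - m x ^+ 2 = m (fun n => (x n - m x) ^+ 2).
  transitivity (m (fun n => x n ^+ 2 + (- (2 * m x) * x n + m x ^+ 2))).
    rewrite !mean_add ?mean_const ?mean_scale //; try bdd.
    by ring.
  by apply: eq_mean => n; ring.
by apply: mean_ge0 => [|n]; [bdd|exact: sqr_ge0].
Qed.

Lemma mean_pow2 x t : bounded x -> m x ^+ (2 ^ t) <= m (fun n => x n ^+ (2 ^ t)).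
Proof.
elim: t x => [|t IH] x bx.
  by rewrite expn0 expr1; under [leRHS]eq_mean do rewrite expr1.
rewrite expnS exprM; apply: le_trans (_ : m (fun n => x n ^+ 2) ^+ (2 ^ t) <= _).
  rewrite lerXn2r ?nnegrE ?sqr_ge0 ?mean_sq //.
  by apply: mean_ge0 => [|n]; [bdd|exact: sqr_ge0].
apply: le_trans (IH _ _) _; first bdd.
by apply: mean_mono => [||n]; [bdd|bdd|rewrite -exprM].
Qed.

(** A mean does not see shifts, so averaging over finitely many of them is free;
    van der Corput's inequality rests on this. *)
Lemma mean_avg_shift (s : seq int) x : (0 < size s)%N -> bounded x ->
  m x = m (fun n => avg s (fun h => x (n + h))).
Proof.
move=> s0 bx; rewrite (mean_avg s (x := fun h n => x (n + h))).
  rewrite -[LHS](avg_cst _ s0); apply: eq_avg => h.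
  by rewrite mean_shift.
by move=> i; exact: bounded_comp.
Qed.

(** Van der Corput's inequality; [y] is to come from the Cauchy-Schwarz inequality
    applied to the averages of [x] over the shifts in [s]. *)
Lemma mean_van_der_corput (s : seq int) x (y : int -> int -> int -> R) :
  (0 < size s)%N -> bounded x -> (forall h h', bounded (y h h')) ->
  (forall n, avg s (fun h => x (n + h)) ^+ 2 <= avg s (fun h => avg s (fun h' => y h h' n))) ->
  m x ^+ 2 <= avg s (fun h => avg s (fun h' => m (y h h'))).
Proof.
move=> s0 bx b_y xy; rewrite -mean_avg2 // (mean_avg_shift s0 bx).
have ba : bounded (fun n => avg s (fun h => x (n + h))).
  by apply: (@bounded_avg _ _ s (fun h n => x (n + h))) => h; exact: bounded_comp.
by apply: le_trans (mean_sq ba) _; apply: mean_mono => //; [bdd|exact: bounded_avg2].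
Qed.

End Means.

Lemma sum_iota_shift {R : realType} (x : int -> R) a k :
  \sum_(i <- iota 0 k) x (a + i%:Z + 1) - \sum_(i <- iota 0 k) x (a + i%:Z) =
  x (a + k%:Z) - x a.
Proof.
elim: k => [|k IH]; first by rewrite !big_nil addr0 !subrr.
rewrite -addn1 iotaD !big_cat /= !big_seq1 add0n opprD addrACA IH.
have -> : a + k%:Z + 1 = a + (k + 1)%N%:Z by rewrite PoszD addrA.
by ring.
Qed.

(** Exactly one of [0], ..., [q - 1] is congruent to [a]. *)
Lemma sum_residues {R : realType} (q : nat) (q0 : (0 < q)%N) (a : int) (z : nat -> R) :
  \sum_(i <- iota 0 q) (if (q%:Z %| (a - i%:Z))%Z then z i else 0) =
  z `|(a %% q%:Z)%Z|%N.
Proof.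
have qz : q%:Z != 0 by rewrite eqz_nat -lt0n.
have ha := divz_eq a q%:Z; set r := (a %% q%:Z)%Z in ha *.
have r0 : (0 <= r) by exact: modz_ge0.
have rq : r < q%:Z by apply: ltz_pmod; lia.
have rm : `|r|%N \in iota 0 q by rewrite mem_iota; lia.
rewrite (bigD1_seq `|r|%N) ?iota_uniq //= ifT; last first.
  by apply/dvdzP; exists (a %/ q%:Z)%Z; rewrite gez0_abs //; lia.
rewrite big1_seq ?addr0 // => i /andP[ir]; rewrite mem_iota => iq.
case: ifP => // /dvdzP[k hk]; exfalso; move/negP: ir; apply.
apply/eqP; set k' := (a %/ q%:Z)%Z in ha.
have h : i%:Z - r = (k' - k) * q%:Z by rewrite mulrBl; lia.
have : k' - k = 0 \/ k' - k <= -1 \/ 1 <= k' - k by lia.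
case=> [e|[?|?]]; [by rewrite e mul0r in h; lia|nia|nia].
Qed.

(** Polynomial orbits simplify only on residue classes.  Giving one class the
    weight [q] and the others zero yields a mean again, as the class has density
    [1 / q] for every mean. *)
Section ResidueMean.
Context {R : realType} (m : mean R) (q : nat) (q0 : (0 < q)%N) (c : int).
Implicit Types x y : int -> R.

Let spread x (n : int) : R :=
  if (q%:Z %| (n - c))%Z then q%:R * x ((n - c) %/ q%:Z)%Z else 0.

Let bounded_spread x : bounded x -> bounded (spread x).
Proof.
move=> [C xC]; exists (q%:R * C) => n; rewrite /spread; case: ifP => _.
  by rewrite normrM ger0_norm // ler_wpM2l.
by rewrite normr0 mulr_ge0 // (le_trans _ (xC 0)).
Qed.

Let residue x := m (spread x).

Let residue_add x y : bounded x -> bounded y ->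
  residue (fun n => x n + y n) = residue x + residue y.
Proof.
move=> bx b_y; rewrite -mean_add; [|exact: bounded_spread..].
by apply: eq_mean => n; rewrite /spread; case: ifP => _; rewrite ?mulrDr ?addr0.
Qed.

Let residue_scale k x : bounded x -> residue (fun n => k * x n) = k * residue x.
Proof.
move=> bx; rewrite -mean_scale; last exact: bounded_spread.
by apply: eq_mean => n; rewrite /spread; case: ifP => _; rewrite ?mulr0 // mulrCA.
Qed.

Let residue_mono x y : bounded x -> bounded y -> (forall n, x n <= y n) ->
  residue x <= residue y.
Proof.
move=> bx b_y h; apply: mean_mono; [exact: bounded_spread..|] => n.
by rewrite /spread; case: ifP => _ //; rewrite ler_wpM2l.
Qed.

Let residue_const k : residue (fun=> k) = k.
Proof.
have s0 : (0 < size [seq - (i%:Z) | i <- iota 0 q])%N by rewrite size_map size_iota.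
rewrite /residue (mean_avg_shift m s0); last exact/bounded_spread/bounded_cst.
rewrite -[RHS](mean_const m); apply: eq_mean => n.
rewrite avg_map /avg size_iota /= /spread.
under eq_bigr do rewrite addrAC.
rewrite (sum_residues q0 (n - c) (fun=> q%:R * k)) mulKf // pnatr_eq0; lia.
Qed.

Let residue_shift x k : bounded x -> residue (fun n => x (n + k)) = residue x.
Proof.
move=> bx; rewrite /residue -[RHS](mean_shift m (q%:Z * k)); last exact: bounded_spread.
apply: eq_mean => n; rewrite /spread.
have -> : n + q%:Z * k - c = (n - c) + q%:Z * k by ring.
have dk : (q%:Z %| q%:Z * k)%Z by exact: dvdz_mulr.
rewrite (rpredDr _ dk) (divzDr _ dk) [(q%:Z * k)%R]mulrC mulzK //; lia.
Qed.

Definition residue_mean : mean R :=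
  Mean residue_add residue_scale residue_mono residue_const residue_shift.

End ResidueMean.

Lemma mean_residues {R : realType} (m : mean R) q (q0 : (0 < q)%N) (x : int -> R) :
  bounded x ->
  m x = avg (iota 0 q) (fun c => residue_mean m q0 c%:Z (fun n => x (q%:Z * n + c%:Z))).
Proof.
move=> bx; rewrite /= -mean_avg.
  apply: eq_mean => n; rewrite /avg size_iota.
  transitivity (q%:R^-1 * (q%:R * x n)); first by rewrite mulKf // pnatr_eq0; lia.
  congr (_ * _); rewrite -(sum_residues q0 n (fun=> q%:R * x n)).
  apply: eq_bigr => i _; case: ifP => // /dvdzP[k kE].
  by rewrite kE mulzK; [congr (_ * x _); lia|lia].
have [C xC] := bx => i; exists (q%:R * C) => n; case: ifP => _.
  by rewrite normrM ger0_norm // ler_wpM2l.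
by rewrite normr0 mulr_ge0 // (le_trans _ (xC 0)).
Qed.


Lemma shift_from_one {R : realType} (M : (int -> R) -> R) :
  (forall x, bounded x -> M (fun n => x (n + 1)) = M x) ->
  forall x k, bounded x -> M (fun n => x (n + k)) = M x.
Proof.
move=> M1 x k bx.
have nat_shift (j : nat) y : bounded y -> M (fun n => y (n + j%:Z)) = M y.
  move=> b_y; elim: j => [|j IH]; first by congr M; apply/funext => n; rewrite addr0.
  rewrite -IH -[RHS]M1; last exact: bounded_comp b_y.
  by congr M; apply/funext => n; congr y; lia.
have [k0|k0] := leP 0 k; first by rewrite -(gez0_abs k0) nat_shift.
rewrite -(nat_shift `|k|%N); last exact: bounded_comp bx.
by congr M; apply/funext => n; congr x; lia.
Qed.

(** The blocks [b n], ..., [b n + b - 1] cover the integers, so the means of their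
    averages form a mean.  Through it the mean over the multiples of [b] can be
    compared with the mean over all integers. *)
Section DilatedMean.
Context {R : realType} (m : mean R) (b : nat) (b0 : (0 < b)%N).
Implicit Types x y : int -> R.

Let blocks x := m (fun n => avg (iota 0 b) (fun c => x (b%:Z * n + c%:Z))).

Let bounded_block x : bounded x ->
  bounded (fun n => avg (iota 0 b) (fun c => x (b%:Z * n + c%:Z))).
Proof.
move=> bx; apply: (@bounded_avg _ _ _ (fun (c : nat) n => x (b%:Z * n + c%:Z))) => c.
exact: bounded_comp bx.
Qed.

Let blocks_add x y : bounded x -> bounded y ->
  blocks (fun n => x n + y n) = blocks x + blocks y.
Proof.
move=> bx b_y; rewrite -mean_add; [|exact: bounded_block..].
by apply: eq_mean => n; rewrite avgD.
Qed.

Let blocks_scale k x : bounded x -> blocks (fun n => k * x n) = k * blocks x.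
Proof.
move=> bx; rewrite -mean_scale; last exact: bounded_block.
by apply: eq_mean => n; rewrite avgZ.
Qed.

Let blocks_mono x y : bounded x -> bounded y -> (forall n, x n <= y n) ->
  blocks x <= blocks y.
Proof.
by move=> bx b_y h; apply: mean_mono; [exact: bounded_block..|] => n; apply: avg_le.
Qed.

Let blocks_const k : blocks (fun=> k) = k.
Proof.
by rewrite -[RHS](mean_const m); apply: eq_mean => n; rewrite avg_cst // size_iota.
Qed.

Let blocks_shift1 x : bounded x -> blocks (fun n => x (n + 1)) = blocks x.
Proof.
move=> bx; have bx0 : bounded (fun n => x (b%:Z * n)) by exact: bounded_comp bx.
apply/eqP; rewrite -subr_eq0 -meanB; last exact: bounded_block.
  2: exact: (bounded_block (@bounded_comp _ x (fun n : int => n + 1) bx)).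
rewrite (_ : (fun n => _) = (fun n => b%:R^-1 * (x (b%:Z * (n + 1)) - x (b%:Z * n)))).
  rewrite mean_scale ?meanB //; [|exact: bounded_comp bx0|].
    by rewrite (mean_shift m 1 bx0) subrr mulr0.
  by apply: boundedB => //; exact: bounded_comp bx0.
apply/funext => n; rewrite /avg size_iota -mulrBr; congr (_ * _).
by rewrite sum_iota_shift; congr (x _ - _); ring.
Qed.

Let blocks_shift x k : bounded x -> blocks (fun n => x (n + k)) = blocks x.
Proof. exact: shift_from_one blocks_shift1 x k. Qed.

Definition dilated_mean : mean R :=
  Mean blocks_add blocks_scale blocks_mono blocks_const blocks_shift.

End DilatedMean.

(** Bounds may be weakened by increasing [N] and decreasing [e], so a maximum and
    a minimum satisfy finitely many requirements at once. *)
Lemma uniform_choice {R : realType} (q : nat) (P : nat -> nat -> R -> Prop) :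
  (forall c N N' e e', (N <= N')%N -> 0 < e' -> e' <= e -> P c N e -> P c N' e') ->
  (forall c, exists N e, 0 < e /\ P c N e) ->
  exists N e, 0 < e /\ forall c, (c < q)%N -> P c N e.
Proof.
move=> mono ex; elim: q => [|q [N [e [e0 IH]]]]; first by exists 0%N, 1.
have [N' [e' [e'0 h]]] := ex q; exists (maxn N N'), (Num.min e e').
rewrite lt_min e0 e'0; split=> // c; rewrite ltnS leq_eqVlt => /orP[/eqP ->|cq].
  by apply: mono h; [exact: leq_maxr|rewrite lt_min e0|rewrite ge_min lexx orbT].
by apply: mono (IH c cq); [exact: leq_maxl|rewrite lt_min e0|rewrite ge_min lexx].
Qed.

(** * Positive definite functions and the mean ergodic theorem *)

(** A positive definite function on an abelian group stands for the orbit of a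
    vector under a unitary representation, through its matrix coefficients
    [K v = <U^v e, e>]. Only finite combinations of the orbit occur, and
    their inner products are finite sums of values of [K]. *)
Section PositiveDefinite.
Context {R : realType} {G : zmodType}.
Implicit Types (K F : G -> R) (s : seq (R * G)).

Definition energy K s : R :=
  \sum_(p <- s) \sum_(q <- s) p.1 * q.1 * K (p.2 - q.2).

Definition pos_def K := (forall v, K (- v) = K v) /\ forall s, 0 <= energy K s.

(** [F] is dominated by [K] when [F v = <U^v e, f>] for some [f] of norm at most 1. *)
Definition dominated F K :=
  forall s, (\sum_(p <- s) p.1 * F p.2) ^+ 2 <= energy K s.

Lemma energy_cons K c v s : (forall u, K (- u) = K u) ->
  energy K ((c, v) :: s) =
  c ^+ 2 * K 0 + 2 * c * (\sum_(p <- s) p.1 * K (p.2 - v)) + energy K s.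
Proof.
move=> ev; rewrite /energy big_cons big_cons /= subrr.
under [X in _ + X]eq_bigr do rewrite big_cons /=.
rewrite big_split /= addrA; congr (_ + _).
rewrite -addrA expr2; congr (_ + _).
under eq_bigr do rewrite -opprB ev.
rewrite mulr_sumr -big_split /=; apply: eq_bigr => p _; ring.
Qed.

Lemma discriminant_le (a b c : R) :
  0 <= a -> (forall t, 0 <= a * t ^+ 2 + 2 * b * t + c) -> b ^+ 2 <= a * c.
Proof.
move=> a0 q; have c0 : 0 <= c by have := q 0; rewrite expr0n /= !mulr0 !add0r.
have [a1|a1] := ltP 0 a.
  have := q (- b / a); have an : a != 0 by rewrite gt_eqF.
  have -> : a * (- b / a) ^+ 2 + 2 * b * (- b / a) + c = (a * c - b ^+ 2) / a by field.
  by rewrite pmulr_lge0 ?invr_gt0 // subr_ge0.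
have a2 : a = 0 by apply/eqP; rewrite eq_le a1 a0.
rewrite a2 mul0r; case: (eqVneq b 0) => [->|bn]; first by rewrite expr0n.
have := q (- (c + 1) / (2 * b)); rewrite a2.
have -> : 0 * (- (c + 1) / (2 * b)) ^+ 2 + 2 * b * (- (c + 1) / (2 * b)) + c = -1.
  by field.
by rewrite oppr_ge0 ler10.
Qed.

Lemma pos_def_ge0 K : pos_def K -> 0 <= K 0.
Proof.
by move=> [_ /(_ [:: (1, 0)])]; rewrite /energy !big_seq1 /= subrr mul1r mul1r.
Qed.

(** The Cauchy-Schwarz inequality [<x, e>^2 <= <e, e> <x, x>]. *)
Lemma pos_def_dominated K : pos_def K -> dominated K (fun v => K 0 * K v).
Proof.
move=> pdK s; have [ev pK] := pdK.
have -> : energy (fun v => K 0 * K v) s = K 0 * energy K s.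
  rewrite /energy mulr_sumr; apply: eq_bigr => p _.
  by rewrite mulr_sumr; apply: eq_bigr => q _; ring.
apply: discriminant_le => [|t]; first exact: pos_def_ge0.
have := pK ((t, 0) :: s); rewrite energy_cons //.
under eq_bigr do rewrite subr0.
by congr (0 <= _); ring.
Qed.

Lemma dominated_norm F K v : dominated F K -> `|F v| ^+ 2 <= K 0.
Proof.
by move=> /(_ [:: (1, v)]); rewrite /energy !big_seq1 /= subrr !mul1r -normrX ger0_norm ?sqr_ge0.
Qed.

Lemma pos_def_norm K v : pos_def K -> `|K v| <= K 0.
Proof.
move=> pdK; have := dominated_norm v (pos_def_dominated pdK).
by rewrite -expr2 ler_pXn2r // nnegrE // pos_def_ge0.
Qed.

Lemma pos_def_bounded K (f : int -> G) : pos_def K -> bounded (fun n => K (f n)).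
Proof. by move=> pdK; exists (K 0) => n; exact: pos_def_norm. Qed.

Lemma dominated_bounded F K (f : int -> G) : dominated F K -> bounded (fun n => F (f n)).
Proof.
move=> dF; exists (K 0 + 1) => n; have := dominated_norm (f n) dF.
have := normr_ge0 (F (f n)); nra.
Qed.

Lemma energy_avg K (I : Type) (s : seq I) (v : I -> G) :
  energy K [seq ((size s)%:R^-1, v i) | i <- s] =
  avg s (fun i => avg s (fun j => K (v i - v j))).
Proof.
rewrite /energy big_map /avg mulr_sumr; apply: eq_bigr => i _.
rewrite big_map /= !mulr_sumr; apply: eq_bigr => j _; ring.
Qed.

Lemma dominated_avg F K (I : Type) (s : seq I) (v : I -> G) : dominated F K ->
  avg s (fun i => F (v i)) ^+ 2 <= avg s (fun i => avg s (fun j => K (v i - v j))).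
Proof.
move=> /(_ [seq ((size s)%:R^-1, v i) | i <- s]); rewrite energy_avg.
by rewrite big_map /= -mulr_sumr.
Qed.

Lemma pos_def_avg K (I : Type) (s : seq I) (v : I -> G) : pos_def K ->
  0 <= avg s (fun i => avg s (fun j => K (v i - v j))).
Proof. by move=> [_ pK]; rewrite -energy_avg. Qed.

Lemma energy_cat_swap K s1 s2 : (forall v, K (- v) = K v) ->
  energy K (s1 ++ s2) = energy K s1 + energy K s2 +
    2 * \sum_(p <- s1) \sum_(q <- s2) p.1 * q.1 * K (p.2 - q.2).
Proof.
move=> ev; rewrite /energy big_cat /=.
under eq_bigr do rewrite big_cat /=.
under [X in _ + X]eq_bigr do rewrite big_cat /=.
rewrite !big_split /= [X in _ + (X + _)]exchange_big /=.
have -> : \sum_(j <- s1) \sum_(i <- s2) i.1 * j.1 * K (i.2 - j.2) =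
  \sum_(p <- s1) \sum_(q <- s2) p.1 * q.1 * K (p.2 - q.2).
  by apply: eq_bigr => p _; apply: eq_bigr => q _; rewrite -opprB ev [q.1 * _]mulrC.
ring.
Qed.

(** Averages over a well chosen finite set of shifts in direction [w] are almost
    invariant, uniformly over all functions dominated by [K]. As in von
    Neumann's theorem, the set is chosen to make the average of the orbit
    almost as short as possible, and the parallelogram law does the rest. *)
Lemma almost_invariant_average K (w : G) (e : R) : pos_def K -> 0 < e ->
  exists s : seq int, (0 < size s)%N /\ forall F, dominated F K -> forall v (j : int),
    `|avg s (fun k => F (v + w *~ k)) - avg s (fun k => F (v + w *~ (k + j)))| <= e.
Proof.
move=> pdK e0; have [ev pK] := pdK.
pose ener (s : seq int) := avg s (fun k => avg s (fun l => K (w *~ k - w *~ l))).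
have ener0 (s : seq int) : 0 <= ener s by exact: (pos_def_avg s (fun k : int => w *~ k) pdK).
pose vals : set R := [set x | exists s : seq int, (0 < size s)%N /\ ener s = x]%classic.
have [s [s0 sP]] : exists s : seq int, (0 < size s)%N /\
    forall t : seq int, (0 < size t)%N -> ener s <= ener t + e ^+ 2 / 4.
  have hi : has_inf vals.
    split; first by exists (ener [:: 0]); exists [:: 0].
    by exists 0 => _ [s [_ <-]].
  have [_ [s [s0 <-]] hs] := inf_adherent (eps := e ^+ 2 / 4) ltac:(nra) hi.
  exists s; split=> // t t0; apply: le_trans (ltW hs) _; rewrite lerD2r.
  by apply: ge_inf; [case: hi|exists t].
exists s; split=> // F dF v j.
pose c := (size s)%:R^-1 : R.
pose s1 := [seq (c, v + w *~ k) | k <- s].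
pose s2 := [seq (- c, v + w *~ (k + j)) | k <- s].
pose cross := avg s (fun k => avg s (fun l => K (w *~ k - w *~ (l + j)))).
have E : avg s (fun k => F (v + w *~ k)) - avg s (fun k => F (v + w *~ (k + j))) =
    \sum_(p <- s1 ++ s2) p.1 * F p.2.
  rewrite big_cat !big_map /= -!mulr_sumr mulNr; congr (_ - _).
have E2 : energy K (s1 ++ s2) = 2 * ener s - 2 * cross.
  rewrite energy_cat_swap // energy_avg.
  have -> : energy K s2 = ener s.
    rewrite /energy big_map /ener /avg mulr_sumr; apply: eq_bigr => k _.
    rewrite big_map /= -/c !mulr_sumr; apply: eq_bigr => l _.
    have -> : v + w *~ (k + j) - (v + w *~ (l + j)) = w *~ k - w *~ l.
      by rewrite !mulrzDr opprD addrACA subrr add0r opprD addrACA subrr addr0.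
    by ring.
  have -> : avg s (fun i => avg s (fun j0 => K (v + w *~ i - (v + w *~ j0)))) = ener s.
    apply: eq_avg => k; apply: eq_avg => l; congr (K _).
    by rewrite opprD addrACA subrr add0r.
  have -> : \sum_(p <- s1) \sum_(q <- s2) p.1 * q.1 * K (p.2 - q.2) = - cross.
    rewrite big_map /cross /avg mulr_sumr -sumrN; apply: eq_bigr => k _.
    rewrite big_map /= -/c !mulr_sumr -sumrN; apply: eq_bigr => l _.
    have -> : v + w *~ k - (v + w *~ (l + j)) = w *~ k - w *~ (l + j).
      by rewrite opprD addrACA subrr add0r.
    by ring.
  by ring.
have E3 : ener (s ++ [seq k + j | k <- s]) = (ener s + cross) / 2.
  pose d := (size (s ++ [seq k + j | k <- s]))%:R^-1 : R.
  have dc : d = c / 2.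
    by rewrite /d size_cat size_map addnn -muln2 natrM invfM mulrC.
  rewrite [LHS]/ener -(energy_avg K (s ++ [seq k + j | k <- s]) (fun k => w *~ k)) -/d.
  rewrite map_cat energy_cat_swap //.
  have -> : energy K [seq (d, w *~ i) | i <- s] = ener s / 4.
    rewrite /energy big_map /ener /avg mulr_sumr mulr_suml; apply: eq_bigr => k _.
    rewrite big_map /= dc -/c !mulr_sumr mulr_suml; apply: eq_bigr => l _.
    by field.
  have -> : energy K [seq (d, w *~ i) | i <- [seq k + j | k <- s]] = ener s / 4.
    rewrite /energy !big_map /ener /avg mulr_sumr mulr_suml; apply: eq_bigr => k _.
    rewrite !big_map /= dc -/c !mulr_sumr mulr_suml; apply: eq_bigr => l _.
    rewrite !mulrzDr opprD addrACA subrr addr0; by field.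
  have -> : \sum_(p <- [seq (d, w *~ i) | i <- s])
      \sum_(q <- [seq (d, w *~ i) | i <- [seq k + j | k <- s]])
        p.1 * q.1 * K (p.2 - q.2) = cross / 4.
    rewrite big_map /cross /avg mulr_sumr mulr_suml; apply: eq_bigr => k _.
    rewrite !big_map /= dc -/c !mulr_sumr mulr_suml; apply: eq_bigr => l _.
    by field.
  by field.
have := dF (s1 ++ s2); rewrite -E E2.
have := sP (s ++ [seq k + j | k <- s]); rewrite E3 size_cat addn_gt0 s0 => /(_ isT).
set x := _ - avg _ _ => h1 h2; apply: norm_le_sqr; first exact: ltW.
by lra.
Qed.

(** A mean does not see shifts, so it may be applied after averaging over the
    finite set of almost invariance, where it averages numbers that are close to
    each other. *)
Lemma uniform_mean_ergodic K (w : G) (e : R) : pos_def K -> 0 < e ->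
  exists s : seq int, (0 < size s)%N /\ forall F, dominated F K ->
    forall (m : mean R) v,
    `|avg s (fun k => F (v + w *~ k)) - m (fun k => F (v + w *~ k))| <= e.
Proof.
move=> pdK e0; have [s [s0 sP]] := almost_invariant_average w pdK e0.
exists s; split=> // F dF m v.
rewrite distrC (mean_avg_shift m s0); last exact: (dominated_bounded (fun k : int => v + w *~ k) dF).
apply: mean_near => [|j].
  apply: (@bounded_avg _ _ _ (fun h n : int => F (v + w *~ (n + h)))) => i.
  exact: (dominated_bounded (fun n : int => v + w *~ (n + i)) dF).
rewrite distrC; apply: le_trans (sP F dF v j); apply: le_of_eq.
 rewrite [X in _ = `|_ - X|](_ : _ = avg s (fun h => F (v + w *~ (j + h)))) 1?distrC //.
by apply: eq_avg => k; rewrite [k + j]addrC.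
Qed.

End PositiveDefinite.

(** The mean of a positive definite function on the integers is the squared
    length of the shortest average of the orbit.  In particular all means agree. *)
Section PositiveDefiniteMean.
Context {R : realType}.
Implicit Types (r : int -> R) (m : mean R).

(** The difference of an average of the orbit and its translate by [j] has
    nonnegative energy; take the mean over [j]. *)
Lemma mean_le_energy m r (s : seq int) : pos_def r -> (0 < size s)%N ->
  m r <= avg s (fun k => avg s (fun l => r (k - l))).
Proof.
move=> pdr s0; have br : bounded r by exact: (pos_def_bounded id pdr).
have bk (k l : int) : bounded (fun j => r (k - l + j)).
  by exact: (@pos_def_bounded _ _ r (fun j : int => k - l + j)).
have -> : m r = m (fun j => avg s (fun k => avg s (fun l => r (k - l + j)))).
  rewrite (mean_avg2 m s (y := fun k l j => r (k - l + j))) //.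
  rewrite -[LHS](avg_cst _ s0); apply: eq_avg => k.
  rewrite -[LHS](avg_cst _ s0); apply: eq_avg => l.
  by rewrite -(mean_shift m (k - l) br); apply: eq_mean => n; rewrite addrC.
apply: mean_le => [|j].
  exact: (@bounded_avg2 _ _ s (fun k l j : int => r (k - l + j))).
have [ev pr] := pdr; pose c := (size s)%:R^-1 : R.
have := pr ([seq (c, k + j) | k <- s] ++ [seq (- c, k) | k <- s]).
rewrite energy_cat_swap //.
have -> : energy r [seq (c, k + j) | k <- s] = avg s (fun k => avg s (fun l => r (k - l))).
  rewrite energy_avg; apply: eq_avg => k; apply: eq_avg => l; congr r; ring.
have -> : energy r [seq (- c, k) | k <- s] = avg s (fun k => avg s (fun l => r (k - l))).
  rewrite -(energy_avg r s id) /energy !big_map; apply: eq_bigr => k _.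
  by rewrite !big_map; apply: eq_bigr => l _ /=; rewrite -/c; ring.
have -> : \sum_(p <- [seq (c, k + j) | k <- s]) \sum_(q <- [seq (- c, k) | k <- s])
   p.1 * q.1 * r (p.2 - q.2) = - avg s (fun k => avg s (fun l => r (k - l + j))).
  rewrite big_map /avg mulr_sumr -sumrN; apply: eq_bigr => k _.
  rewrite big_map /= -/c !mulr_sumr -sumrN; apply: eq_bigr => l _.
  have -> : k + j - l = k - l + j by ring.
  by ring.
lra.
Qed.

(** The average provided by the mean ergodic theorem has almost constant inner
    product with the orbit, and that constant is the mean. *)
Lemma energy_le_mean r (e : R) : pos_def r -> 0 < e ->
  exists s : seq int, (0 < size s)%N /\ forall m : mean R,
    avg s (fun k => avg s (fun l => r (k - l))) <= m r + e.
Proof.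
move=> pdr e0; pose C := r 0 + 1; have r0 := pos_def_ge0 pdr.
have C0 : 0 < C by rewrite /C; lra.
have pdC : pos_def (fun v => r 0 * r v).
  have [ev pr] := pdr; split=> [v|s]; first by rewrite ev.
  have -> : energy (fun v => r 0 * r v) s = r 0 * energy r s.
    rewrite /energy mulr_sumr; apply: eq_bigr => p _.
    by rewrite mulr_sumr; apply: eq_bigr => q _; ring.
  exact: mulr_ge0.
have [s [s0 sP]] := uniform_mean_ergodic (1 : int) pdC e0.
exists s; split=> // m; have := sP r (pos_def_dominated pdr) m.
move=> h; rewrite avg_exchange -[leRHS](avg_cst _ s0); apply: avg_le => l.
have := h (- l); rewrite ler_norml => /andP[_].
have -> : m (fun k => r (- l + 1 *~ k)) = m r.
  rewrite -[RHS](mean_shift m (- l)); last exact: (pos_def_bounded id pdr).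
  by apply: eq_mean => n; rewrite intz addrC.
under eq_avg do rewrite intz addrC.
by rewrite lerBlDl addrC.
Qed.

Lemma pos_def_mean_ge0 m r : pos_def r -> 0 <= m r.
Proof.
move=> pdr; apply/ler_addgt0Pr => e e0; have [s [s0 sP]] := energy_le_mean pdr e0.
by apply: le_trans (sP m); exact: (pos_def_avg s id pdr).
Qed.

Lemma mean_indep (m m' : mean R) r : pos_def r -> m r = m' r.
Proof.
move=> pdr; apply/eqP; rewrite eq_le; apply/andP; split; apply/ler_addgt0Pr => e e0;
  have [s [s0 sP]] := energy_le_mean pdr e0; apply: le_trans (sP _); exact: mean_le_energy.
Qed.

(** At a multiple of [b] the nonnegative [r] is at most [b] times its average over
    the block that starts there.  The block averages define another mean, and all
    means agree on [r]. *)
Lemma mean_dilate m r (b : nat) : pos_def r -> (forall n, 0 <= r n) -> (0 < b)%N ->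
  m (fun n => r (b%:Z * n)) <= b%:R * m r.
Proof.
move=> pdr r0 b0; have br : bounded r by exact: (pos_def_bounded id pdr).
have bd (c : int) : bounded (fun n => r (b%:Z * n + c)) by exact: bounded_comp br.
pose x n := avg (iota 0 b) (fun c => r (b%:Z * n + c%:Z)).
have bx : bounded x by apply: (@bounded_avg _ _ _ (fun (c : nat) n => r (b%:Z * n + c%:Z))).
have rx n : r (b%:Z * n) <= b%:R * x n.
  rewrite /x /avg size_iota mulVKf ?pnatr_eq0; last by lia.
  rewrite (bigD1_seq 0%N) ?iota_uniq ?mem_iota ?add0n //=.
  by rewrite addr0 lerDl sumr_ge0.
apply: (@le_trans _ _ (m (fun n => b%:R * x n))).
  by apply: mean_mono => //; [exact: bounded_comp br|bdd].
rewrite mean_scale // ler_wpM2l //; apply: le_of_eq.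
pose m' := dilated_mean m b0; rewrite -[LHS]/(m' r); exact: mean_indep.
Qed.

End PositiveDefiniteMean.

(** * Measure preserving systems as algebras with a state *)

(** The properties of the algebra of bounded measurable functions that the proof
    uses; [ball] stands for the functions bounded by 1.  Only the last property
    concerns infinitely many functions at once: it is the weak compactness of the
    unit ball. *)
Record msys (R : realType) := MSys {
  obs : comNzRingType ;
  scal : R -> obs ;
  state : obs -> R ;
  act : int -> obs -> obs ;
  ball : obs -> Prop ;
  scal1 : scal 1 = 1 ;
  stateD : forall f g, state (f + g) = state f + state g ;
  stateZ : forall c f, state (scal c * f) = c * state f ;
  state1 : state 1 = 1 ;
  state_sq_ge0 : forall f, 0 <= state (f ^+ 2) ;
  act0 : forall f, act 0 f = f ;
  actD : forall a b f, act (a + b) f = act a (act b f) ;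
  act_add : forall a f g, act a (f + g) = act a f + act a g ;
  actM : forall a f g, act a (f * g) = act a f * act a g ;
  act1 : forall a, act a 1 = 1 ;
  act_scal : forall a c, act a (scal c) = scal c ;
  state_act : forall a f, state (act a f) = state f ;
  ball1 : ball 1 ;
  ballM : forall f g, ball f -> ball g -> ball (f * g) ;
  ball_act : forall a f, ball f -> ball (act a f) ;
  ball_half : forall f g, ball f -> ball g -> ball (scal 2^-1 * (f - g)) ;
  ball_state : forall f g, ball f -> state ((f * g) ^+ 2) <= state (g ^+ 2) ;
  weak_limit : forall (m : mean R) (F : int -> obs), (forall n, ball (F n)) ->
    exists f, ball f /\ forall g, state (f * g) = m (fun n => state (F n * g)) }.

#[global] Hint Resolve ball1 ballM ball_act : ball.
Ltac ball := by eauto 20 with ball.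

Section System.
Context {R : realType} {S : msys R}.
Implicit Types f g u w : obs S.
Local Notation phi := (@state R S).
Local Notation T := (@act R S).
Local Notation sc := (@scal R S).

Lemma state0 : phi 0 = 0.
Proof. by apply: (addrI (phi 0)); rewrite -stateD !addr0. Qed.

Lemma stateN f : phi (- f) = - phi f.
Proof. by apply: (addrI (phi f)); rewrite -stateD !subrr state0. Qed.

Lemma stateB f g : phi (f - g) = phi f - phi g.
Proof. by rewrite stateD stateN. Qed.

Lemma state_sum I (s : seq I) (F : I -> obs S) :
  phi (\sum_(i <- s) F i) = \sum_(i <- s) phi (F i).
Proof.
by elim: s => [|a s IH]; [rewrite !big_nil state0|rewrite !big_cons stateD IH].
Qed.

Lemma act_prod a I (s : seq I) (F : I -> obs S) :
  T a (\prod_(i <- s) F i) = \prod_(i <- s) T a (F i).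
Proof.
by elim: s => [|b s IH]; [rewrite !big_nil act1|rewrite !big_cons actM IH].
Qed.

Lemma act_comm a b f : T a (T b f) = T b (T a f).
Proof. by rewrite -!actD addrC. Qed.

Lemma state_actl a f g : phi (T a f * g) = phi (f * T (- a) g).
Proof. by rewrite -(state_act (- a)) actM -actD addNr act0. Qed.

Lemma state_actr a f g : phi (f * T a g) = phi (T (- a) f * g).
Proof. by rewrite state_actl opprK. Qed.

Lemma state_cauchy f g : phi (f * g) ^+ 2 <= phi (f ^+ 2) * phi (g ^+ 2).
Proof.
apply: discriminant_le => [|t]; first exact: state_sq_ge0.
have -> : phi (f ^+ 2) * t ^+ 2 + 2 * phi (f * g) * t + phi (g ^+ 2) =
    phi ((sc t * f + g) ^+ 2); last exact: state_sq_ge0.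
have -> : (sc t * f + g) ^+ 2 = sc t * (sc t * f ^+ 2 + (f * g + f * g)) + g ^+ 2 by ring.
rewrite !(stateD, stateZ); ring.
Qed.

Lemma state_sq1 f : phi f ^+ 2 <= phi (f ^+ 2).
Proof. by have := state_cauchy f 1; rewrite mulr1 expr1n state1 mulr1. Qed.

Lemma ball_sq f : ball f -> phi (f ^+ 2) <= 1.
Proof. by move=> bf; have := ball_state 1 bf; rewrite mulr1 expr1n state1. Qed.

Lemma ball_cauchy f g : ball f -> phi (f * g) ^+ 2 <= phi (g ^+ 2).
Proof. by move=> bf; apply: le_trans (ball_state g bf); exact: state_sq1. Qed.

Lemma ball_norm f : ball f -> `|phi f| <= 1.
Proof.
move=> bf; apply: norm_le_sqr => //; rewrite expr1n.
by apply: le_trans (state_sq1 f) _; exact: ball_sq.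
Qed.

Lemma ball_bounded (F : int -> obs S) : (forall n, ball (F n)) -> bounded (fun n => phi (F n)).
Proof. by move=> bF; exists 1 => n; exact: ball_norm. Qed.

Lemma state_bounded (F : int -> obs S) w : (forall n, ball (F n)) ->
  bounded (fun n => phi (F n * w)).
Proof.
move=> bF; exists (phi (w ^+ 2) + 1) => n.
by apply: norm_le_succ; [exact: state_sq_ge0|exact: ball_cauchy].
Qed.

Lemma ball_prod I (s : seq I) (F : I -> obs S) : (forall i, ball (F i)) ->
  ball (\prod_(i <- s) F i).
Proof.
by move=> bF; elim: s => [|a s IH]; rewrite ?big_nil ?big_cons; [exact: ball1|exact: ballM].
Qed.

Lemma state_gram I (s : seq I) (c : I -> R) (F : I -> obs S) :
  \sum_(i <- s) \sum_(j <- s) c i * c j * phi (F i * F j) =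
  phi ((\sum_(i <- s) sc (c i) * F i) ^+ 2).
Proof.
rewrite expr2 mulr_suml state_sum; apply: eq_bigr => i _.
rewrite mulr_sumr state_sum; apply: eq_bigr => j _.
by rewrite -[_ * F i * _]mulrA stateZ [F i * (_ * _)]mulrCA stateZ mulrA.
Qed.

Lemma state_avg I (s : seq I) (F : I -> obs S) w :
  avg s (fun i => phi (F i * w)) = phi ((sc (size s)%:R^-1 * \sum_(i <- s) F i) * w).
Proof. by rewrite -mulrA stateZ mulr_suml state_sum. Qed.

Lemma state_avg_sq I (s : seq I) (F : I -> obs S) :
  avg s (fun i => avg s (fun j => phi (F i * F j))) =
  phi ((sc (size s)%:R^-1 * \sum_(i <- s) F i) ^+ 2).
Proof.
rewrite expr2 -state_avg; apply: eq_avg => i.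
by rewrite mulrC -state_avg; apply: eq_avg => j; rewrite mulrC.
Qed.

Lemma state_avg_cauchy I (s : seq I) w (F : I -> obs S) : ball w ->
  avg s (fun i => phi (w * F i)) ^+ 2 <= avg s (fun i => avg s (fun j => phi (F i * F j))).
Proof.
move=> bw; under eq_avg do rewrite mulrC.
by rewrite state_avg state_avg_sq mulrC; exact: ball_cauchy.
Qed.

(** ** Weak limits and projections *)

(** The value [1] is a default for sequences that leave the unit ball. *)
Definition wlim (m : mean R) (F : int -> obs S) : obs S :=
  if pselect (forall n, ball (F n)) is left bF then projT1 (cid (weak_limit m bF)) else 1.

Lemma wlim_ball m F : ball (wlim m F).
Proof. by rewrite /wlim; case: pselect => [bF|_]; [case: cid => f []|exact: ball1]. Qed.

Lemma wlimE m F : (forall n, ball (F n)) -> forall g,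
  phi (wlim m F * g) = m (fun n => phi (F n * g)).
Proof. by rewrite /wlim; case: pselect => // bF _; case: cid => f []. Qed.

End System.
#[global] Hint Resolve wlim_ball : ball.

Section Projections.
Context {R : realType} {S : msys R} (m0 : mean R).
Implicit Types f g u w : obs S.
Local Notation phi := (@state R S).
Local Notation T := (@act R S).
Local Notation sc := (@scal R S).

(** By the mean ergodic theorem, in its weak form, this is the conditional
    expectation onto the functions invariant under the [r]-th power. *)
Definition proj (r : nat) f := wlim m0 (fun k => T (r%:Z * k) f).

(** Weak limits are only determined through their pairings with observables, and
    so is their invariance. *)
Definition invariant (r : nat) u := forall k w, phi (T (r%:Z * k) u * w) = phi (u * w).

Lemma proj_ball r f : ball (proj r f). Proof. exact: wlim_ball. Qed.

Lemma projE r f g : ball f -> phi (proj r f * g) = m0 (fun k => phi (T (r%:Z * k) f * g)).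
Proof. by move=> bf; rewrite wlimE // => n; ball. Qed.

Lemma proj_invariant r f : ball f -> invariant r (proj r f).
Proof.
move=> bf k w; rewrite state_actl !projE //.
rewrite -[RHS](mean_shift m0 k); last by apply: state_bounded => n; ball.
by apply: eq_mean => n; rewrite state_actr opprK -actD -mulrDr addrC.
Qed.

Lemma invariantM r u v : invariant r u -> invariant r v -> invariant r (u * v).
Proof.
move=> iu iv k w; rewrite actM -mulrA iu mulrCA iv; congr phi; ring.
Qed.

Lemma invariant_act r u a : invariant r u -> invariant r (T a u).
Proof. by move=> iu k w; rewrite act_comm state_actl iu -state_actl. Qed.

Lemma invariant_dvd r r' u : (r %| r')%N -> invariant r u -> invariant r' u.
Proof.
by move=> /dvdnP[q ->] iu k w; rewrite PoszM [q%:Z * _]mulrC -mulrA iu.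
Qed.

Lemma invariant1 r : invariant r 1.
Proof. by move=> k w; rewrite act1. Qed.

Lemma proj_adjoint r u f : invariant r u -> ball f -> phi (u * proj r f) = phi (u * f).
Proof.
move=> iu bf; rewrite mulrC projE //.
rewrite -[RHS](mean_const m0); apply: eq_mean => k.
by rewrite state_actl mulrC -mulrN iu mulrC.
Qed.

Lemma proj_state r f : ball f -> phi (proj r f) = phi f.
Proof. by move=> bf; have := proj_adjoint (invariant1 r) bf; rewrite !mul1r. Qed.

Lemma proj_sq r f : ball f -> phi (proj r f ^+ 2) = phi (proj r f * f).
Proof. by move=> bf; rewrite expr2 proj_adjoint //; exact: proj_invariant. Qed.

(** Only the projection of a function correlates with invariant functions. *)
Lemma invariant_cauchy r u f : invariant r u -> ball u -> ball f ->
  phi (u * f) ^+ 2 <= phi (proj r f ^+ 2).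
Proof. by move=> iu bu bf; rewrite -(proj_adjoint iu bf); exact: ball_cauchy. Qed.

(** ** Uniformity seminorms *)

(** The [2^(t+1)]-th power of the uniformity seminorm of order [t + 1], for which
    the innermost average runs over the multiples of [r].  The step [r] arises in
    degree lowering, which produces projections to the functions invariant under
    the [r]-th power; [gow_dilate] removes it. *)
Fixpoint gow (t r : nat) f : R :=
  if t is t'.+1 then m0 (fun h => gow t' r (f * T h f))
  else m0 (fun k => phi (f * T (r%:Z * k) f)).

Lemma gowS t r f : gow t.+1 r f = m0 (fun h => gow t r (f * T h f)).
Proof. by []. Qed.

Lemma gow0E r f : ball f -> gow 0 r f = phi (proj r f ^+ 2).
Proof.
move=> bf; rewrite proj_sq // projE //; apply: eq_mean => k.
by rewrite mulrC.
Qed.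

Lemma gow_bound t r f : ball f -> `|gow t r f| <= 1.
Proof.
elim: t f => [|t IH] f bf /=; apply: mean_bound => n; [apply: ball_norm|apply: IH]; ball.
Qed.

Lemma gow_bounded t r (F : int -> obs S) : (forall n, ball (F n)) ->
  bounded (fun n => gow t r (F n)).
Proof. by move=> bF; exists 1 => n; exact: gow_bound. Qed.

Lemma gow_act t r a f : gow t r (T a f) = gow t r f.
Proof.
elim: t f => [|t IH] f /=; apply: eq_mean => n; rewrite act_comm -actM.
  exact: state_act.
exact: IH.
Qed.

(** The kernels [gow (F i * F j)] are positive definite, as they are means of Gram
    matrices. *)
Lemma gow_gram t r I (s : seq I) (c : I -> R) (F : I -> obs S) :
  (forall i, ball (F i)) ->
  0 <= \sum_(i <- s) \sum_(j <- s) c i * c j * gow t r (F i * F j).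
Proof.
elim: t F => [|t IH] F bF /=.
  have -> : \sum_(i <- s) \sum_(j <- s) c i * c j *
      m0 (fun k => phi (F i * F j * T (r%:Z * k) (F i * F j))) =
      m0 (fun k => \sum_(i <- s) \sum_(j <- s) c i * c j *
      phi ((F i * T (r%:Z * k) (F i)) * (F j * T (r%:Z * k) (F j)))).
    have bd i j : bounded (fun k => c i * c j *
      phi ((F i * T (r%:Z * k) (F i)) * (F j * T (r%:Z * k) (F j)))).
      by apply: boundedM; [bdd|apply: ball_bounded => n; ball].
    rewrite mean_sum => [|i]; last exact: bounded_sum.
    apply: eq_bigr => i _; rewrite mean_sum => [|j //].
    apply: eq_bigr => j _; rewrite mean_scale; last by apply: ball_bounded => n; ball.
    by congr (_ * _); apply: eq_mean => k; rewrite actM; congr phi; ring.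
  apply: mean_ge0 => [|n]; last by rewrite state_gram state_sq_ge0.
  apply: bounded_sum => i; apply: bounded_sum => j.
  by apply: boundedM; [bdd|apply: ball_bounded => n; ball].
have -> : \sum_(i <- s) \sum_(j <- s) c i * c j *
    m0 (fun h => gow t r (F i * F j * T h (F i * F j))) =
    m0 (fun h => \sum_(i <- s) \sum_(j <- s) c i * c j *
    gow t r ((F i * T h (F i)) * (F j * T h (F j)))).
  have bd i j : bounded (fun h => c i * c j * gow t r ((F i * T h (F i)) * (F j * T h (F j)))).
    by apply: boundedM; [bdd|apply: gow_bounded => n; ball].
  rewrite mean_sum => [|i]; last exact: bounded_sum.
  apply: eq_bigr => i _; rewrite mean_sum => [|j //].
  apply: eq_bigr => j _; rewrite mean_scale; last by apply: gow_bounded => n; ball.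
  by congr (_ * _); apply: eq_mean => k; rewrite actM; congr gow; ring.
apply: mean_ge0 => [|n]; last by apply: IH => i; ball.
apply: bounded_sum => i; apply: bounded_sum => j.
by apply: boundedM; [bdd|apply: gow_bounded => n; ball].
Qed.

Lemma gow_pos_def t r f : ball f -> pos_def (fun h => gow t r (f * T h f)).
Proof.
move=> bf; split=> [h|s].
  by rewrite -(gow_act _ _ h) actM -actD subrr act0 mulrC.
have := @gow_gram t r _ s (fun p => p.1) (fun p => T p.2 f) (fun p => ball_act p.2 bf).
congr (0 <= _); apply: eq_bigr => p _; apply: eq_bigr => q _; congr (_ * _).
by rewrite -[RHS](gow_act _ _ q.2) actM -actD addrC subrK mulrC.
Qed.

Lemma act_pos_def (r : nat) f : pos_def (fun k => phi (f * T (r%:Z * k) f)).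
Proof.
split=> [h|s]; first by rewrite state_actr mulrN opprK mulrC.
have := state_sq_ge0 (\sum_(p <- s) sc p.1 * T (r%:Z * p.2) f).
rewrite -state_gram; congr (0 <= _); apply: eq_bigr => p _; apply: eq_bigr => q _.
by congr (_ * _); rewrite mulrC !state_actl -actD; congr phi; congr (_ * T _ _); ring.
Qed.

Lemma gow_ge0 t r f : ball f -> 0 <= gow t r f.
Proof.
case: t => [|t] bf; first by rewrite gow0E // state_sq_ge0.
by apply: pos_def_mean_ge0; exact: gow_pos_def.
Qed.

Lemma gow_shiftB t r f k l : gow t r (f * T (k - l) f) = gow t r (T k f * T l f).
Proof. by rewrite -[LHS](gow_act _ _ l) actM -actD addrC subrK mulrC. Qed.

Lemma gow_energy t r f (s : seq int) : ball f -> (0 < size s)%N ->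
  gow t.+1 r f <= avg s (fun k => avg s (fun l => gow t r (T k f * T l f))).
Proof.
move=> bf s0; have := mean_le_energy m0 (gow_pos_def t r bf) s0.
by under eq_avg do under eq_avg do rewrite gow_shiftB.
Qed.

Lemma sum_pos_def (G : zmodType) I (s : seq I) (K : I -> G -> R) :
  (forall i, pos_def (K i)) -> pos_def (fun v => \sum_(i <- s) K i v).
Proof.
move=> pK; split=> [v|u]; first by apply: eq_bigr => i _; case: (pK i) => ->.
have -> : energy (fun v => \sum_(i <- s) K i v) u = \sum_(i <- s) energy (K i) u.
  rewrite /energy [RHS]exchange_big; apply: eq_bigr => p _ /=.
  by rewrite [RHS]exchange_big; apply: eq_bigr => q _; rewrite mulr_sumr.
by apply: sumr_ge0 => i _; case: (pK i).
Qed.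

(** One set of shifts serves several functions, because the sum of their kernels is
    again positive definite. *)
Lemma gow_energy_family t r I (u : seq I) (F : I -> obs S) e :
  (forall i, ball (F i)) -> 0 < e ->
  exists s : seq int, (0 < size s)%N /\
    \sum_(i <- u) avg s (fun k => avg s (fun l => gow t r (T k (F i) * T l (F i)))) <=
    \sum_(i <- u) gow t.+1 r (F i) + e.
Proof.
move=> bF e0.
have pd := sum_pos_def u (fun i => gow_pos_def t r (bF i)).
have [s [s0 sP]] := energy_le_mean pd e0; exists s; split=> //.
have := sP m0; rewrite mean_sum => [|i]; last by apply: gow_bounded => n; ball.
apply: le_trans; apply: le_of_eq.
rewrite -avg_sum; apply: eq_avg => k; rewrite -avg_sum; apply: eq_avg => l.
by apply: eq_bigr => i _; rewrite gow_shiftB.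
Qed.

(** *** Box averages *)

Fixpoint box (b : seq (seq int)) : seq (seq int) :=
  if b is s :: b' then [seq h :: l | h <- s, l <- box b'] else [:: [::]].

Lemma avg_box s b (x : seq int -> R) :
  avg (box (s :: b)) x = avg s (fun h => avg (box b) (fun l => x (h :: l))).
Proof.
rewrite /avg /= size_allpairs natrM invfM big_allpairs_dep -mulrA; congr (_ * _).
by rewrite -mulr_sumr.
Qed.

Definition box_pos (b : seq (seq int)) := all (fun s => 0 < size s)%N b.

Lemma size_box b : box_pos b -> (0 < size (box b))%N.
Proof.
by elim: b => //= s b IH /andP[s0 /IH b0]; rewrite size_allpairs muln_gt0 s0.
Qed.

(** The product of the [2^t] translates of [f] over the vertices of a cube: every
    direction offers the shift from [hs] or the one from [hs']. *)
Fixpoint cube f (hs hs' : seq int) : obs S :=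
  match hs, hs' with
  | h :: hs1, h' :: hs1' => cube (T h f * T h' f) hs1 hs1'
  | _, _ => f
  end.

Lemma cube_ball f hs hs' : ball f -> ball (cube f hs hs').
Proof. by elim: hs hs' f => [|h hs IH] [|h' hs'] f bf //=; apply: IH; ball. Qed.

(** Means in several variables do not commute, but finite averages do.  Averages
    over finite boxes bound the seminorms from above ([gow_le_cube_avg]) and come
    arbitrarily close to them ([cube_avg_le_gow]), so that the seminorms can be
    handled through finite averages. *)
Definition cube_avg (b : seq (seq int)) (Y : obs S -> R) f : R :=
  avg (box b) (fun hs => avg (box b) (fun hs' => Y (cube f hs hs'))).

Lemma cube_avg_cons s b Y f : cube_avg (s :: b) Y f =
  avg s (fun h => avg s (fun h' => cube_avg b Y (T h f * T h' f))).
Proof.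
rewrite /cube_avg avg_box; apply: eq_avg => h.
under eq_avg do rewrite avg_box /=.
by rewrite avg_exchange.
Qed.

Lemma gow_le_cube_avg b t r f : ball f -> box_pos b ->
  gow (size b + t) r f <= cube_avg b (gow t r) f.
Proof.
elim: b f => [|s b IH] f bf; first by rewrite /cube_avg !avg_seq1.
move=> /andP[s0 pb]; rewrite cube_avg_cons; apply: le_trans (gow_energy _ _ bf s0) _.
by apply: avg_le => h; apply: avg_le => h'; apply: IH => //; ball.
Qed.

(** Choosing the shifts of the first direction splits each function into several,
    for which the shifts of the other directions have to be chosen jointly; hence
    the family. *)
Lemma cube_avg_le_gow_family t r I (u : seq I) (F : I -> obs S) e :
  (forall i, ball (F i)) -> 0 < e ->
  exists b, [/\ size b = t, box_pos b &
    \sum_(i <- u) cube_avg b (gow 0 r) (F i) <= \sum_(i <- u) gow t r (F i) + e].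
Proof.
elim: t I u F e => [|t IH] I u F e bF e0.
  exists [::]; split=> //; under eq_bigr do rewrite /cube_avg !avg_seq1 /=.
  by rewrite lerDl ltW.
have e2 : 0 < e / 2 by lra.
have [s [s0 sP]] := gow_energy_family t r u bF e2.
pose u' := [seq (i, kl) | i <- u, kl <- [seq (k, l) | k <- s, l <- s]].
pose F' p := T p.2.1 (F p.1) * T p.2.2 (F p.1).
pose c := (size s)%:R ^+ 2 : R.
have c0 : 0 < c by rewrite exprn_gt0 // ltr0n.
have [b [sb pb bP]] := IH _ u' F' (c * (e / 2)) (fun p => ballM (ball_act _ (bF _)) (ball_act _ (bF _))) (mulr_gt0 c0 e2).
have E (Y : obs S -> R) : \sum_(p <- u') Y (F' p) =
    c * \sum_(i <- u) avg s (fun k => avg s (fun l => Y (T k (F i) * T l (F i)))).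
  rewrite big_allpairs_dep mulr_sumr; apply: eq_bigr => i _.
  rewrite big_allpairs_dep /avg -mulr_sumr /c; have n0 : (size s)%:R != 0 :> R.
    by rewrite pnatr_eq0 -lt0n.
  by rewrite /F' /=; field.
exists (s :: b); split; [by rewrite /= sb|by rewrite /= s0|].
under eq_bigr do rewrite cube_avg_cons.
rewrite (E (cube_avg b (gow 0 r))) (E (gow t r)) -mulrDr ler_pM2l // in bP.
lra.
Qed.

Lemma cube_avg_le_gow t r f c : ball f ->
  (forall b, size b = t -> box_pos b -> c <= cube_avg b (gow 0 r) f) -> c <= gow t r f.
Proof.
move=> bf h; apply/ler_addgt0Pr => e e0.
have [b [sb pb]] := cube_avg_le_gow_family t r [:: tt] (fun=> bf) e0.
by rewrite !big_seq1; apply: le_trans; exact: h.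
Qed.

(** Exchanging the two averages in the second order seminorm turns the step [r]
    of the inner one into a dilation of the outer one. *)
Lemma gow1_dilate r f : ball f -> (0 < r)%N -> gow 1 r f <= r%:R * gow 1 1 f.
Proof.
move=> bf r0; pose tau k := gow 0 1 (f * T k f).
apply: (@le_trans _ _ (m0 (fun k => tau (r%:Z * k)))); last first.
  by apply: mean_dilate => // [|n]; [exact: gow_pos_def|apply: gow_ge0; ball].
have pdt : pos_def (fun k => tau (r%:Z * k)).
  have [ev pt] := gow_pos_def 0 1 bf; split=> [v|s]; first by rewrite /tau mulrN ev.
  have := pt [seq (p.1, r%:Z * p.2) | p <- s]; rewrite /energy big_map; congr (0 <= _).
  by apply: eq_bigr => p _; rewrite big_map; apply: eq_bigr => q _ /=; rewrite mulrBr.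
apply/ler_addgt0Pr => e e0; have [s [s0 sP]] := energy_le_mean pdt e0.
apply: le_trans (sP m0).
have -> : avg s (fun k => avg s (fun l => tau (r%:Z * (k - l)))) =
    m0 (fun h => avg s (fun k => avg s (fun l =>
      phi (f * T h f * T (r%:Z * (k - l)) (f * T h f))))).
  have bd k l : bounded (fun h => phi (f * T h f * T (r%:Z * (k - l)) (f * T h f))).
    by apply: ball_bounded => n; ball.
  rewrite (mean_avg2 m0 s (y := fun k l h =>
      phi (f * T h f * T (r%:Z * (k - l)) (f * T h f)))) //.
  apply: eq_avg => k.
  apply: eq_avg => l; apply: eq_mean => h; rewrite mul1r !actM act_comm; congr phi; ring.
apply: mean_mono => [||h].
- apply: (@gow_bounded 0 r (fun h => f * T h f)) => n; ball.
- apply: (@bounded_avg2 _ _ s (fun k l h =>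
      phi (f * T h f * T (r%:Z * (k - l)) (f * T h f)))) => k l.
  apply: ball_bounded => n; ball.
- exact: (mean_le_energy m0 (act_pos_def r (f * T h f)) s0).
Qed.

Lemma gow_dilate t r f : ball f -> (0 < r)%N -> gow t.+1 r f <= r%:R * gow t.+1 1 f.
Proof.
move=> bf r0; elim: t f bf => [|t IH] f bf; first exact: gow1_dilate.
rewrite (gowS t.+1 r) (gowS t.+1 1) -mean_scale; last by apply: gow_bounded => n; ball.
apply: mean_mono => [||h]; last by apply: IH; ball.
- by apply: gow_bounded => n; ball.
- by apply: boundedM; [bdd|apply: gow_bounded => n; ball].
Qed.

Lemma state_le_gow f : ball f -> phi f ^+ 2 <= gow 0 1 f.
Proof.
by move=> bf; rewrite gow0E // -(proj_state 1 bf); exact: state_sq1.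
Qed.

Lemma gow_mono t f : ball f -> gow t 1 f ^+ 2 <= gow t.+1 1 f.
Proof.
elim: t f => [|t IH] f bf; rewrite ?(gowS 0) ?(gowS t.+1) ?(gowS t).
  rewrite /=; apply: le_trans (mean_sq _ _) _; first by apply: ball_bounded => n; ball.
  apply: mean_mono => [||h]; first by apply: boundedX; apply: ball_bounded => n; ball.
    by apply: (@gow_bounded 0 1 (fun h => f * T h f)) => n; ball.
  by rewrite mul1r; apply: state_le_gow; ball.
apply: le_trans (mean_sq _ _) _; first by apply: gow_bounded => n; ball.
apply: mean_mono => [||h]; first by apply: boundedX; apply: gow_bounded => n; ball.
  apply: (@gow_bounded t.+1 1 (fun h => f * T h f)) => n; ball.
by apply: IH; ball.
Qed.

Lemma gow_mono_iter t k f c : ball f -> 0 <= c -> c <= gow t 1 f ->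
  c ^+ (2 ^ k) <= gow (t + k) 1 f.
Proof.
move=> bf c0 h; elim: k => [|k IH]; first by rewrite expn0 addn0 expr1.
rewrite addnS expnSr exprM; apply: le_trans (gow_mono _ bf).
by rewrite ler_pXn2r // ?nnegrE ?exprn_ge0 ?gow_ge0.
Qed.

End Projections.

(** * The Gowers-Cauchy-Schwarz inequality *)

Section GowersCauchySchwarz.
Context {R : realType} {S : msys R}.
Implicit Types (f g : obs S) (W c : seq int -> obs S).
Local Notation phi := (@state R S).
Local Notation T := (@act R S).

(** As [cube], for a function of several parameters in place of the translates of
    a single function, see [cube_wcube]. *)
Fixpoint wcube W (hs hs' : seq int) : obs S :=
  match hs, hs' with
  | h :: hs1, h' :: hs1' => wcube (fun l => W (h :: l) * W (h' :: l)) hs1 hs1'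
  | _, _ => W [::]
  end.

Lemma wcubeM W W' hs hs' :
  wcube (fun l => W l * W' l) hs hs' = wcube W hs hs' * wcube W' hs hs'.
Proof.
elim: hs hs' W W' => [|h hs IH] [|h' hs'] W W' //=.
by rewrite -IH; congr wcube; apply/funext => l; ring.
Qed.

Lemma wcube_act a W hs hs' : wcube (fun l => T a (W l)) hs hs' = T a (wcube W hs hs').
Proof.
elim: hs hs' W => [|h hs IH] [|h' hs'] W //=.
by rewrite -IH; congr wcube; apply/funext => l; rewrite actM.
Qed.

Lemma wcube_ball W hs hs' : (forall l, ball (W l)) -> ball (wcube W hs hs').
Proof. by elim: hs hs' W => [|h hs IH] [|h' hs'] W bW //=; apply: IH => l; ball. Qed.

Lemma cube_wcube f hs hs' : cube f hs hs' = wcube (fun l => T (\sum_(h <- l) h) f) hs hs'.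
Proof.
elim: hs hs' f => [|h hs IH] [|h' hs'] f /=; rewrite ?big_nil ?act0 // IH.
congr wcube; apply/funext => l; rewrite !big_cons actM -!actD.
by rewrite [_ + h]addrC [_ + h']addrC.
Qed.

Lemma cubeM f g hs hs' : cube (f * g) hs hs' = cube f hs hs' * cube g hs hs'.
Proof.
by rewrite !cube_wcube -wcubeM; congr wcube; apply/funext => l; rewrite actM.
Qed.

Lemma cube_act a f hs hs' : cube (T a f) hs hs' = T a (cube f hs hs').
Proof.
by rewrite !cube_wcube -wcube_act; congr wcube; apply/funext => l; rewrite act_comm.
Qed.

Lemma cube1 hs hs' : cube 1 hs hs' = 1 :> obs S.
Proof. by elim: hs hs' => [|h hs IH] [|h' hs'] //=; rewrite !act1 mulr1. Qed.

(** A product of bounded functions each of which ignores one of the [t]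
    variables; such factors are invisible to the uniformity seminorms. *)
Fixpoint lower (t : nat) c : Prop :=
  if t is t'.+1 then exists (c1 : seq int -> obs S) (c2 : int -> seq int -> obs S),
    [/\ forall h l, c (h :: l) = c1 l * c2 h l,
    forall l, ball (c1 l) & forall h, lower t' (c2 h)]
  else c [::] = 1.

Lemma lowerM t c c' : lower t c -> lower t c' -> lower t (fun l => c l * c' l).
Proof.
elim: t c c' => [|t IH] c c' /=; first by move=> -> ->; rewrite mulr1.
move=> [c1 [c2 [e b L]]] [c1' [c2' [e' b' L']]].
exists (fun l => c1 l * c1' l), (fun h l => c2 h l * c2' h l); split.
- by move=> h l; rewrite e e'; ring.
- by move=> l; ball.
- by move=> h; exact: IH.
Qed.

Lemma lower_act t a c : lower t c -> lower t (fun l => T a (c l)).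
Proof.
elim: t c => [|t IH] c /=; first by move=> ->; rewrite act1.
move=> [c1 [c2 [e b L]]]; exists (fun l => T a (c1 l)), (fun h l => T a (c2 h l)).
by split=> [h l|l|h]; [rewrite e actM|ball|exact: IH].
Qed.

Lemma lower_ball t c l : lower t c -> size l = t -> ball (c l).
Proof.
elim: t c l => [|t IH] c l /=; first by move=> e /size0nil ->; rewrite e; exact: ball1.
move=> [c1 [c2 [e b L]]]; case: l => // h l [sl].
by rewrite e; apply: ballM => //; exact: IH.
Qed.

(** The Cauchy-Schwarz inequality in the first variable removes the factor [c1] of
    [c], which ignores it, at the price of doubling the first variable.  For each
    pair of its values the induction treats the other variables. *)
Lemma gowers_cauchy_schwarz (b : seq (seq int)) W c :
  box_pos b -> (forall l, ball (W l)) -> lower (size b) c ->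
  avg (box b) (fun l => phi (W l * c l)) ^+ (2 ^ size b) <=
  avg (box b) (fun hs => avg (box b) (fun hs' => phi (wcube W hs hs'))).
Proof.
elim: b W c => [|s b IH] W c; first by rewrite !avg_seq1 /= => _ _ ->; rewrite mulr1.
move=> /andP[s0 pb] bW [c1 [c2 [e bc1 L]]].
pose y h h' := avg (box b) (fun l =>
  phi (W (h :: l) * W (h' :: l) * (c2 h l * c2 h' l))).
have sq : avg (box (s :: b)) (fun l => phi (W l * c l)) ^+ 2 <=
    avg s (fun h => avg s (y h)).
  rewrite avg_box avg_exchange; apply: le_trans (avg_sq _ _) _.
  apply: (@le_trans _ _ (avg (box b) (fun l => avg s (fun h => avg s (fun h' =>
    phi (W (h :: l) * W (h' :: l) * (c2 h l * c2 h' l))))))).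
    apply: avg_le => l; have := state_avg_cauchy s (fun h => W (h :: l) * c2 h l) (bc1 l).
    under eq_avg do rewrite mulrCA -e.
    move=> h; apply: le_trans h _; apply: le_of_eq.
    by apply: eq_avg => h; apply: eq_avg => h'; congr phi; ring.
  by rewrite avg_exchange; apply: avg_le => h; rewrite avg_exchange.
rewrite /= expnS exprM; apply: le_trans (_ : avg s (fun h => avg s (y h)) ^+ (2 ^ size b) <= _).
  by rewrite lerXn2r ?nnegrE ?sqr_ge0 // (le_trans _ sq) ?sqr_ge0.
apply: le_trans (avg_pow2 _ _ _) _; rewrite avg_box; apply: avg_le => h.
under [leRHS]eq_avg do rewrite avg_box /=.
rewrite [leRHS]avg_exchange; apply: le_trans (avg_pow2 _ _ _) _; apply: avg_le => h'.
apply: (IH (fun l => W (h :: l) * W (h' :: l)) (fun l => c2 h l * c2 h' l) pb).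
  by move=> l; exact: ballM.
exact: (lowerM (L h) (L h')).
Qed.

Lemma size_mem_box b l : l \in box b -> size l = size b.
Proof.
elim: b l => [|s b IH] l; first by rewrite inE => /eqP ->.
by case/allpairsP=> -[h k] /= [_ kb ->]; rewrite /= (IH _ kb).
Qed.

(** A vertex other than [W hs] takes some entry from [hs'], which is fixed, and
    therefore ignores the corresponding entry of [hs]. *)
Lemma wcube_lower W hs' : (forall l, ball (W l)) ->
  exists2 c, lower (size hs') c &
    forall hs, size hs = size hs' -> wcube W hs hs' = W hs * c hs.
Proof.
elim: hs' W => [|h' k IH] W bW.
  by exists (fun=> 1) => // hs /size0nil ->; rewrite mulr1.
have [c2 c2P] := choice (fun h => let: ex_intro2 c c1 c2 := IH (fun l => W (h :: l)) (fun l => bW _)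
   in ex_intro (fun c => lower (size k) c /\ forall hs, size hs = size k ->
     wcube (fun l => W (h :: l)) hs k = W (h :: hs) * c hs) c (conj c1 c2)).
pose c1 l := wcube (fun l => W (h' :: l)) l k.
exists (fun l => if l is h :: l' then c1 l' * c2 h l' else 1).
  exists c1, c2; split=> // [l|h]; first by apply: wcube_ball.
  by case: (c2P h).
move=> [|h hs] //= [shs]; rewrite wcubeM.
by have [_ ->] := c2P h; rewrite // -/(c1 hs); ring.
Qed.

End GowersCauchySchwarz.

(** * Functions of compact type *)

Section Tame.
Context {R : realType} {S : msys R} (m0 : mean R).
Implicit Types (f g u F : obs S).
Local Notation phi := (@state R S).
Local Notation T := (@act R S).
Local Notation sc := (@scal R S).
Local Notation proj := (proj m0).
Local Notation gow := (gow m0).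

(** The squared norm of [sum W_i (x) T^a_i g (x) ...], in the tensor product over
    the invariant functions. *)
Fixpoint tensor_norm (I : Type) (L : seq (obs S * (I -> int))) (s : seq I)
    (W : I -> obs S) : R :=
  if L is (g, a) :: L' then
    m0 (fun k => tensor_norm L' s (fun i => W i * T (a i + k) g))
  else phi ((\sum_(i <- s) W i) ^+ 2).

Fixpoint all_ball (gs : seq (obs S)) : Prop :=
  if gs is g :: gs' then ball g /\ all_ball gs' else True.

(** The orbit of [F] is the image of the orbit of a tensor product of functions
    under a map of norm at most [sqrt C] that is linear over the invariant
    functions: only the invariant functions [E(g T^a g)] matter when [F] occurs
    in an average. In an ergodic system such functions are combinations of
    eigenfunctions, and the [E(g T^a g)] are constants; over the invariant functions
    the same idea works in every system. *)
Definition tame (C : R) F := exists2 gs : seq (obs S), all_ball gs &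
  forall (I : Type) (s : seq I) (W : I -> obs S) (a : I -> int),
    phi ((\sum_(i <- s) W i * T (a i) F) ^+ 2) <=
    C * tensor_norm [seq (g, a) | g <- gs] s W.

Lemma sum_sq_bound I (s : seq I) (W B : I -> obs S) : (forall i, ball (B i)) ->
  `|phi ((\sum_(i <- s) W i * B i) ^+ 2)| <=
  \sum_(i <- s) \sum_(j <- s) (phi ((W i * W j) ^+ 2) + 1).
Proof.
move=> bB; rewrite expr2 mulr_suml state_sum; apply: le_trans (ler_norm_sum _ _ _) _.
apply: ler_sum => i _; rewrite mulr_sumr state_sum; apply: le_trans (ler_norm_sum _ _ _) _.
apply: ler_sum => j _; apply: norm_le_succ; first exact: state_sq_ge0.
have -> : W i * B i * (W j * B j) = (B i * B j) * (W i * W j) by ring.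
by apply: ball_cauchy; ball.
Qed.

Fixpoint balls I (L : seq (obs S * (I -> int))) : Prop :=
  if L is p :: L' then ball p.1 /\ balls L' else True.

Lemma balls_cat I (L L' : seq (obs S * (I -> int))) :
  balls L -> balls L' -> balls (L ++ L').
Proof. by elim: L => //= p L IH [bp /IH]; tauto. Qed.

Lemma balls_map I (gs : seq (obs S)) (a : I -> int) :
  all_ball gs -> balls [seq (g, a) | g <- gs].
Proof. by elim: gs => //= g gs IH [bg /IH]. Qed.

Lemma all_ball_cat gs gs' : all_ball gs -> all_ball gs' -> all_ball (gs ++ gs').
Proof. by elim: gs => //= p L IH [bp /IH]; tauto. Qed.

Lemma tensor_norm_bound I (L : seq (obs S * (I -> int))) s (W B : I -> obs S) :
  balls L -> (forall i, ball (B i)) ->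
  `|tensor_norm L s (fun i => W i * B i)| <=
  \sum_(i <- s) \sum_(j <- s) (phi ((W i * W j) ^+ 2) + 1).
Proof.
elim: L B => [|[g a] L IH] B /=; first by move=> _; exact: sum_sq_bound.
move=> [bg bL] bB; apply: mean_bound => k.
have -> : (fun i => W i * B i * T (a i + k) g) = (fun i => W i * (B i * T (a i + k) g)).
  by apply/funext => i; rewrite mulrA.
by apply: IH => // i; apply: ballM => //; exact: ball_act.
Qed.

Lemma tensor_norm_bounded I (L : seq (obs S * (I -> int))) s W (B : int -> I -> obs S) :
  balls L -> (forall k i, ball (B k i)) ->
  bounded (fun k => tensor_norm L s (fun i => W i * B k i)).
Proof. by move=> bL bB; eexists => k; apply: tensor_norm_bound. Qed.

Lemma tensor_norm_ge0 I (L : seq (obs S * (I -> int))) s W : balls L ->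
  0 <= tensor_norm L s W.
Proof.
elim: L W => [|[g a] L IH] W /=; first by move=> _; exact: state_sq_ge0.
move=> [bg bL]; apply: mean_ge0 => [|k]; last exact: IH.
by apply: tensor_norm_bounded => // k i; exact: ball_act.
Qed.

(** Each factor of [L] enters both sides in the same way, by induction on [L].
    Therefore the product of two dominated functions is dominated by the
    concatenated tensor product, as [tameM] states. *)
Lemma tensor_norm_cat I (L L' : seq (obs S * (I -> int))) s (X : I -> obs S) C :
  0 <= C -> balls L -> balls L' -> (forall i, ball (X i)) ->
  (forall W, phi ((\sum_(i <- s) W i * X i) ^+ 2) <= C * tensor_norm L' s W) ->
  forall W, tensor_norm L s (fun i => W i * X i) <= C * tensor_norm (L ++ L') s W.
Proof.
move=> C0 + bL' bX h; elim: L => [|[g a] L IH] /=; first by move=> _ W; exact: h.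
move=> [bg bL1] W.
have bLL := balls_cat bL1 bL'.
have bd : bounded (fun k => tensor_norm (L ++ L') s (fun i => W i * T (a i + k) g)).
  by apply: tensor_norm_bounded => // k i; ball.
rewrite -mean_scale //; apply: mean_mono => [||k]; last 1 first.
- apply: le_trans (IH bL1 _); apply: le_of_eq.
  by congr tensor_norm; apply/funext => i; rewrite mulrAC.
- rewrite (_ : (fun k => _) = fun k => tensor_norm L s (fun i => W i * (X i * T (a i + k) g))).
    by apply: tensor_norm_bounded => // k i; ball.
  by apply/funext => k; congr tensor_norm; apply/funext => i; rewrite mulrA.
- by apply: boundedM => //; bdd.
Qed.

Lemma tameM C C' F F' : 0 <= C -> 0 <= C' -> ball F -> ball F' ->
  tame C F -> tame C' F' -> tame (C * C') (F * F').
Proof.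
move=> C0 C0' bF bF' [gs bgs h] [gs' bgs' h']; exists (gs ++ gs').
  exact: all_ball_cat.
move=> I s W a; under eq_bigr do rewrite actM [T (a _) F * _]mulrC mulrA.
apply: le_trans (h _ _ _ _) _; rewrite -mulrA ler_wpM2l // map_cat.
apply: (tensor_norm_cat C0' (balls_map a bgs) (balls_map a bgs')) => [i|W'].
  exact: ball_act.
exact: h'.
Qed.

Lemma tame_act C z F : 0 <= C -> tame C F -> tame C (T z F).
Proof.
move=> C0 [gs bgs h]; exists gs => // I s W a.
under eq_bigr do rewrite -actD; apply: le_trans (h _ _ _ _) _; rewrite ler_wpM2l //.
elim: gs bgs W {h} => //= g gs IH [bg bgs1] W.
have bd (a' : I -> int) : bounded (fun k => tensor_norm [seq (g, a') | g <- gs] s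
    (fun i => W i * T (a' i + k) g)).
  by apply: (tensor_norm_bounded s W (balls_map a' bgs1)) => k i; exact: ball_act.
rewrite -(mean_shift m0 z (bd a)); apply: mean_mono => [||k]; first exact: bd.
  exact: (bounded_comp (fun k => k + z) (bd a)).
apply: le_trans (IH bgs1 _) _; apply: le_of_eq.
congr tensor_norm; apply/funext => i; congr (_ * T _ _); ring.
Qed.

Lemma tame_mono C C' F : C <= C' -> tame C F -> tame C' F.
Proof.
move=> CC [gs bgs h]; exists gs => // I s W a; apply: le_trans (h _ _ _ _) _.
by rewrite ler_wpM2r // tensor_norm_ge0 //; exact: (balls_map a bgs).
Qed.

Lemma tame_cube C F hs hs' t : 1 <= C -> ball F -> size hs = t -> tame C F ->
  tame (C ^+ (2 ^ t)) (cube F hs hs').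
Proof.
elim: hs hs' F C t => [|h hs IH] [|h' hs'] F C t C1 bF <- tF /=.
- by rewrite expn0 expr1.
- by rewrite expn0 expr1.
- by apply: tame_mono tF; rewrite ler_eXnr // expn_gt0.
have C0 : 0 <= C by lra.
rewrite expnS exprM; apply: IH => //; first by rewrite exprn_ege1.
  by ball.
by rewrite expr2; apply: tameM; [..|exact: tame_act|exact: tame_act]; ball.
Qed.

(** An invariant function of the [r]-th power is its own majorant, because its
    orbit returns to itself with frequency [1 / r]. *)
Lemma invariant_tame r u : (0 < r)%N -> ball u -> invariant r u -> tame r%:R u.
Proof.
move=> r0 bu iu; exists [:: u] => [|I s W a /=]; first by [].
pose x k := phi ((\sum_(i <- s) W i * T (a i + k) u) ^+ 2).
have bx : bounded x.
  by apply: (@tensor_norm_bounded I [::] s W (fun k i => T (a i + k) u)) => // k i; ball.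
have x0 k : 0 <= x k by exact: state_sq_ge0.
pose s' := [seq i%:Z | i <- iota 0 r].
have s0 : (0 < size s')%N by rewrite size_map size_iota.
have xr k : x (r%:Z * k) = x 0.
  rewrite /x !expr2 !mulr_suml !state_sum; apply: eq_bigr => i _.
  rewrite !mulr_sumr !state_sum; apply: eq_bigr => j _; rewrite !addr0.
  have iuu := invariantM (invariant_act (a i) iu) (invariant_act (a j) iu).
  transitivity (phi (T (r%:Z * k) (T (a i) u * T (a j) u) * (W i * W j))).
    by rewrite actM -!actD ![a _ + _]addrC; congr phi; ring.
  by rewrite iuu; congr phi; ring.
have x0E : phi ((\sum_(i <- s) W i * T (a i) u) ^+ 2) = x 0.
  by congr phi; congr (_ ^+ 2); apply: eq_bigr => i _; rewrite addr0.
rewrite x0E -/x (mean_avg_shift m0 s0 bx) -mean_scale; last first.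
  by apply: (@bounded_avg _ _ _ (fun h n => x (n + h))) => h; exact: bounded_comp bx.
apply: mean_ge => [|n].
  apply: boundedM; first bdd.
  by apply: (@bounded_avg _ _ _ (fun h n => x (n + h))) => h; exact: bounded_comp bx.
rewrite avg_map /avg size_iota mulVKf ?pnatr_eq0 -?lt0n //.
rewrite -(sum_residues r0 (- n) (fun=> x 0)); apply: ler_sum => i _ /=.
case: ifP => // /dvdzP[q hq]; rewrite -(xr (- q)).
by rewrite (_ : r%:Z * - q = n + i%:Z) //; lia.
Qed.

(** Pairing with [f] gives back the seminorm ([gow1_dual]), and translates depend
    on the shift only through projections to invariant functions ([dual_act]),
    which makes this function tame. *)
Definition dual f := wlim m0 (fun k => proj 1 (f * T k f) * T k f).

Lemma dual_ball f : ball (dual f). Proof. exact: wlim_ball. Qed.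

Lemma dualE f w : ball f ->
  phi (dual f * w) = m0 (fun k => phi (proj 1 (f * T k f) * T k f * w)).
Proof. by move=> bf; rewrite wlimE // => k; apply: ballM; [exact: proj_ball|ball]. Qed.

Lemma gow1_dual f : ball f -> gow 1 1 f = phi (f * dual f).
Proof.
move=> bf; rewrite mulrC dualE // gowS; apply: eq_mean => k.
by rewrite gow0E ?proj_sq; [congr phi; ring|ball|ball].
Qed.

Lemma proj_act r z f w : ball f -> phi (T z (proj r f) * w) = phi (proj r (T z f) * w).
Proof.
move=> bf; rewrite state_actl !projE //; last ball.
by apply: eq_mean => k; rewrite state_actr opprK act_comm.
Qed.

Lemma dual_act f z w : ball f ->
  phi (T z (dual f) * w) = m0 (fun k => phi (proj 1 (T z f * T k f) * T k f * w)).
Proof.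
move=> bf; rewrite state_actl dualE //.
rewrite -(mean_shift m0 (- z)); last first.
  apply: (@state_bounded _ _ (fun k => proj 1 (f * T k f) * T k f)) => k.
  by apply: ballM; [exact: proj_ball|ball].
apply: eq_mean => k; set p := proj 1 _.
have -> : phi (p * T (k - z) f * T (- z) w) = phi (T z p * (T k f * w)).
  rewrite -[LHS](state_act z) !actM -!actD subrr act0 [z + _]addrC subrK.
  by congr phi; ring.
rewrite /p proj_act; last by ball.
by rewrite actM -actD [z + _]addrC subrK mulrA.
Qed.

(** Let [N] be the norm to be bounded, [N = phi (X * X)].  Expanding one factor [X]
    by [dual_act] and then the projections in it writes [N] as an iterated mean of
    correlations of [T^k f * T^(j + k) f * X] with [sum_i W_i * T^(a_i + j) f].  The
    Cauchy-Schwarz inequality bounds [N ^+ 2] by [N] times the tensor norm. *)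
Lemma dual_tame f : ball f -> tame 1 (dual f).
Proof.
move=> bf; exists [:: f] => [|I s W a]; first by [].
rewrite mul1r /=; set X := \sum_(i <- s) _.
pose y k := phi ((\sum_(i <- s) W i * T (a i + k) f) ^+ 2).
have by_ : bounded y.
  by apply: (@tensor_norm_bounded I [::] s W (fun k i => T (a i + k) f)) => // k i; ball.
rewrite -/y; set E := m0 y; set N := phi _.
have N0 : 0 <= N by exact: state_sq_ge0.
have E0 : 0 <= E by apply: mean_ge0 => // k; exact: state_sq_ge0.
suff h : N ^+ 2 <= N * E.
  have [n0|n0] := ltP 0 N; last by apply: le_trans E0.
  by rewrite expr2 ler_pM2l in h.
have bz k (i : I) : bounded (fun j => phi (T j (T (a i) f * T k f) * (X * T k f * W i))).
  by apply: state_bounded => j; ball.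
pose z k := \sum_(i <- s) phi (proj 1 (T (a i) f * T k f) * (T k f * (W i * X))).
have NE : N = m0 z.
  rewrite /N expr2 {1}/X mulr_suml state_sum.
  rewrite /z mean_sum => [|i]; last first.
    rewrite (_ : (fun k => _) = (fun k => phi (proj 1 (T (a i) f * T k f) * T k f * (W i * X)))).
      by apply: state_bounded => k; apply: ballM; [exact: proj_ball|ball].
    by apply/funext => k; rewrite mulrA.
  apply: eq_bigr => i _; rewrite [W i * _]mulrC -mulrA dual_act //.
  by apply: eq_mean => k; rewrite -!mulrA.
have bz' : bounded z.
  apply: bounded_sum => i.
  rewrite (_ : (fun k => _) = (fun k => phi (proj 1 (T (a i) f * T k f) * T k f * (W i * X)))).
    by apply: state_bounded => k; apply: ballM; [exact: proj_ball|ball].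
  by apply/funext => k; rewrite mulrA.
have zk k : z k ^+ 2 <= N * E.
  have -> : z k = m0 (fun j => phi ((T k f * T (j + k) f) * X * \sum_(i <- s) W i * T (a i + j) f)).
    transitivity (\sum_(i <- s) m0 (fun j =>
        phi (T (1%N%:Z * j) (T (a i) f * T k f) * (T k f * (W i * X))))).
      by apply: eq_bigr => i _; rewrite projE //; ball.
    rewrite -mean_sum => [|i]; last by apply: state_bounded => j; ball.
    apply: eq_mean => j; rewrite mulr_sumr state_sum; apply: eq_bigr => i _.
    rewrite mul1r actM -!actD [j + a i]addrC; congr phi; ring.
  apply: le_trans (mean_sq _ _) _.
    rewrite (_ : (fun k => _) = (fun j => \sum_(i <- s) phi ((T k f * T (j + k) f * T (a i + j) f) * (X * W i)))).
      by apply: bounded_sum => i; apply: state_bounded => j; ball.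
    by apply/funext => j; rewrite mulr_sumr state_sum; apply: eq_bigr => i _; congr phi; ring.
  rewrite -mean_scale //; apply: mean_mono => [||j].
  - apply: boundedX.
    rewrite (_ : (fun k => _) = (fun j => \sum_(i <- s) phi ((T k f * T (j + k) f * T (a i + j) f) * (X * W i)))).
      by apply: bounded_sum => i; apply: state_bounded => j; ball.
    by apply/funext => j; rewrite mulr_sumr state_sum; apply: eq_bigr => i _; congr phi; ring.
  - by apply: boundedM => //; bdd.
  - apply: le_trans (state_cauchy _ _) _; rewrite ler_wpM2r ?state_sq_ge0 //.
    by apply: ball_state; ball.
rewrite {1}NE; apply: le_trans (mean_sq _ bz') _; apply: mean_le => //; bdd.
Qed.

End Tame.

(** * Weyl equidistribution for unitary representations *)

Section PolynomialOrbits.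
Context {R : realType} {G : zmodType} (m0 : mean R).
Implicit Types (K F : G -> R) (b : int -> G) (w v : G).

(** [b] is polynomial of degree at most [d + 1], and [w] is its iterated
    difference of order [d + 1]. *)
Fixpoint poly_orbit (d : nat) b w : Prop :=
  if d is d'.+1 then
    forall h h' : int, poly_orbit d' (fun n => b (n + h) - b (n + h')) (w *~ (h - h'))
  else exists v, forall n, b n = v + w *~ n.

Lemma line_pos_def K w : pos_def K -> pos_def (fun k : int => K (w *~ k)).
Proof.
move=> [ev pK]; split=> [k|s]; first by rewrite mulrNz ev.
have := pK [seq (p.1, w *~ p.2) | p <- s]; rewrite /energy big_map; congr (0 <= _).
apply: eq_bigr => p _; rewrite big_map; apply: eq_bigr => q _ /=.
by rewrite mulrzBr.
Qed.

Lemma scale_pos_def c K : 0 <= c -> pos_def K -> pos_def (fun v => c * K v).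
Proof.
move=> c0 [ev pK]; split=> [v|s]; first by rewrite ev.
have -> : energy (fun v => c * K v) s = c * energy K s; last exact: mulr_ge0.
rewrite /energy mulr_sumr; apply: eq_bigr => p _.
by rewrite mulr_sumr; apply: eq_bigr => q _; ring.
Qed.

Lemma van_der_corput (m : mean R) F K b (s : seq int) :
  (0 < size s)%N -> pos_def K -> dominated F K ->
  m (fun n => F (b n)) ^+ 2 <=
  avg s (fun h => avg s (fun h' => m (fun n => K (b (n + h) - b (n + h'))))).
Proof.
move=> s0 pK dF; have bF : bounded (fun n => F (b n)) by exact: (dominated_bounded b dF).
have bK h h' : bounded (fun n => K (b (n + h) - b (n + h'))).
  exact: (pos_def_bounded (fun n => b (n + h) - b (n + h')) pK).
by apply: mean_van_der_corput => // n; exact: (dominated_avg s (fun h => b (n + h)) dF).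
Qed.

Lemma avg_diagonal (H : nat) (C e : R) (x : int -> int -> R) : (0 < H)%N ->
  (forall h, x h h <= C) -> 0 <= C -> 0 <= e ->
  (forall i j : nat, (i < H)%N -> (j < H)%N -> i != j -> x i%:Z j%:Z <= e) ->
  avg [seq i%:Z | i <- iota 0 H] (fun h => avg [seq i%:Z | i <- iota 0 H] (x h)) <=
  C / H%:R + e.
Proof.
move=> H0 xC C0 e0 xe; have sz : (0 < size (iota 0 H))%N by rewrite size_iota.
rewrite avg_map -[leRHS](avg_cst _ sz); apply: avg_le_in => i; rewrite mem_iota => iH.
rewrite /= avg_map.
apply: (@le_trans _ _ (avg (iota 0 H) (fun j => C * (j == i)%:R + e))).
  apply: avg_le_in => j; rewrite mem_iota => jH /=.
  case: eqP => [->|/eqP ij]; first by rewrite mulr1; have := xC i%:Z; lra.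
  by rewrite mulr0 add0r xe // eq_sym.
rewrite avgD avgZ avg_cst // lerD2r /avg size_iota.
rewrite (bigD1_seq i) ?iota_uniq ?mem_iota //= eqxx big1 ?addr0 ?mulr1 //.
by move=> j /negbTE ->.
Qed.

(** Weyl's theorem, when nothing is invariant under the first few multiples of
    the leading coefficient. The bound on the multiples does not depend on the
    orbit, since finitely many steps of van der Corput's trick suffice. *)
Lemma weyl_null d (e C : R) : 0 < e -> 0 <= C -> exists2 r : nat, (0 < r)%N &
  forall K F b w, pos_def K -> K 0 <= C -> dominated F K -> poly_orbit d b w ->
    (forall c : int, c != 0 -> `|c| <= r%:Z -> m0 (fun k => K (w *~ (c * k))) = 0) ->
    forall m : mean R, `|m (fun n => F (b n))| <= e.
Proof.
elim: d e C => [|d IH] e C e0 C0.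
  exists 1%N => // K F b w pK KC dF [v bE] null m.
  have e2 : 0 < e ^+ 2 by rewrite exprn_gt0.
  have [s [s0 sP]] := energy_le_mean (line_pos_def w pK) e2.
  apply: norm_le_sqr; first exact: ltW.
  apply: le_trans (van_der_corput m b s0 pK dF) _.
  have := sP m0; have /= := null 1 isT isT; under eq_mean do rewrite mul1r.
  move=> ->; rewrite add0r; apply: le_trans; apply: avg_le => h; apply: avg_le => h'.
  rewrite -[leRHS](mean_const m); apply: le_of_eq.
  apply: eq_mean => n; congr K; rewrite !bE opprD addrACA subrr add0r -mulrzBr.
  by congr (w *~ _); ring.
have e2 : 0 < e ^+ 2 / 2 by nra.
have C2 : 0 <= C ^+ 2 by exact: sqr_ge0.
have [r r0 rP] := IH (e ^+ 2 / 2) (C ^+ 2) e2 C2.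
have [H H0 HC] := natural_bound C e2; rewrite mulrC -ler_pdivrMr ?ltr0n // in HC.
exists (H * r)%N; first by rewrite muln_gt0 H0.
move=> K F b w pK KC dF pb null m; apply: norm_le_sqr; first exact: ltW.
pose s := [seq i%:Z | i <- iota 0 H].
have s0 : (0 < size s)%N by rewrite size_map size_iota.
apply: le_trans (van_der_corput m b s0 pK dF) _.
apply: le_trans (_ : C / H%:R + e ^+ 2 / 2 <= _); last by lra.
apply: avg_diagonal => //; [|exact: ltW|].
  move=> h; rewrite (_ : m _ = K 0) // -[RHS](mean_const m); apply: eq_mean => n.
  by rewrite subrr.
move=> i j iH jH ij; apply: le_trans (ler_norm _) _.
have K0 := pos_def_ge0 pK.
apply: (rP (fun v => K 0 * K v) K _ (w *~ (i%:Z - j%:Z))) => //.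
- exact: scale_pos_def.
- by rewrite expr2 ler_pM.
- exact: pos_def_dominated.
- move=> c c0 cr; rewrite mean_scale; last exact: (pos_def_bounded (fun k => _) pK).
  under eq_mean do rewrite -mulrzA mulrA.
  rewrite null ?mulr0 // ?mulf_neq0 ?subr_eq0 //.
  by rewrite normrM PoszM ler_pM //; lia.
Qed.

(** The second function is the matrix coefficient of [sum_q q.1 U^q.2 e] in place
    of [e]. *)
Lemma dominated_comb F K (a : seq (R * G)) : dominated F K ->
  dominated (fun v => \sum_(q <- a) q.1 * F (v + q.2))
    (fun v => \sum_(q <- a) \sum_(q' <- a) q.1 * q'.1 * K (v + (q.2 - q'.2))).
Proof.
move=> dF s; have := dF [seq (p.1 * q.1, p.2 + q.2) | p <- s, q <- a].
rewrite /energy !big_allpairs_dep /=.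
have -> : \sum_(p <- s) \sum_(q <- a) p.1 * q.1 * F (p.2 + q.2) =
    \sum_(p <- s) p.1 * \sum_(q <- a) q.1 * F (p.2 + q.2).
  by apply: eq_bigr => p _; rewrite mulr_sumr; apply: eq_bigr => q _; rewrite mulrA.
move/le_trans; apply; apply: le_of_eq.
apply: eq_bigr => p _; under eq_bigr do rewrite big_allpairs_dep /=.
rewrite exchange_big; apply: eq_bigr => p' _.
rewrite mulr_sumr; apply: eq_bigr => q _; rewrite mulr_sumr; apply: eq_bigr => q' _ /=.
by rewrite opprD addrACA; ring.
Qed.

Lemma comb_pos_def K (a : seq (R * G)) : pos_def K ->
  pos_def (fun v => \sum_(q <- a) \sum_(q' <- a) q.1 * q'.1 * K (v + (q.2 - q'.2))).
Proof.
move=> [ev pK]; split=> [v|s].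
  rewrite exchange_big; apply: eq_bigr => q _; apply: eq_bigr => q' _.
  by rewrite [q'.1 * _]mulrC -ev opprD opprK opprB.
have := pK [seq (p.1 * q.1, p.2 + q.2) | p <- s, q <- a].
rewrite /energy big_allpairs_dep; congr (0 <= _).
apply: eq_bigr => p _; under eq_bigr do rewrite big_allpairs_dep /=.
rewrite exchange_big; apply: eq_bigr => p' _.
rewrite mulr_sumr; apply: eq_bigr => q _; rewrite mulr_sumr; apply: eq_bigr => q' _ /=.
by rewrite opprD addrACA; ring.
Qed.

Lemma energy_le_weight K (a : seq (R * G)) : pos_def K ->
  energy K a <= (\sum_(q <- a) `|q.1|) ^+ 2 * K 0.
Proof.
move=> pK; rewrite expr2 mulr_suml mulr_suml; apply: ler_sum => q _.
rewrite mulr_sumr mulr_suml; apply: ler_sum => q' _; apply: le_trans (ler_norm _) _.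
by rewrite !normrM ler_wpM2l ?mulr_ge0 // pos_def_norm.
Qed.

Definition invariant_part (u : G) F v := m0 (fun k => F (v + u *~ k)).

Lemma invariant_part_shift u F K v j : dominated F K ->
  invariant_part u F (v + u *~ j) = invariant_part u F v.
Proof.
move=> dF; rewrite /invariant_part.
rewrite -[RHS](mean_shift m0 j); last exact: (dominated_bounded (fun k => _) dF).
by apply: eq_mean => k; rewrite -addrA -mulrzDr [j + k]addrC.
Qed.

Lemma invariant_part_dominated u F K : dominated F K -> dominated (invariant_part u F) K.
Proof.
move=> dF s.
have bF (p : R * G) : bounded (fun k : int => F (p.2 + u *~ k)).
  exact: (dominated_bounded (fun k : int => p.2 + u *~ k) dF).
have bd : bounded (fun k : int => \sum_(p <- s) p.1 * F (p.2 + u *~ k)).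
  by apply: bounded_sum => p; apply: boundedM => //; bdd.
have -> : \sum_(p <- s) p.1 * invariant_part u F p.2 =
    m0 (fun k => \sum_(p <- s) p.1 * F (p.2 + u *~ k)).
  rewrite mean_sum => [|p]; last by apply: boundedM => //; bdd.
  by apply: eq_bigr => p _; rewrite mean_scale.
apply: le_trans (mean_sq _ bd) _; apply: mean_le => [|k]; first bdd.
have := dF [seq (p.1, p.2 + u *~ k) | p <- s]; rewrite /energy !big_map /=.
move/le_trans; apply; apply: le_of_eq.
apply: eq_bigr => p _; rewrite big_map; apply: eq_bigr => q _ /=.
by rewrite opprD addrACA subrr addr0.
Qed.

(** Along a polynomial orbit only the part invariant under a multiple of the
    leading coefficient matters, up to a small error; the multiple does not
    depend on the orbit. *)
Lemma weyl_invariant_part d (e C : R) : 0 < e -> 0 <= C -> exists2 r : nat, (0 < r)%N &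
  forall K F b w, pos_def K -> K 0 <= C -> dominated F K -> poly_orbit d b w ->
    forall m : mean R,
    `|m (fun n => F (b n)) - m (fun n => invariant_part (w *~ r%:Z) F (b n))| <= e.
Proof.
move=> e0 C0; have e2 : 0 < e / 2 by lra.
have C4 : 0 <= 4 * C by lra.
have [r r0 rP] := weyl_null d e2 C4; exists r`!; first exact: fact_gt0.
move=> K F b w pK KC dF pb m; set u := w *~ r`!%:Z.
have [s [s0 sP]] := uniform_mean_ergodic u pK e2.
(* the combination [a] subtracts from [F] its average along multiples of [u],
   which is close to the invariant part *)
pose a := (1, 0) :: [seq (- (size s)%:R^-1 : R, u *~ k) | k <- s].
have aE v : \sum_(q <- a) q.1 * F (v + q.2) = F v - avg s (fun k => F (v + u *~ k)).
  rewrite big_cons /= mul1r addr0; congr (_ + _).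
  by rewrite big_map /= -mulr_sumr mulNr.
have bF : bounded (fun n => F (b n)) by exact: (dominated_bounded b dF).
have bA : bounded (fun n => avg s (fun k => F (b n + u *~ k))).
  apply: (@bounded_avg _ _ s (fun k n => F (b n + u *~ k))) => k.
  exact: (dominated_bounded (fun n => b n + u *~ k) dF).
have bI : bounded (fun n => invariant_part u F (b n)).
  exact: (dominated_bounded b (invariant_part_dominated u dF)).
(* as [c] divides [r`!], the mean over the multiples of [w *~ c] does not see the
   shifts in [a], whose coefficients add up to 0 *)
have null (c : int) : c != 0 -> `|c| <= r%:Z ->
    m0 (fun k => \sum_(q <- a) \sum_(q' <- a) q.1 * q'.1 *
      K (w *~ (c * k) + (q.2 - q'.2))) = 0.
  move=> c0 cr; have /dvdzP[t tE] : (c %| r`!%:Z)%Z.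
    by rewrite dvdzE absz_nat dvdn_fact //; lia.
  have bK x : bounded (fun k => K (w *~ (c * k) + x)).
    exact: (pos_def_bounded (fun k => w *~ (c * k) + x) pK).
  have shift j : m0 (fun k => K (w *~ (c * k) + u *~ j)) = m0 (fun k => K (w *~ (c * k))).
    have b0 : bounded (fun k => K (w *~ (c * k))).
      exact: (pos_def_bounded (fun k => w *~ (c * k)) pK).
    rewrite -(mean_shift m0 (t * j) b0); apply: eq_mean => k; congr K.
    by rewrite /u -mulrzA -mulrzDr tE; congr (w *~ _); ring.
  have qa q : q \in a -> exists j, q.2 = u *~ j.
    by rewrite inE => /predU1P[->|/mapP[j _ ->]]; [exists 0|exists j].
  rewrite mean_sum => [|q]; last by apply: bounded_sum => q'; apply: boundedM => //; bdd.
  transitivity (\sum_(q <- a) \sum_(q' <- a) q.1 * q'.1 * m0 (fun k => K (w *~ (c * k)))).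
    rewrite big_seq [RHS]big_seq; apply: eq_bigr => q /qa[j qE].
    rewrite mean_sum => [|q']; last by apply: boundedM => //; bdd.
    rewrite big_seq [RHS]big_seq; apply: eq_bigr => q' /qa[j' qE'].
    by rewrite mean_scale // qE qE' -mulrzBr shift.
  under eq_bigr do rewrite -mulr_suml -mulr_sumr.
  rewrite -mulr_suml -mulr_suml (_ : \sum_(q <- a) q.1 = 0) ?mul0r //.
  rewrite big_cons big_map /= big_const_seq count_predT iter_addr_0 mulNrn.
  by rewrite -[_ *+ _]mulr_natl mulfV ?subrr // pnatr_eq0 -lt0n.
have Ka0 : \sum_(q <- a) \sum_(q' <- a) q.1 * q'.1 * K (0 + (q.2 - q'.2)) <= 4 * C.
  under eq_bigr do under eq_bigr do rewrite add0r.
  apply: le_trans (energy_le_weight a pK) _.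
  rewrite big_cons big_map /= normr1 normrN ger0_norm ?invr_ge0 //.
  rewrite big_const_seq count_predT iter_addr_0 -[_ *+ _]mulr_natl mulfV; last first.
    by rewrite pnatr_eq0 -lt0n.
  by rewrite (_ : (1 + 1) ^+ 2 = 4); [rewrite ler_wpM2l|ring].
have := rP _ _ b w (comb_pos_def a pK) Ka0 (dominated_comb a dF) pb null m.
under eq_mean do rewrite aE.
rewrite meanB // => h1.
have h2 : `|m (fun n => avg s (fun k => F (b n + u *~ k))) -
    m (fun n => invariant_part u F (b n))| <= e / 2.
  rewrite -meanB // -[X in `|X|]subr0; apply: mean_near => [|n]; first bdd.
  by rewrite subr0; exact: sP.
move: h1 h2; rewrite !ler_norml => /andP[? ?] /andP[? ?]; apply/andP; split; lra.
Qed.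

Fixpoint iterated_mean (us : seq G) F : G -> R :=
  if us is u :: us' then invariant_part u (iterated_mean us' F) else F.

Lemma iterated_mean_dominated us F K : dominated F K -> dominated (iterated_mean us F) K.
Proof. by elim: us => //= u us IH /IH; exact: invariant_part_dominated. Qed.

Lemma iterated_mean_fixed us F : (forall u, u \in us -> forall v k, F (v + u *~ k) = F v) ->
  iterated_mean us F = F.
Proof.
elim: us => //= u us IH h; rewrite IH => [|u' u'us]; last first.
  by apply: h; rewrite in_cons u'us orbT.
apply/funext => v; rewrite /invariant_part -[RHS](mean_const m0).
by apply: eq_mean => k; rewrite h ?mem_head.
Qed.

Lemma iterated_mean_near us F F' K K' e : dominated F K -> dominated F' K' ->
  (forall v, `|F v - F' v| <= e) ->
  forall v, `|iterated_mean us F v - iterated_mean us F' v| <= e.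
Proof.
move=> dF dF' h; elim: us => //= u us IH v; rewrite /invariant_part.
have b1 : bounded (fun k : int => iterated_mean us F (v + u *~ k)).
  exact: (dominated_bounded (fun k : int => v + u *~ k) (iterated_mean_dominated us dF)).
have b2 : bounded (fun k : int => iterated_mean us F' (v + u *~ k)).
  exact: (dominated_bounded (fun k : int => v + u *~ k) (iterated_mean_dominated us dF')).
rewrite -meanB // -[X in `|X|]subr0; apply: mean_near => [|k]; first bdd.
by rewrite subr0; exact: IH.
Qed.

Lemma iterated_mean_avg us F K (s : seq int) u v : dominated F K ->
  iterated_mean us (fun v => avg s (fun k => F (v + u *~ k))) v =
  avg s (fun k => iterated_mean us F (v + u *~ k)).
Proof.
move=> dF; elim: us v => //= w us IH v; rewrite /invariant_part.
under eq_mean do rewrite IH.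
rewrite (mean_avg m0 s (x := fun k j => iterated_mean us F (v + w *~ j + u *~ k))).
  by apply: eq_avg => k; apply: eq_mean => j; rewrite addrAC.
move=> k.
exact: (dominated_bounded (fun j : int => v + w *~ j + u *~ k) (iterated_mean_dominated us dF)).
Qed.

(** Projections commute: an iterated mean of an invariant part is about as large
    somewhere as the iterated mean of the function itself. *)
Lemma iterated_mean_invariant_part us F K u v (e : R) : pos_def K -> dominated F K ->
  0 < e -> e <= `|iterated_mean us (invariant_part u F) v| ->
  exists v', e / 2 <= `|iterated_mean us F v'|.
Proof.
move=> pK dF e0 h; have e2 : 0 < e / 2 by lra.
have [s [s0 sP]] := uniform_mean_ergodic u pK e2.
pose A v := avg s (fun k => F (v + u *~ k)).
pose a := [seq ((size s)%:R^-1 : R, u *~ k) | k <- s].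
have AE : A = (fun v => \sum_(q <- a) q.1 * F (v + q.2)).
  by apply/funext => x; rewrite big_map /= -mulr_sumr.
have dA := dominated_comb a dF; rewrite -AE in dA.
have near := iterated_mean_near us (invariant_part_dominated u dF) dA
  (e := e / 2) (fun x => ltac:(rewrite distrC; exact: sP)) v.
rewrite (iterated_mean_avg us s u v dF) in near.
set x := iterated_mean us _ v in h near; set y := avg s _ in near.
have xy : `|x| <= `|x - y| + `|y| by have := ler_normD (x - y) y; rewrite subrK.
have : e / 2 <= avg s (fun k => `|iterated_mean us F (v + u *~ k)|).
  by apply: le_trans (avg_norm _ _); rewrite -/y; lra.
by case/(avg_exists s0) => k hk; exists (v + u *~ k).
Qed.

End PolynomialOrbits.

(** * Integer polynomials *)

Section IntegerPolynomials.
Context {R : realType}.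
Implicit Types p q : {poly R}.

Definition pval p (n : int) : int := Num.floor p.[n%:~R].

Lemma pvalE p n : integer_poly p -> (pval p n)%:~R = p.[n%:~R] :> R.
Proof. by move=> ip; rewrite /pval floorK. Qed.

Lemma int_inj (a b : int) : a%:~R = b%:~R :> R -> a = b.
Proof. by move/eqP; rewrite eqr_int => /eqP. Qed.

Lemma pvalP p n (a : int) : integer_poly p -> p.[n%:~R] = a%:~R -> pval p n = a.
Proof. by move=> ip h; apply: int_inj; rewrite pvalE. Qed.

Lemma integer_polyB p q : integer_poly p -> integer_poly q -> integer_poly (p - q).
Proof. by move=> ip iq z; rewrite hornerD hornerN rpredB. Qed.

Lemma integer_polyZ (c : int) p : integer_poly p -> integer_poly (c%:~R *: p).
Proof. by move=> ip z; rewrite hornerZ rpredM // rpred_int. Qed.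

Definition affine p (a b : int) := p \Po (a%:~R *: 'X + b%:~R%:P).

Lemma affineE p a b n : (affine p a b).[n%:~R] = p.[(a * n + b)%:~R].
Proof. by rewrite /affine horner_comp !hornerE -intrM -intrD. Qed.

Lemma integer_affine p a b : integer_poly p -> integer_poly (affine p a b).
Proof. by move=> ip z; rewrite affineE. Qed.

Lemma pval_affine p a b n : pval (affine p a b) n = pval p (a * n + b).
Proof. by rewrite /pval affineE. Qed.

Lemma pvalB p q n : integer_poly p -> integer_poly q -> pval (p - q) n = pval p n - pval q n.
Proof.
move=> ip iq; apply: pvalP; first exact: integer_polyB.
by rewrite hornerD hornerN -!pvalE // intrB.
Qed.

Lemma coef_affine_pow (a b : R) i k :
  ((a *: 'X + b%:P) ^+ i)`_k = a ^+ k * b ^+ (i - k) *+ 'C(i, k).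
Proof.
rewrite addrC exprDn coef_sum.
under eq_bigr do rewrite coefMn exprZn -polyC_exp coefCM coefZ coefXn.
have [ki|ki] := leqP k i; last first.
  rewrite bin_small // mulr0n big1 // => j _.
  case: eqP => [e|_]; last by rewrite !mulr0 mul0rn.
  by have := ltn_ord j; rewrite -e; lia.
have ki' : (k < i.+1)%N by [].
rewrite (bigD1 (Ordinal ki')) //= eqxx mulr1 big1 ?addr0; first by rewrite mulrC.
move=> j; rewrite -val_eqE /= => /negbTE jk.
by rewrite eq_sym jk !mulr0 mul0rn.
Qed.

Lemma coef_affine p a b D : (size p <= D.+1)%N ->
  (affine p a b)`_D = a%:~R ^+ D * p`_D.
Proof.
move=> sp; rewrite /affine coef_comp_poly.
under eq_bigr do rewrite coef_affine_pow.
have [sD|sD] := ltnP D (size p); last first.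
  rewrite nth_default // mulr0 big1 // => i _.
  by rewrite (bin_small (leq_trans (ltn_ord i) sD)) mulr0n mulr0.
rewrite (bigD1 (Ordinal sD)) //= subnn expr0 mulr1 binn mulr1n mulrC big1 ?addr0 //.
move=> i; rewrite -val_eqE /= => iD; rewrite bin_small ?mulr0n ?mulr0 //.
by rewrite ltn_neqAle iD -ltnS (leq_trans (ltn_ord i) sp).
Qed.

Lemma coef_shift p b D : (size p <= D.+2)%N ->
  (affine p 1 b)`_D = p`_D + b%:~R * p`_D.+1 *+ D.+1.
Proof.
move=> sp; rewrite /affine coef_comp_poly.
under eq_bigr do rewrite coef_affine_pow expr1n mul1r.
have [sD|sD] := ltnP D (size p); last first.
  rewrite (nth_default _ sD) (nth_default _ (leqW sD)) mulr0 mul0rn addr0 big1 //.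
  by move=> i _; rewrite (bin_small (leq_trans (ltn_ord i) sD)) mulr0n mulr0.
rewrite (bigD1 (Ordinal sD)) //= subnn expr0 binn mulr1n mulr1; congr (_ + _).
have [sD1|sD1] := ltnP D.+1 (size p); last first.
  rewrite nth_default // mulr0 mul0rn big1 // => i; rewrite -val_eqE /= => iD.
  rewrite bin_small ?mulr0n ?mulr0 //.
  by rewrite ltn_neqAle iD -ltnS (leq_trans (ltn_ord i)).
have ne : Ordinal sD1 != Ordinal sD by rewrite -val_eqE /=; lia.
rewrite (bigD1 (Ordinal sD1)) //= subSnn expr1 binSn big1 ?addr0.
  by rewrite mulrnAr mulrC.
move=> i; rewrite -!val_eqE /= => /andP[iD iD1].
rewrite bin_small ?mulr0n ?mulr0 //.
have := leq_trans (ltn_ord i) sp; rewrite ltnS leq_eqVlt (negPf iD1) /= ltnS.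
by rewrite leq_eqVlt (negPf iD).
Qed.

Lemma size_affine p a b : (size (affine p a b) <= size p)%N.
Proof.
apply/leq_sizeP => D sD; rewrite coef_affine ?nth_default ?mulr0 //; lia.
Qed.

Lemma size_difference p (h h' : int) d : (size p <= d.+1)%N ->
  (size (affine p 1 h - affine p 1 h')%R <= d)%N.
Proof.
move=> sp; apply/leq_sizeP => D dD; rewrite coefB.
have sD : (size p <= D.+1)%N by lia.
by rewrite !coef_affine // subrr.
Qed.

Lemma linear_poly p x : (size p <= 2)%N -> p.[x] = p`_1 * x + p`_0.
Proof. by move=> sp; rewrite (horner_coef_wide x sp) !big_ord_recl big_ord0 /=; ring. Qed.

(** The values of an integer polynomial of degree at most [d + 1] form a
    polynomial orbit, with [(d + 1)!] times the leading coefficient as difference. *)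
Lemma poly_orbit_pval p d : integer_poly p -> (size p <= d.+2)%N ->
  exists2 w : int, w%:~R = (d.+1)`!%:R * p`_d.+1 & poly_orbit d (pval p) w.
Proof.
elim: d p => [|d IH] p ip sp.
  exists (pval p 1 - pval p 0).
    by rewrite intrB !pvalE // mul1r !(linear_poly _ sp); ring.
  exists (pval p 0) => n; apply: int_inj; rewrite intrD mulrzz intrM intrB !pvalE //.
  by rewrite !(linear_poly _ sp); ring.
have diff (h h' : int) : exists2 w : int, w%:~R = (d.+2)`!%:R * p`_d.+2 * (h - h')%:~R &
    poly_orbit d (fun n => pval p (n + h) - pval p (n + h')) w.
  have [w wE wP] := IH (affine p 1 h - affine p 1 h')
    (integer_polyB (integer_affine 1 h ip) (integer_affine 1 h' ip)) (size_difference h h' sp).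
  exists w.
    rewrite wE coefB !coef_shift // [(d.+2)`!]factS natrM intrB -![_ * _ *+ _]mulr_natl.
    have alg (x y z z' a c : R) :
        y * (a + x * (z * c) - (a + x * (z' * c))) = x * y * c * (z - z') by ring.
    exact: alg.
  rewrite (_ : (fun n => _) = pval (affine p 1 h - affine p 1 h')) //.
  apply/funext => n; rewrite pvalB; [|exact: integer_affine..].
  by rewrite !pval_affine !mul1r.
have [w wE wP] := diff 1 0; exists w; first by rewrite wE subr0 mulr1.
move=> h h'; have [w' w'E w'P] := diff h h'.
have -> : w *~ (h - h') = w'; last exact: w'P.
apply: int_inj; rewrite w'E mulrzz intrM wE subr0 mulr1.
by [].
Qed.

End IntegerPolynomials.

(** * Lattices *)

Section Lattice.
Context {l : nat}.

(** Over the rationals such vectors span the whole space, since otherwise a column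
    of the cokernel would be a nonzero functional that vanishes on them.  Clearing
    denominators gives the multiple [N]. *)
Lemma finite_index_span (W : seq 'rV[int]_l) :
  (forall c : 'I_l -> int, (forall w, w \in W -> \sum_i c i * w 0 i = 0) -> forall i, c i = 0) ->
  exists2 N : nat, (0 < N)%N & forall i, exists c : 'I_(size W) -> int,
    N%:Z *: delta_mx 0 i = \sum_(j < size W) c j *: W`_j :> 'rV[int]_l.
Proof.
move=> h; pose M : 'M[rat]_(size W, l) := \matrix_(j, i) (W`_j 0 i)%:~R.
have clear (I : finType) (x : I -> rat) : exists2 N : nat, (0 < N)%N &
    exists y : I -> int, forall i, N%:R * x i = (y i)%:~R.
  exists (\prod_i `|denq (x i)|)%N.
    by apply: prodn_gt0 => i; rewrite absz_gt0 denq_neq0.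
  exists (fun i => (\prod_(j | j != i) `|denq (x j)|)%N%:Z * numq (x i)) => i.
  rewrite (bigD1 i) //= natrM -mulrA mulrCA intrM.
  have -> : (`|denq (x i)|%N)%:R = (denq (x i))%:~R :> rat.
    by rewrite -[in RHS](gez0_abs (denq_ge0 (x i))).
  rewrite [X in X * _]pmulrn; congr (_ * _).
  by rewrite -{2}(divq_num_den (x i)) mulrCA mulfV ?mulr1 // intr_eq0 denq_neq0.
have full : row_full M.
  apply: contrapT => /negP nf.
  have : cokermx M != 0.
    rewrite -mxrank_eq0 mxrank_coker subn_eq0 -ltnNge ltn_neqAle rank_leq_col andbT.
    exact: nf.
  case/matrix0Pn => i0 [j0 nz].
  have [N N0 [y yP]] := clear _ (fun i => cokermx M i j0).
  have y0 : forall i, y i = 0.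
    apply: h => w /(nthP 0)[j jW <-].
    apply/eqP; rewrite -(intr_eq0 rat) rmorph_sum /=.
    have : (M *m cokermx M) (Ordinal jW) j0 = 0 by rewrite mulmx_coker mxE.
    rewrite mxE => e; apply/eqP.
    transitivity (N%:R * \sum_i M (Ordinal jW) i * cokermx M i j0); last by rewrite e mulr0.
    by rewrite mulr_sumr; apply: eq_bigr => i _; rewrite intrM -yP [M _ _]mxE /=; ring.
  have := yP i0; rewrite y0 => /eqP; rewrite mulf_eq0 (negPf nz) orbF pnatr_eq0.
  by move/eqP => e; rewrite e in N0.
have /row_fullP[B BM] := full.
have [N N0 [y yP]] := clear _ (fun ij : 'I_l * 'I_(size W) => B ij.1 ij.2).
exists N => // i; exists (fun j => y (i, j)); apply/rowP => k; rewrite !mxE summxE.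
apply/eqP; rewrite -(eqr_int rat) rmorph_sum /= intrM.
have := congr1 (fun A : 'M[rat]_l => N%:R * A i k) BM; rewrite !mxE mulr_sumr => e.
rewrite (_ : ((k == i)%:R)%:~R = (i == k)%:R :> rat).
  rewrite -pmulrn -e; apply/eqP; apply: eq_bigr => j _.
  by rewrite !mxE intrM -yP /=; ring.
by rewrite eq_sym; case: eqP.
Qed.

End Lattice.

(** * Weyl equidistribution for vectors of integer polynomials *)

Section WeylPolynomial.
Context {R : realType} {l : nat} (m0 : mean R).
Implicit Types (K F : 'rV[int]_l -> R) (b : 'I_l -> {poly R}) (W : seq 'rV[int]_l).
Local Notation itm := (iterated_mean m0).

Definition orbit b (n : int) : 'rV[int]_l := \row_i pval (b i) n.

(** Directions in [W] are those along which invariance is known already; modulo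
    them, the [b i] satisfy no linear relation up to constants. *)
Definition independent_mod W b := forall c : 'I_l -> int,
  (forall w, w \in W -> \sum_i c i * w 0 i = 0) ->
  (exists a : R, \sum_i (c i)%:~R *: b i = a%:P) -> forall i, c i = 0.

Lemma row_mulrz (v : 'I_l -> int) n : (\row_i v i) *~ n = \row_i (v i * n).
Proof. by apply/rowP => i; rewrite -scaler_int !mxE intz mulrC. Qed.

Lemma poly_orbit_row d b (w : 'I_l -> int) :
  (forall i, poly_orbit d (pval (b i)) (w i)) -> poly_orbit d (orbit b) (\row_i w i).
Proof.
suff gen (f : 'I_l -> int -> int) (v : 'I_l -> int) :
    (forall i, poly_orbit d (f i) (v i)) -> poly_orbit d (fun n => \row_i f i n) (\row_i v i).
  exact: gen.
elim: d f v => [|d IH] f v h.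
  have [c cP] := choice h; exists (\row_i c i) => n; apply/rowP => i.
  by rewrite row_mulrz !mxE cP mulrzz.
move=> x y; rewrite row_mulrz (_ : (fun n => _) = fun n => \row_i (f i (n + x) - f i (n + y))).
  by apply: IH => i; rewrite -mulrzz; exact: h.
by apply/funext => n; apply/rowP => i; rewrite !mxE.
Qed.

Definition axes (N : nat) : seq 'rV[int]_l := [seq N%:Z *: delta_mx 0 i | i <- enum 'I_l].

Lemma invariant_span W F (c : 'I_(size W) -> int) :
  (forall w v, w \in W -> F (v + w) = F v) ->
  forall v k, F (v + (\sum_(j < size W) c j *: W`_j) *~ k) = F v.
Proof.
move=> h.
have hz w : w \in W -> forall k v, F (v + w *~ k) = F v.
  move=> wW; have hn (n : nat) v : F (v + w *+ n) = F v.
    by elim: n v => [|n IH] v; rewrite ?mulr0n ?addr0 // mulrS addrA IH h.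
  by move=> [n|n] v; [rewrite -pmulrn hn|rewrite NegzE mulrNz -[in RHS](subrK (w *+ n.+1) v) hn].
have hs (s : seq 'I_(size W)) k v : F (v + (\sum_(j <- s) c j *: W`_j) *~ k) = F v.
  elim: s v => [|j s IH] v; first by rewrite big_nil mul0rz addr0.
  rewrite big_cons mulrzDl addrA IH -[c j]intz scaler_int -mulrzA.
  by rewrite hz // mem_nth.
by move=> v k; exact: hs.
Qed.

(** Up to a small error only the part of [F] invariant under a multiple [u] of the
    top coefficient matters.  On the residue classes of a suitable modulus the top
    term of the orbit is a multiple of [u], so it can be dropped, which lowers the
    degree, while [u] is added to the known directions.  In degree 0 these
    directions span a subgroup of finite index, and [F] is invariant along
    multiples of all the axes. *)
Lemma weyl_orbit d b W (e C : R) : (forall i, integer_poly (b i)) ->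
  (forall i, (size (b i) <= d.+1)%N) -> independent_mod W b -> 0 < e -> 0 <= C ->
  exists (N0 : nat) (e' : R), 0 < e' /\ forall K F (m : mean R), pos_def K -> K 0 <= C ->
    dominated F K -> (forall w v, w \in W -> F (v + w) = F v) ->
    e <= `|m (fun n => F (orbit b n))| ->
    exists N v, [/\ (0 < N)%N, (N <= N0)%N & e' <= `|itm (axes N) F v|].
Proof.
elim: d b W e => [|d IH] b W e ib sb ind e0 C0.
  have cst i : exists a : R, b i = a%:P by exists (b i)`_0; exact: size1_polyC.
  have [a aE] := choice cst.
  have [|N N0 span] := @finite_index_span l W.
    move=> c cW; apply: ind cW _; exists (\sum_i (c i)%:~R * a i).
    rewrite rmorph_sum; apply: eq_bigr => i _ /=.
    by rewrite aE -mul_polyC -polyCM.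
  exists N, e; split=> // K F m pK KC dF FW.
  pose v := orbit b 0.
  have -> : m (fun n => F (orbit b n)) = F v.
    rewrite -[RHS](mean_const m); apply: eq_mean => n; congr F.
    by apply/rowP => i; rewrite !mxE /pval aE !hornerC.
  move=> eF; exists N, v; split=> //; rewrite iterated_mean_fixed // => u.
  move=> /mapP[i _ ->] x k; have [c ->] := span i; exact: invariant_span.
have /choice[w wP] : forall i, exists w : int, w%:~R = (d.+1)`!%:R * (b i)`_d.+1 :> R /\
    poly_orbit d (pval (b i)) w.
  by move=> i; have [w] := poly_orbit_pval (ib i) (sb i); exists w.
have pb : poly_orbit d (orbit b) (\row_i w i).
  by apply: poly_orbit_row => i; case: (wP i).
have e2 : 0 < e / 2 by lra.
have [r r0 rP] := @weyl_invariant_part R 'rV[int]_l m0 d _ _ e2 C0.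
pose u := (\row_i w i) *~ r%:Z : 'rV[int]_l.
pose q := (r * (d.+1)`!)%N; have q0 : (0 < q)%N by rewrite muln_gt0 r0 fact_gt0.
(* on a residue class modulo [q] the top term consists of multiples of [u]; here
   [t] is the cofactor in [q ^ d.+1 = r * t * (d.+1)`!] *)
pose t := (r ^ d * (d.+1)`! ^ d)%N.
pose b' (c : nat) i : {poly R} := affine (b i) q%:Z c%:Z - (r%:Z * t%:Z * w i)%:~R *: 'X^(d.+1).
have ibX (x : int) : integer_poly (x%:~R *: 'X^(d.+1) : {poly R}).
  by apply: integer_polyZ => z; rewrite hornerXn rpredX ?rpred_int.
have ib' c i : integer_poly (b' c i).
  by apply: integer_polyB; [exact: integer_affine|exact: ibX].
have sb' c i : (size (b' c i) <= d.+1)%N.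
  apply/leq_sizeP => D dD; rewrite coefB coefZ coefXn.
  have sD : (size (b i) <= D.+1)%N by apply: leq_trans (sb i) _.
  rewrite coef_affine //; have [->|Dd] := eqVneq D d.+1.
    have qt : (q%:Z%:~R ^+ d.+1 : R) = r%:R * t%:R * (d.+1)`!%:R.
      have qn : (q ^ d.+1)%N = (r * t * (d.+1)`!)%N.
        by rewrite /q /t; move: (d.+1)`! => f; rewrite expnMn !expnS; ring.
      by rewrite -pmulrn -natrX qn natrM natrM.
    rewrite qt mulr1 2!intrM (proj1 (wP i)) -!pmulrn.
    by move: (d.+1)`!%:R => f; ring.
  rewrite mulr0 subr0 (_ : (b i)`_D = 0) ?mulr0 // nth_default //.
  by apply: leq_trans (sb i) _; rewrite ltn_neqAle eq_sym Dd.
have orb c n : orbit b (q%:Z * n + c%:Z) = orbit (b' c) n + u *~ (t%:Z * n ^+ d.+1).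
  apply/rowP => i; rewrite /u -mulrzA row_mulrz !mxE /b'.
  rewrite pvalB ?pval_affine; [|exact: integer_affine|exact: ibX].
  rewrite (@pvalP _ (_ *: 'X^(d.+1)) n (r%:Z * t%:Z * w i * n ^+ d.+1)) //; first by ring.
  by rewrite hornerZ hornerXn -rmorphXn -intrM.
have ind' c : independent_mod (u :: W) (b' c).
  move=> x xW [a aE]; apply: ind => [z zW|]; first by apply: xW; rewrite in_cons zW orbT.
  have xw : \sum_i x i * w i = 0.
    have := xW u (mem_head _ _); rewrite /u row_mulrz.
    under eq_bigr do rewrite !mxE mulrA.
    by rewrite -mulr_suml => /eqP; rewrite mulf_eq0 => /orP[/eqP //|]; lia.
  have [L LE] : exists L, (q%:Z%:~R *: 'X + (c%:Z%:~R)%:P : {poly R}) \Po L = 'X.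
    exists (q%:R^-1 *: ('X - (c%:R)%:P)).
    rewrite comp_polyD comp_polyZ comp_polyX comp_polyC scalerA -!pmulrn.
    by rewrite mulfV ?pnatr_eq0 -?lt0n // scale1r subrK.
  exists a; have aff : affine (\sum_i (x i)%:~R *: b i) q%:Z c%:Z = a%:P.
    rewrite -aE /affine rmorph_sum /=; under [RHS]eq_bigr do rewrite scalerBr scalerA.
    rewrite sumrB -scaler_suml (_ : \sum_i _ * _ = 0) ?scale0r ?subr0.
      by apply: eq_bigr => i _; rewrite comp_polyZ.
    transitivity ((r%:Z * t%:Z)%:~R * (\sum_i x i * w i)%:~R : R); last by rewrite xw mulr0.
    by rewrite rmorph_sum mulr_sumr; apply: eq_bigr => i _ /=; rewrite !intrM; ring.
  by have := congr1 (fun p => p \Po L) aff; rewrite /affine -comp_polyA LE comp_polyXr comp_polyC.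
pose P c N0 (e' : R) := forall K F (m : mean R), pos_def K -> K 0 <= C ->
    dominated F K -> (forall z v, z \in u :: W -> F (v + z) = F v) ->
    e / 2 <= `|m (fun n => F (orbit (b' c) n))| ->
    exists N v, [/\ (0 < N)%N, (N <= N0)%N & e' <= `|itm (axes N) F v|].
have [N0 [e' [e'0 h]]] : exists N0 e', 0 < e' /\ forall c, (c < q)%N -> P c N0 e'.
  apply: uniform_choice => [c N N' x y NN _ yx hP K F m pK KC dF FW eF|c].
    have [M [v [M0 MN xM]]] := hP K F m pK KC dF FW eF.
    by exists M, v; split=> //; [exact: leq_trans NN|exact: le_trans xM].
  exact: (IH (b' c) (u :: W) (e / 2)).
exists N0, (e' / 2); split=> [|K F m pK KC dF FW eF]; first by lra.
have dI := invariant_part_dominated m0 u dF.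
have eI : e / 2 <= `|m (fun n => invariant_part m0 u F (orbit b n))|.
  have := rP K F (orbit b) _ pK KC dF pb m; rewrite -/u.
  move: eF; set x := m _; set y := m _ => ex xy.
  by have := ler_normD (x - y) y; rewrite subrK; lra.
have bI : bounded (fun n => invariant_part m0 u F (orbit b n)) by exact: (dominated_bounded _ dI).
rewrite (mean_residues m q0 bI) in eI.
have sz : (0 < size (iota 0 q))%N by rewrite size_iota.
have [c] := avg_exists_in sz (le_trans eI (avg_norm _ _)).
rewrite mem_iota add0n => /andP[_ cq] ec.
have := h c cq K (invariant_part m0 u F) (residue_mean m q0 c%:Z) pK KC dI.
case=> [z v|| N [v [N1 N2 N3]]].
- rewrite in_cons => /predU1P[->|zW].
    by have := invariant_part_shift m0 u v 1 dF; rewrite mulr1z.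
  by apply: eq_mean => k; rewrite addrAC FW.
- move: ec; congr (_ <= `|_|); apply: eq_mean => n.
  by rewrite orb (invariant_part_shift m0 u _ _ dF).
have [v' hv] := iterated_mean_invariant_part pK dF e'0 N3.
by exists N, v'.
Qed.

End WeylPolynomial.

(** * Polynomial averages are controlled by uniformity seminorms *)

Section LexicographicInduction.

(** The lexicographic order in which larger indices count more is well founded on
    finitely many indices.  It is enough that the values above the index of the
    decrease do not increase. *)
Lemma lexicographic_ind (N : nat) (P : (nat -> nat) -> Prop) :
  (forall w, (forall w', (exists e, [/\ (e < N)%N, (w' e < w e)%N &
     forall E, (e < E < N)%N -> (w' E <= w E)%N]) -> P w') -> P w) ->
  forall w, P w.
Proof.
elim: N P => [|N IH] P H w; first by apply: H => w' [e []].
suff gen v w0 : (w0 N <= v)%N -> P w0 by exact: (gen (w N)).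
elim/ltn_ind: v w0 => v IHv; apply: IH => w0 IHw w0v; apply: H => w' [e [eN le lE]].
have [E|E] := eqVneq e N; first by apply: (IHv (w' N)) => //; rewrite -E in w0v *; exact: leq_trans w0v.
have eN' : (e < N)%N by rewrite ltn_neqAle E -ltnS.
apply: IHw.
  by exists e; split=> // E' /andP[h1 h2]; apply: lE; rewrite h1 ltnW.
by apply: leq_trans w0v; apply: lE; rewrite eN' /=.
Qed.

Lemma seq_argmin (I : eqType) (s : seq I) (A : pred I) (f : I -> nat) : has A s ->
  exists x, [/\ x \in s, A x & forall y, y \in s -> A y -> (f x <= f y)%N].
Proof.
move=> /hasP[x0 x0s Ax0].
have ex : exists n, has (fun x => A x && (f x == n)) s.
  by exists (f x0); apply/hasP; exists x0; rewrite // Ax0 /=.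
case: (ex_minnP ex) => n /hasP[x xs /andP[Ax /eqP fx]] mn.
exists x; split=> // y ys Ay; rewrite fx; apply: mn; apply/hasP; exists y => //.
by rewrite Ay /=.
Qed.

End LexicographicInduction.

Section ShiftedPolynomials.
Context {R : realType}.
Implicit Types p q b c : {poly R}.

Lemma affine1_comp p x y : affine (affine p 1 x) 1 y = affine p 1 (x + y).
Proof.
rewrite /affine -comp_polyA !comp_polyD comp_polyZ comp_polyX comp_polyC.
by rewrite (_ : 1%:~R = 1) // !scale1r -addrA -polyCD -intrD [y + x]addrC.
Qed.

Lemma affineB p q x y : affine (p - q) x y = affine p x y - affine q x y.
Proof. by rewrite /affine comp_polyB. Qed.

Lemma size_shift p h : size (affine p 1 h) = size p.
Proof.
apply/eqP; rewrite eqn_leq size_affine /= leqNgt; apply/negP => lt.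
have : (size (affine (affine p 1 h) 1 (- h)) < size p)%N by apply: leq_ltn_trans lt; exact: size_affine.
by rewrite affine1_comp subrr /affine scale1r addr0 comp_polyXr ltnn.
Qed.

Lemma coef_shift_top p h D : (size p <= D.+1)%N -> (affine p 1 h)`_D = p`_D.
Proof. by move=> sp; rewrite coef_affine // expr1n mul1r. Qed.

Lemma size_shift_difference p h h' d : size p = d.+2 -> h != h' ->
  size (affine p 1 h - affine p 1 h')%R = d.+1.
Proof.
move=> sp hh; apply/eqP; rewrite eqn_leq size_difference ?sp //= ltnNge.
apply/negP => le.
have : (affine p 1 h - affine p 1 h')`_d = 0 by rewrite nth_default.
rewrite coefB !coef_shift ?sp // opprD addrACA subrr add0r -mulrnBl -mulrBl -intrB.
move/eqP; rewrite mulrn_eq0 /= mulf_eq0 intr_eq0 subr_eq0 (negPf hh) /=.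
have : lead_coef p != 0 by rewrite lead_coef_eq0 -size_poly_eq0 sp.
by rewrite lead_coefE sp /= => /negPf ->.
Qed.

(** A nonzero shift changes a polynomial of degree at least 2 by a nonconstant one,
    so two such polynomials differ by a constant for at most one relative shift. *)
Lemma shifts_separate b c : (2 < size b)%N -> exists D : nat, forall h h' : int,
  D%:Z <= `|h' - h| -> (1 < size (affine c 1 h' - affine b 1 h)%R)%N.
Proof.
move=> sb; have [sc|sc] := leqP (size c) 2.
  exists 0%N => h h' _; rewrite -size_polyN opprB size_polyDl ?size_shift ?size_polyN ?size_shift.
    exact: ltnW.
  exact: leq_ltn_trans sb.
have [[h0 [h0' bad]]|ok] := pselect (exists h0 h0' : int,
    (size (affine c 1 h0' - affine b 1 h0)%R <= 1)%N); last first.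
  by exists 0%N => h h' _; rewrite ltnNge; apply/negP => bad; apply: ok; exists h, h'.
exists (`|h0' - h0|.+1)%N => h h' hh; rewrite ltnNge; apply/negP => bad'.
have bad2 : (size (affine c 1 (h' + (h0 - h)) - affine b 1 h0)%R <= 1)%N.
  have := size_affine (affine c 1 h' - affine b 1 h) 1 (h0 - h).
  by rewrite affineB !affine1_comp [h + _]addrC subrK => /leq_trans; apply.
have ne : h' + (h0 - h) != h0' by apply/eqP => e; lia.
case sE : (size c) sc => [|[|[|n]]] // _.
have := size_shift_difference sE ne.
have -> : affine c 1 (h' + (h0 - h)) - affine c 1 h0' =
    (affine c 1 (h' + (h0 - h)) - affine b 1 h0) - (affine c 1 h0' - affine b 1 h0) by ring.
move=> e; have := size_polyD (affine c 1 (h' + (h0 - h)) - affine b 1 h0)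
   (- (affine c 1 h0' - affine b 1 h0)).
by rewrite e size_polyN leq_max => /orP[] /leq_trans /(_ _); [move/(_ _ bad2)|move/(_ _ bad)].
Qed.

Lemma shifts_separate_seq b (s : seq {poly R}) : (2 < size b)%N ->
  exists D : nat, forall h h' : int, D%:Z <= `|h' - h| ->
    forall c, c \in s -> (1 < size (affine c 1 h' - affine b 1 h)%R)%N.
Proof.
move=> sb; elim: s => [|c s [D IH]]; first by exists 0%N.
have [D' h'] := shifts_separate c sb; exists (maxn D D') => x y hxy z.
rewrite in_cons => /predU1P[->|zs]; first by apply: h'; lia.
by apply: IH zs; lia.
Qed.

End ShiftedPolynomials.

Section Control.
Context {R : realType} {S : msys R} (m0 : mean R).
Implicit Types (f g F : obs S) (a q : {poly R}) (L : seq ({poly R} * obs S)).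
Local Notation phi := (@state R S).
Local Notation T := (@act R S).
Local Notation gow := (gow m0).

Definition term L n : obs S := \prod_(p <- L) T (pval p.1 n) p.2.

Definition corr (m : mean R) L : R := m (fun n => phi (term L n)).

Definition pair_balls L := all_ball [seq p.2 | p <- L].

Lemma term_ball L n : pair_balls L -> ball (term L n).
Proof.
rewrite /term /pair_balls; elim: L => [|p L IH] /=; first by rewrite big_nil; ball.
by move=> [bp /IH]; rewrite big_cons => bL; ball.
Qed.

Lemma pair_balls_filter (P : pred ({poly R} * obs S)) L :
  pair_balls L -> pair_balls [seq p <- L | P p].
Proof. by rewrite /pair_balls; elim: L => //= p L IH [bp /IH]; case: ifP. Qed.

Lemma pair_balls_map (c : {poly R} -> {poly R}) L :
  pair_balls L -> pair_balls [seq (c p.1, p.2) | p <- L].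
Proof. by rewrite /pair_balls -map_comp. Qed.

Lemma pair_balls_cat L L' : pair_balls L -> pair_balls L' -> pair_balls (L ++ L').
Proof. by rewrite /pair_balls map_cat; exact: all_ball_cat. Qed.

Lemma corr_bound m L : pair_balls L -> `|corr m L| <= 1.
Proof. by move=> bL; apply: mean_bound => n; apply: ball_norm; exact: term_ball. Qed.

Lemma state_van_der_corput (m : mean R) G (X : int -> obs S) (s : seq int) :
  (0 < size s)%N -> ball G -> (forall n, ball (X n)) ->
  m (fun n => phi (G * X n)) ^+ 2 <=
  avg s (fun h => avg s (fun h' => m (fun n => phi (X (n + h) * X (n + h'))))).
Proof.
move=> s0 bG bX.
have bF : bounded (fun n => phi (G * X n)) by apply: ball_bounded => n; ball.
have bK h h' : bounded (fun n => phi (X (n + h) * X (n + h'))).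
  by apply: ball_bounded => n; ball.
by apply: mean_van_der_corput => // n; exact: state_avg_cauchy.
Qed.

(** A polynomial is constant when its size is at most 1. *)
Definition far q (p : {poly R} * obs S) := (1 < size (p.1 - q)%R)%N.

(** Translating by [- q(n)] subtracts [q] from every polynomial.  The terms whose
    difference with [q] is constant then no longer move, and [G] collects them. *)
Lemma corr_rebase (m : mean R) q L : integer_poly q ->
  (forall p, p \in [seq p.1 | p <- L] -> integer_poly p) -> pair_balls L ->
  exists2 G, ball G & corr m L =
    m (fun n => phi (G * term [seq (p.1 - q, p.2) | p <- L & far q p] n)).
Proof.
move=> iq iL bL.
exists (\prod_(p <- [seq p <- L | ~~ far q p]) T (pval (p.1 - q) 0) p.2).
  have := pair_balls_filter (fun p => ~~ far q p) bL; move: [seq p <- L | _].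
  rewrite /pair_balls; elim=> [|p L' IH] /=; first by rewrite big_nil; ball.
  by move=> [bp /IH bL']; rewrite big_cons; ball.
apply: eq_mean => n; rewrite -[LHS](state_act (- pval q n)) /term act_prod.
congr phi; rewrite big_map [RHS]mulrC.
have -> : \prod_(i <- L) T (- pval q n) (T (pval i.1 n) i.2) =
    \prod_(i <- L) T (pval (i.1 - q) n) i.2.
  elim: L iL {bL} => [|p L IH] iL; first by rewrite !big_nil.
  rewrite !big_cons -actD addrC -pvalB ?IH // => [p' p'L|]; apply: iL.
    by rewrite in_cons p'L orbT.
  by rewrite mem_head.
rewrite (bigID (far q)) /= !big_filter; congr (_ * _).
apply: eq_bigr => p nf; congr (T _ _); rewrite /pval.
have /size1_polyC -> : (size (p.1 - q)%R <= 1)%N by rewrite leqNgt.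
by rewrite !hornerC.
Qed.

Lemma term_cons p L n : term (p :: L) n = T (pval p.1 n) p.2 * term L n.
Proof. by rewrite /term big_cons. Qed.

Lemma term_cat L L' n : term (L ++ L') n = term L n * term L' n.
Proof. by rewrite /term big_cat. Qed.

Lemma term_shift L n h :
  term L (n + h) = term [seq (affine p.1 1 h, p.2) | p <- L] n.
Proof. by rewrite /term big_map; apply: eq_bigr => p _ /=; rewrite pval_affine mul1r. Qed.

(** Large correlations force [F], the function attached to the first polynomial,
    to have a large uniformity seminorm, with bounds that only depend on the
    polynomials.  The exponent of [c] makes the bound stable under raising the
    order, see [gow_mono_iter]. *)
Definition controlled a (s : seq {poly R}) := forall e : R, 0 < e ->
  exists t (c : R), 0 < c /\ forall (m : mean R) F L, ball F -> pair_balls L ->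
    [seq p.1 | p <- L] = s -> e <= `|corr m ((a, F) :: L)| -> c ^+ (2 ^ t) <= gow t 1 F.

Definition recenter q (s : seq {poly R}) := [seq p - q | p <- s & (1 < size (p - q)%R)%N].

(** The polynomials produced by van der Corput's trick with shifts [h] and [h'], once
    [q] has been subtracted.  The shift of [a - q] by [h] is left out: it carries
    the function to be controlled. *)
Definition derived q a (s : seq {poly R}) (h h' : int) :=
  affine (a - q) 1 h' :: [seq affine b 1 h | b <- recenter q s] ++
  [seq affine b 1 h' | b <- recenter q s].

Lemma recenterE q L : [seq p.1 | p <- [seq (p.1 - q, p.2) | p <- L & far q p]] =
  recenter q [seq p.1 | p <- L].
Proof. by rewrite /recenter filter_map -!map_comp. Qed.

(** After subtracting [q], van der Corput's inequality bounds the square of the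
    correlation by an average over pairs of shifts.  The diagonal contributes at
    most [1 / H], so for some pair of distinct shifts the correlation along the
    shift of [a - q] by [h] and the derived polynomials is large, and the first of
    these carries [F]. *)
Lemma controlled_step a (s : seq {poly R}) q (D : nat) :
  integer_poly a -> integer_poly q -> (forall p, p \in s -> integer_poly p) ->
  (1 < size (a - q)%R)%N ->
  (forall h h' : int, D%:Z <= `|h' - h| ->
     controlled (affine (a - q) 1 h) (derived q a s h h')) ->
  controlled a s.
Proof.
move=> ia iq is_ saq hyp e e0.
have e4 : 0 < e ^+ 2 / 4 by nra.
have [H H0 HC] := natural_bound 1 e4; rewrite mulrC -ler_pdivrMr ?ltr0n // in HC.
(* this spacing makes distinct shifts differ by more than [D] *)
pose sh (i : nat) : int := D.+1%:Z * i%:Z.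
pose good i j t (c : R) := i != j -> forall (m : mean R) F L, ball F -> pair_balls L ->
    [seq p.1 | p <- L] = derived q a s (sh i) (sh j) ->
    e ^+ 2 / 4 <= `|corr m ((affine (a - q) 1 (sh i), F) :: L)| ->
    Num.min c 1 ^+ (2 ^ t) <= gow t 1 F.
have gmono i j t t' (c c' : R) : (t <= t')%N -> 0 < c' -> c' <= c ->
    good i j t c -> good i j t' c'.
  move=> tt c'0 cc g ij m F L bF bL Ls ec.
  have m0' : 0 <= Num.min c' 1 by rewrite le_min ltW ?ler01.
  have g1 : Num.min c' 1 ^+ (2 ^ t) <= gow t 1 F.
    apply: le_trans (g ij m F L bF bL Ls ec); rewrite lerXn2r ?nnegrE //.
      by rewrite le_min ler01 (le_trans (ltW c'0)).
    by rewrite le_min !ge_min cc lexx orbT.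
  have := gow_mono_iter (t' - t) bF (exprn_ge0 _ m0') g1.
  by rewrite subnKC // -exprM -expnD subnKC.
have [t [c [c0 hc]]] : exists t (c : R), 0 < c /\ forall i, (i < H)%N ->
    forall j, (j < H)%N -> good i j t c.
  apply: uniform_choice => [i t t' c c' tt c'0 cc g j jH|i].
    exact: (gmono i j _ _ _ _ tt c'0 cc (g j jH)).
  apply: uniform_choice => [j t t' c c' tt c'0 cc g|j]; first exact: (gmono i j _ _ _ _ tt c'0 cc g).
  have [->|ij] := eqVneq i j; first by exists 0%N, 1; split=> // /eqP.
  have far_ij : D%:Z <= `|sh j - sh i|.
    rewrite /sh -mulrBr normrM; move/eqP: ij => ij; nia.
  have [t [c [c0 h]]] := hyp _ _ far_ij _ e4; exists t, c; split=> // _ m F L bF bL Ls ec.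
  apply: le_trans (h m F L bF bL Ls ec); rewrite lerXn2r ?nnegrE ?(ltW c0) //.
    by rewrite le_min ltW ?ler01.
  by rewrite ge_min lexx.
exists t, (Num.min c 1); split=> [|m F L bF bL Ls ec]; first by rewrite lt_min c0 ltr01.
rewrite leNgt; apply/negP => lt.
pose s' := [seq sh i | i <- iota 0 H].
have s'0 : (0 < size s')%N by rewrite size_map size_iota.
have bFL : pair_balls ((a, F) :: L) by [].
have ip p : p \in [seq p.1 | p <- (a, F) :: L] -> integer_poly p.
  by rewrite /= in_cons Ls => /predU1P[->|/is_].
have [G bG] := corr_rebase m iq ip bFL; rewrite /= /far /= saq /= => cE.
pose L1 := [seq (p.1 - q, p.2) | p <- L & far q p].
have bL1 : pair_balls L1 by apply/(@pair_balls_map (fun p => p - q))/pair_balls_filter.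
pose X n := term ((a - q, F) :: L1) n.
have bX n : ball (X n) by apply: term_ball.
pose L2 h h' := (affine (a - q) 1 h', F) :: [seq (affine p.1 1 h, p.2) | p <- L1] ++
  [seq (affine p.1 1 h', p.2) | p <- L1].
have XE n h h' : X (n + h) * X (n + h') = term ((affine (a - q) 1 h, F) :: L2 h h') n.
  by rewrite /X !term_shift /= !term_cons term_cat; ring.
have bL2 h h' : pair_balls (L2 h h').
  by split=> //; apply: pair_balls_cat; apply: (@pair_balls_map (fun p => affine p 1 _)).
have L2E h h' : [seq p.1 | p <- L2 h h'] = derived q a s h h'.
  rewrite /derived /= map_cat -Ls -recenterE -/L1; congr (_ :: _ ++ _);
  by rewrite -!map_comp.
have := state_van_der_corput m s'0 bG bX; rewrite -cE.
under eq_avg do under eq_avg do under eq_mean do rewrite XE.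
rewrite avg_map; under eq_avg do rewrite /= avg_map /=.
move=> h; have : e ^+ 2 <= 1 / H%:R + e ^+ 2 / 4.
  apply: le_trans (_ : corr m ((a, F) :: L) ^+ 2 <= _).
    by apply: sqr_le_norm; [exact: ltW|].
  apply: le_trans h _.
  have := @avg_diagonal R H 1 (e ^+ 2 / 4) (fun i j => corr m ((affine (a - q) 1 (D.+1%:Z * i), F) ::
    L2 (D.+1%:Z * i) (D.+1%:Z * j))) H0.
  have AE (f : int -> R) : avg [seq Posz i | i <- iota 0 H] f = avg (iota 0 H) (fun i => f (Posz i)).
    by rewrite avg_map.
  rewrite AE; under eq_avg do rewrite AE.
  apply=> [i|||i j iH jH ij] //; last 1 first.
  - apply: le_trans (ler_norm _) _; rewrite leNgt; apply/negP => big; move: lt.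
    rewrite ltNge; apply/negP; rewrite negbK.
    by apply: (hc i iH j jH ij m F (L2 (sh i) (sh j)) bF); rewrite ?L2E // ltW.
  - by apply: le_trans (ler_norm _) _; apply: corr_bound; split; [exact: bF|exact: bL2].
  - exact: ltW.
by nra.
Qed.

Lemma controlled_nil a : controlled a [::].
Proof.
move=> e e0; exists 0%N, (e ^+ 2); split=> [|m F [|//] bF _ _]; first by rewrite exprn_gt0.
rewrite /corr; under eq_mean do rewrite term_cons /term big_nil mulr1 state_act.
rewrite mean_const expn0 expr1 => ef; apply: le_trans (state_le_gow m0 bF).
by apply: sqr_le_norm; [exact: ltW|].
Qed.

Lemma pval_linear q n h : integer_poly q -> (size q <= 2)%N ->
  pval q (n + h) = pval q n + (pval q 1 - pval q 0) * h.
Proof.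
move=> iq sq; apply: (@int_inj R); rewrite intrD intrM intrB !pvalE // !(linear_poly _ sq).
by rewrite intrD; ring.
Qed.

(** When all the differences are linear, van der Corput's trick reproduces the
    same polynomials, so that one more average is gained at each step. *)
Lemma controlled_linear k a (s : seq {poly R}) : (size s <= k)%N -> integer_poly a ->
  (forall p, p \in s -> integer_poly p) ->
  (forall p, p \in s -> size (p - a)%R = 2) -> controlled a s.
Proof.
elim: k a s => [|k IH] a [|q s] //; try by move=> *; exact: controlled_nil.
move=> sk ia is_ sa.
have iq : integer_poly q by apply: is_; rewrite mem_head.
have sqa : size (q - a)%R = 2 by apply: sa; rewrite mem_head.
have saq : size (a - q)%R = 2 by rewrite -sqa -size_polyN opprB.
have le2 p : p \in q :: s -> (size (p - q)%R <= 2)%N.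
  move=> ps; have -> : p - q = (p - a) - (q - a) by ring.
  by apply: leq_trans (size_polyD _ _) _; rewrite size_polyN sqa (sa _ ps).
set r := recenter q (q :: s).
have rE p : p \in r -> exists2 p', p' \in q :: s & p = p' - q.
  by move=> /mapP[p']; rewrite mem_filter => /andP[_ ps] ->; exists p'.
have ir p : p \in r -> integer_poly p.
  by move=> /rE[p' ps ->]; apply: integer_polyB => //; exact: is_.
have ctr : controlled (a - q) r.
  apply: IH => //.
  - rewrite /r /recenter /= subrr size_poly0 /= size_map size_filter.
    by apply: leq_trans (count_size _ _) _.
  - exact: integer_polyB.
  - move=> p /rE[p' ps ->]; have -> : p' - q - (a - q) = p' - a by ring.
    exact: sa.
move=> e e0; have e2 : 0 < e ^+ 2 / 2 by nra.
have [t [c [c0 hc]]] := ctr _ e2.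
pose beta (b : {poly R}) : int := pval b 1 - pval b 0.
pose B := beta (a - q).
have iaq : integer_poly (a - q) by exact: integer_polyB.
have B0 : B != 0.
  apply/eqP => B0; have : (a - q)`_1 = 0.
    have := pvalE 1 iaq; have := pvalE 0 iaq; have : pval (a - q) 1 = pval (a - q) 0.
      by apply/eqP; rewrite -subr_eq0; apply/eqP.
    by move=> -> -> E; have := linear_poly 1%:~R (eq_leq saq); have := linear_poly 0%:~R (eq_leq saq); rewrite /= in E *; nra.
  have : lead_coef (a - q) != 0 by rewrite lead_coef_eq0 -size_poly_eq0 saq.
  by rewrite lead_coefE saq /= => /eqP.
pose c' := c ^+ (2 ^ t) * (e ^+ 2 / 2) / `|B|%:~R.
have nB : 0 < `|B|%:~R :> R by rewrite ltr0z normr_gt0.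
have c'0 : 0 < c' by rewrite divr_gt0 // mulr_gt0 // exprn_gt0.
exists t.+1, (Num.min c' 1); split=> [|m F L bF bL Ls ec]; first by rewrite lt_min c'0 ltr01.
have min0 : 0 <= Num.min c' 1 by rewrite le_min ltW ?ler01.
apply: le_trans (_ : c' <= _).
  apply: le_trans (_ : Num.min c' 1 <= _); last by rewrite ge_min lexx.
  by rewrite -[leRHS]expr1 ler_wiXn2l ?ge_min ?lexx ?orbT // expn_gt0.
rewrite /c' ler_pdivrMr //.
have bFL : pair_balls ((a, F) :: L) by [].
have ip p : p \in [seq p.1 | p <- (a, F) :: L] -> integer_poly p.
  by rewrite /= in_cons Ls => /predU1P[->|/is_].
have [G bG] := corr_rebase m iq ip bFL; rewrite /= /far /= saq /= => cE.
pose L1 := [seq (p.1 - q, p.2) | p <- L & far q p].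
have L1E : [seq p.1 | p <- L1] = r by rewrite recenterE Ls.
have bL1 : pair_balls L1 by apply/(@pair_balls_map (fun p => p - q))/pair_balls_filter.
pose X n := term ((a - q, F) :: L1) n.
have bX n : ball (X n) by apply: term_ball.
pose L2 h h' := [seq (p.1, T (beta p.1 * h) p.2 * T (beta p.1 * h') p.2) | p <- L1].
have bL2 h h' : pair_balls (L2 h h').
  rewrite /pair_balls -map_comp; move: bL1; rewrite /pair_balls.
  by elim: {+}L1 => //= p L' IH' [bp /IH']; split=> //; ball.
have XE n h h' : X (n + h) * X (n + h') =
    term ((a - q, T (B * h) F * T (B * h') F) :: L2 h h') n.
  rewrite /X !term_cons /= !pval_linear ?saq // !actD -/B actM.
  have -> : term (L2 h h') n = term L1 (n + h) * term L1 (n + h').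
    rewrite /term big_map -big_split big_seq [RHS]big_seq; apply: eq_bigr => p pL /=.
    have pr : p.1 \in r by rewrite -L1E; exact: map_f.
    have [p' ps pE] := rE _ pr.
    have sp : (size p.1 <= 2)%N by rewrite pE; exact: le2.
    have ip1 := ir _ pr.
    by rewrite !(pval_linear _ _ ip1 sp) !actD actM -/(beta p.1); ring.
  by ring.
pose rho h := gow t 1 (F * T h F).
have pdr : pos_def (fun h => rho (B * h)).
  have [ev pt] := gow_pos_def m0 t 1 bF; split=> [v|u]; first by rewrite /rho mulrN ev.
  have := pt [seq (p.1, B * p.2) | p <- u]; rewrite /energy big_map; congr (0 <= _).
  by apply: eq_bigr => p _; rewrite big_map; apply: eq_bigr => p' _ /=; rewrite mulrBr.
have lower_bound : c ^+ (2 ^ t) * (e ^+ 2 / 2) <= m0 (fun h => rho (B * h)).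
  apply/ler_addgt0Pr => x x0; have [u [u0 uP]] := energy_le_mean pdr x0.
  apply: le_trans (uP m0); have := state_van_der_corput m u0 bG bX; rewrite -cE.
  under eq_avg do under eq_avg do under eq_mean do rewrite XE.
  move=> h; have ee : e ^+ 2 <= corr m ((a, F) :: L) ^+ 2.
    by apply: sqr_le_norm; [exact: ltW|].
  pose y k l := corr m ((a - q, T (B * k) F * T (B * l) F) :: L2 k l).
  apply: le_trans (_ : avg u (fun k => avg u (fun l =>
     c ^+ (2 ^ t) * y k l + - (c ^+ (2 ^ t) * (e ^+ 2 / 2)))) <= _).
    under eq_avg do rewrite avgD avgZ avg_cst //.
    rewrite avgD avgZ avg_cst //.
    have : e ^+ 2 <= avg u (fun k => avg u (y k)) by exact: le_trans ee h.
    have : 0 <= c ^+ (2 ^ t) by rewrite exprn_ge0 // ltW.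
    by nra.
  apply: avg_le => i; apply: avg_le => l.
  have bFF : ball (T (B * i) F * T (B * l) F) by ball.
  have yb : y i l <= 1.
    apply: le_trans (ler_norm _) _; apply: corr_bound; split; [exact: bFF|exact: bL2].
  rewrite /rho mulrBr gow_shiftB; have [big|small] := lerP (e ^+ 2 / 2) (y i l).
    have := hc m _ (L2 i l) bFF (bL2 i l) _ (le_trans big (ler_norm _)).
    rewrite -map_comp L1E => /(_ erefl).
    have : 0 <= c ^+ (2 ^ t) by rewrite exprn_ge0 // ltW.
    by nra.
  have := gow_ge0 m0 t 1 bFF; have : 0 <= c ^+ (2 ^ t) by rewrite exprn_ge0 // ltW.
  by nra.
apply: le_trans lower_bound _.
have -> : m0 (fun h => rho (B * h)) = m0 (fun h => rho (`|B|%N%:Z * h)).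
  have [ev _] := gow_pos_def m0 t 1 bF; apply: eq_mean => h; have [B1|B1] := lerP 0 B.
    by rewrite gez0_abs.
  by rewrite ltz0_abs // mulNr /rho ev.
apply: le_trans (mean_dilate m0 (gow_pos_def m0 t 1 bF) _ _) _.
- by move=> n; apply: gow_ge0; ball.
- by rewrite absz_gt0.
by rewrite mulrC -abszE -pmulrn.
Qed.

(** The number of distinct leading coefficients of the polynomials of size [e];
    compared from the largest [e] down, these numbers are what decreases at each
    step of the induction. *)
Definition weight (s : seq {poly R}) (e : nat) :=
  size (undup [seq b`_e.-1 | b : {poly R} <- s & size b == e]).

Lemma size_undup_shift (s s' : seq R) k : {in s, forall x, x + k \in s'} ->
  (size (undup s) <= size (undup s'))%N.
Proof.
move=> h; rewrite -(size_map (fun x => x + k)); apply: uniq_leq_size => [|x /mapP[y]].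
  by rewrite map_inj_uniq ?undup_uniq //; exact: addIr.
by rewrite mem_undup => /h yk ->; rewrite mem_undup.
Qed.

Lemma size_undup_shift_lt (s s' : seq R) k z : z \in s' ->
  {in s, forall x, x + k \in s' /\ x + k != z} ->
  (size (undup s) < size (undup s'))%N.
Proof.
move=> zs h; rewrite -(size_map (fun x => x + k)).
apply: (@uniq_leq_size _ (z :: [seq x + k | x <- undup s])) => [|x].
  rewrite /= map_inj_uniq ?undup_uniq ?andbT; last exact: addIr.
  by apply/mapP => -[x]; rewrite mem_undup => /h[_ /eqP + /esym].
rewrite in_cons mem_undup => /predU1P[-> //|/mapP[y]].
by rewrite mem_undup => /h[yk _] ->.
Qed.

Lemma derivedP q a (s : seq {poly R}) h h' x :
  x \in affine (a - q) 1 h :: derived q a s h h' ->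
  exists y (g : int), [/\ y \in (a - q) :: recenter q s, x = affine y 1 g &
    x = affine (a - q) 1 h \/ (g = h' \/ y \in recenter q s /\ g = h)].
Proof.
rewrite /derived !in_cons mem_cat => /or4P[/eqP->|/eqP->|/mapP[y ys ->]|/mapP[y ys ->]].
- by exists (a - q), h; rewrite mem_head; split=> //; left.
- by exists (a - q), h'; rewrite mem_head; split=> //; right; left.
- by exists y, h; rewrite in_cons ys orbT; split=> //; right; right.
- by exists y, h'; rewrite in_cons ys orbT; split=> //; right; left.
Qed.

Lemma recenterP q (s : seq {poly R}) y : y \in recenter q s ->
  exists p, [/\ p \in s, y = p - q & (1 < size y)%N].
Proof. by move=> /mapP[p]; rewrite mem_filter => /andP[sp ps] ->; exists p. Qed.

(** The polynomial [q] is the one that van der Corput's trick removes.  If the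
    differences [p - q] do not all share the degree and leading coefficient of
    [a - q], the next one removed is a shift of the [p] of least degree among the
    exceptions, which keeps the degree and removes one leading coefficient.  If
    they do, then after one step every pairwise difference has smaller degree. *)
Lemma controlled_induction (N : nat) (w : nat -> nat) a (s : seq {poly R}) q :
  integer_poly a -> integer_poly q -> (forall p, p \in s -> integer_poly p) ->
  (2 < size (a - q)%R < N)%N ->
  (forall p, p \in s -> (size (p - q)%R <= size (a - q)%R)%N) ->
  (forall p, p \in s -> (1 < size (p - a)%R)%N) ->
  (forall e, w e = weight [seq p - q | p <- a :: s] e) -> controlled a s.
Proof.
move: a s q; elim/(@lexicographic_ind N): w => w IH a s q ia iq is_ /andP[sb bN] sz sa wE.
set b := a - q in sb bN sz; set d := size b in sb bN sz.
have ib : integer_poly b by exact: integer_polyB.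
have [D0 sep] := shifts_separate_seq (b :: recenter q s) sb.
apply: (@controlled_step a s q D0.+1) => // [|h h' hh]; first exact: ltnW.
have hne : h != h' by apply/eqP => E; lia.
have hD : D0%:Z <= `|h' - h| by lia.
pose a' := affine b 1 h; rewrite -/b -/a'.
have oldP y : y \in b :: recenter q s -> y \in [seq p - q | p <- a :: s].
  rewrite in_cons => /predU1P[->|/recenterP[p [ps -> _]]]; first by rewrite /= mem_head.
  by apply: (@map_f _ _ (fun p => p - q)); rewrite in_cons ps orbT.
have iy y : y \in b :: recenter q s -> integer_poly y.
  rewrite in_cons => /predU1P[->//|/recenterP[p [ps -> _]]].
  by apply: integer_polyB => //; exact: is_.
have sy y : y \in b :: recenter q s -> (1 < size y <= d)%N.
  rewrite in_cons => /predU1P[->|/recenterP[p [ps yE s1]]]; first by rewrite leqnn ltnW.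
  by rewrite s1 yE sz.
have newP x : x \in a' :: derived q a s h h' ->
    exists2 y, y \in b :: recenter q s & exists g : int, x = affine y 1 g.
  by move=> /derivedP[y [g [yb -> _]]]; exists y => //; exists g.
have ia' x : x \in a' :: derived q a s h h' -> integer_poly x.
  by move=> /newP[y yb [g ->]]; apply: integer_affine; exact: iy.
have sx x : x \in a' :: derived q a s h h' -> (size x <= d)%N.
  by move=> /newP[y /sy/andP[_ yd] [g ->]]; rewrite size_shift.
have sa' x : x \in derived q a s h h' -> (1 < size (x - a')%R)%N.
  rewrite in_cons mem_cat => /or3P[/eqP->|/mapP[y yr ->]|/mapP[y yr ->]].
  - by apply: sep => //; rewrite mem_head.
  - have [p [ps -> _]] := recenterP yr; rewrite -affineB size_shift.
    have -> : p - q - b = p - a by rewrite /b; ring.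
    exact: sa.
  - by apply: sep => //; rewrite in_cons yr orbT.
pose odd_one (y : {poly R}) := (1 < size y)%N && ~~ ((size y == d) && (y`_d.-1 == b`_d.-1)).
(* first case: there are exceptions, and [c] is one of least degree *)
have [exc|] := boolP (has odd_one (recenter q s)).
  have [c [cr /andP[c1 cb] cmin]] := seq_argmin (fun y : {poly R} => size y) exc.
  have cb' : c \in b :: recenter q s by rewrite in_cons cr orbT.
  have /andP[_ cd] := sy _ cb'.
  have bc : size (b - c) = d.
    apply/eqP; rewrite eqn_leq; apply/andP; split.
      by apply: leq_trans (size_polyD _ _) _; rewrite size_polyN geq_max leqnn.
    rewrite leqNgt; apply/negP => lt; move: cb.
    have dp : d = d.-1.+1 by rewrite prednK // -/d; apply: leq_trans sb.
    have bcd : b`_d.-1 = c`_d.-1.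
      by apply/eqP; rewrite -subr_eq0 -coefB nth_default // -ltnS -dp.
    rewrite bcd eqxx andbT => /eqP; apply; apply/eqP; rewrite eqn_leq cd /=.
    have : lead_coef b != 0 by rewrite lead_coef_eq0 -size_poly_eq0 -/d; lia.
    rewrite lead_coefE -/d bcd; apply: contraR; rewrite -ltnNge => lt'.
    by rewrite nth_default // -ltnS -dp.
  pose c' := affine c 1 h.
  have lc (y : {poly R}) (g : int) E : (size y <= E)%N -> (size c <= E)%N -> (0 < E)%N ->
      (affine y 1 g - c')`_E.-1 = y`_E.-1 - c`_E.-1.
    by move=> yE cE E0; rewrite coefB !coef_shift_top ?prednK.
  have big (y : {poly R}) (g : int) : (size c < size y)%N -> size (affine y 1 g - c') = size y.
    by move=> cy; rewrite size_polyDl ?size_polyN !size_shift.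
  have c0 : (0 < size c)%N by exact: ltnW.
  apply: (IH (weight [seq x - c' | x <- a' :: derived q a s h h']) _ a' _ c') => //.
  - exists (size c); split; first exact: leq_ltn_trans bN.
      rewrite wE; apply: (@size_undup_shift_lt _ _ (c`_(size c).-1) (c`_(size c).-1)).
        by apply/mapP; exists c => //; rewrite mem_filter eqxx oldP.
      move=> _ /mapP[z + ->]; rewrite mem_filter => /andP[/eqP sE /mapP[x /newP[y yb [g xE]] zE]].
      rewrite {}zE {}xE in sE *.
      have yc : (size y <= size c)%N.
        by rewrite leqNgt; apply/negP => lt; move: sE; rewrite big // => E; rewrite E ltnn in lt.
      rewrite lc // subrK; have nz : y`_(size c).-1 - c`_(size c).-1 != 0.
        rewrite -(lc _ g) // -sE -lead_coefE lead_coef_eq0 -size_poly_eq0 sE.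
        by rewrite -lt0n.
      split; last by rewrite -subr_eq0.
      apply: map_f; rewrite mem_filter oldP // andbT eqn_leq yc /=.
      rewrite leqNgt; apply/negP => lt; have yr : y \in recenter q s.
        move: yb; rewrite in_cons => /predU1P[yE|//].
        by move: lt; rewrite yE -/d ltnNge cd.
      have : odd_one y.
        have /andP[y1 _] := sy _ yb; rewrite /odd_one y1 /=.
        apply/negP => /andP[/eqP yd _]; by move: lt; rewrite yd ltnNge cd.
      by move=> /(cmin _ yr); rewrite leqNgt lt.
    move=> E /andP[cE EN]; rewrite wE; apply: (@size_undup_shift _ _ 0).
    move=> _ /mapP[z + ->]; rewrite mem_filter => /andP[/eqP sE /mapP[x /newP[y yb [g xE]] zE]].
    rewrite {}zE {}xE in sE *.
    have yE : size y = E.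
      have [yc|cy] := leqP (size y) (size c); last by rewrite -sE big.
      have : (size (affine y 1 g - c')%R <= size c)%N.
        by apply: leq_trans (size_polyD _ _) _; rewrite size_polyN !size_shift geq_max yc leqnn.
      by rewrite sE leqNgt cE.
    rewrite lc ?yE ?(ltnW cE) ?(ltn_trans c0) // addr0.
    rewrite [c`__]nth_default ?subr0; last by rewrite -ltnS prednK // (ltn_trans c0).
    by apply: map_f; rewrite mem_filter yE eqxx oldP.
  - by apply: ia'; rewrite mem_head.
  - by apply: integer_affine; exact: iy.
  - by move=> p pd; apply: ia'; rewrite in_cons pd orbT.
  - by rewrite /a' /c' -affineB size_shift bc sb.
  - move=> p pd; rewrite /a' /c' -affineB size_shift bc.
    apply: leq_trans (size_polyD _ _) _; rewrite size_polyN geq_max size_shift cd andbT.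
    by apply: sx; rewrite in_cons pd orbT.
(* second case: all leading terms agree, and cancel in the differences *)
move=> /hasPn same; have allb y : y \in b :: recenter q s -> size y = d /\ y`_d.-1 = b`_d.-1.
  rewrite in_cons => /predU1P[->//|yr]; have := same _ yr; rewrite /odd_one.
  have [p [_ _ ->]] := recenterP yr; by rewrite /= negbK => /andP[/eqP -> /eqP].
have sdiff x x' : x \in a' :: derived q a s h h' -> x' \in a' :: derived q a s h h' ->
    (size (x - x')%R <= d.-1)%N.
  move=> xd xd'; apply/leq_sizeP => j; rewrite leq_eqVlt => /predU1P[<-|lt].
    have [y /allb[yd yl] [g ->]] := newP _ xd; have [y' /allb[yd' yl'] [g' ->]] := newP _ xd'.
    by rewrite coefB !coef_shift_top ?yd ?yd' ?prednK ?yl ?yl' ?subrr //; apply: leq_trans sb.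
  rewrite nth_default //; apply: leq_trans (size_polyD _ _) _.
  have dj : (d <= j)%N by apply: leq_trans lt; rewrite leqSpred.
  by rewrite size_polyN geq_max !(leq_trans _ dj) ?sx.
have a'd : a' \in a' :: derived q a s h h' by rewrite mem_head.
have tl x : x \in derived q a s h h' -> x \in a' :: derived q a s h h'.
  by move=> xd; rewrite in_cons xd orbT.
have [d3|d4] := leqP d 3.
  apply: (@controlled_linear (size (derived q a s h h'))) => // [|p pd|p pd].
  - exact: ia'.
  - by apply: ia'; exact: tl.
  - have p1 := sa' _ pd; apply/eqP; rewrite eqn_leq p1 andbT.
    by apply: leq_trans (sdiff _ _ (tl _ pd) a'd) _; move: d3; case: (d) => [|[|[|[|]]]].
pose c' := affine b 1 h'; have c'd : c' \in derived q a s h h' by rewrite mem_head.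
have sc : size (a' - c') = d.-1.
  have dE : size b = d.-2.+2 by rewrite -/d; move: (d) d4 => [|[|]].
  by rewrite (size_shift_difference dE hne); move: (d) d4 => [|[|]].
apply: (IH (weight [seq x - c' | x <- a' :: derived q a s h h']) _ a' _ c') => //.
- have none E : (d <= E)%N -> weight [seq x - c' | x <- a' :: derived q a s h h'] E = 0%N.
    move=> dE; rewrite /weight (_ : [seq _ <- _ | _] = [::]) //.
    apply/eqP; rewrite -size_eq0 size_filter -leqn0 leqNgt -has_count; apply/hasPn.
    move=> _ /mapP[x xd ->]; apply/eqP => sE.
    have := sdiff _ _ xd (tl _ c'd); rewrite sE => /(leq_trans dE).
    by move: (d) d4 => [|k] //=; rewrite ltnn.
  exists d; split=> // [|E /andP[dE _]]; last by rewrite none // ltnW.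
  rewrite none // wE lt0n size_eq0; apply/eqP => nil.
  have : b`_d.-1 \in undup [seq z`_d.-1 | z : {poly R} <-
      [seq p - q | p <- a :: s] & size z == d].
    by rewrite mem_undup; apply: map_f; rewrite mem_filter eqxx oldP // mem_head.
  by rewrite nil in_nil.
- exact: ia'.
- by apply: ia'; exact: tl.
- by move=> p pd; apply: ia'; exact: tl.
- by rewrite sc; move: (d) d4 bN => [|k] //= k3 /ltnW -> ; rewrite andbT.
- by move=> p pd; rewrite sc; apply: sdiff; exact: tl.
Qed.

(** If no difference with [a] has degree greater than 1, the linear case applies;
    otherwise the induction starts by removing the [q] for which [q - a] has the
    largest degree, which makes the degrees of all [p - q] at most that of [a - q]. *)
Theorem polynomials_controlled a (s : seq {poly R}) :
  integer_poly a -> (forall p, p \in s -> integer_poly p) ->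
  (forall p, p \in s -> (1 < size (p - a)%R)%N) -> controlled a s.
Proof.
move=> ia is_ sa; have [big|] := boolP (has (fun p => 2 < size (p - a)%R)%N s); last first.
  move=> /hasPn le2; apply: (@controlled_linear (size s)) => // p ps.
  by apply/eqP; rewrite eqn_leq sa // andbT leqNgt; exact: le2.
have [x0 x0s x02] := hasP big.
pose n := \max_(p <- s) size (p - a)%R.
have le p : p \in s -> (size (p - a)%R <= n)%N.
  by move=> ps; rewrite /n (big_rem _ ps) /= leq_maxl.
have hT : has predT s by apply/hasP; exists x0.
have [q [qs _ qmin]] := seq_argmin (fun p => n - size (p - a)%R)%N hT.
have qmax p : p \in s -> (size (p - a)%R <= size (q - a)%R)%N.
  by move=> ps; have := qmin p ps isT; have := le _ ps; have := le _ qs;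
  move: (size _) (size _) => u v; lia.
have aq : size (a - q)%R = size (q - a)%R by rewrite -size_polyN opprB.
apply: (@controlled_induction (size (q - a)%R).+1 _ a s q) => //.
- exact: is_.
- by rewrite aq ltnSn andbT; exact: leq_trans x02 (qmax _ x0s).
- move=> p ps; rewrite aq; have -> : p - q = (p - a) + (a - q) by ring.
  by apply: leq_trans (size_polyD _ _) _; rewrite geq_max aq leqnn qmax.
Qed.

End Control.

(** * Correlations of tame functions *)

Section TameCorrelations.
Context {R : realType} {S : msys R} (m0 : mean R) {l : nat}.
Implicit Types (f g w : obs S) (F : 'I_l -> obs S) (L : seq (obs S * 'I_l)) (v : 'rV[int]_l).
Local Notation phi := (@state R S).
Local Notation T := (@act R S).
Local Notation sc := (@scal R S).
Local Notation proj := (proj m0).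
Local Notation tame := (tame m0).
Local Notation tensor_norm := (tensor_norm m0).

(** A multiple of [r] has more invariant functions than [r]. *)
Lemma proj_sq_mono r r' f : (r %| r')%N -> ball f ->
  phi (proj r f ^+ 2) <= phi (proj r' f ^+ 2).
Proof.
move=> rr' bf; have ir' := invariant_dvd rr' (proj_invariant m0 r bf).
have := state_cauchy (proj r f) (proj r' f).
rewrite (proj_adjoint m0 ir' bf) -proj_sq // => h.
have := state_sq_ge0 (proj r f); rewrite le_eqVlt => /predU1P[<-|x0].
  exact: state_sq_ge0.
by rewrite expr2 ler_pM2l in h.
Qed.

(** The kernel of a tensor product: a correlation of two translates, each factor
    being averaged along its own orbit. *)
Fixpoint kern L w v v' : R :=
  if L is (g, j) :: L' then
    m0 (fun k => kern L' (w * (T (v 0 j + k) g * T (v' 0 j + k) g)) v v')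
  else phi w.

Definition axis_ball L := all_ball [seq q.1 | q <- L].

Lemma kern_bound L w B v v' : axis_ball L -> ball B ->
  `|kern L (w * B) v v'| <= phi (w ^+ 2) + 1.
Proof.
rewrite /axis_ball; elim: L B => [|[g j] L IH] B /=.
  move=> _ bB; apply: norm_le_succ; first exact: state_sq_ge0.
  by rewrite mulrC; exact: ball_cauchy.
move=> [bg bL] bB; apply: mean_bound => k.
by rewrite -mulrA; apply: IH => //; ball.
Qed.

Lemma kern_bounded L w v v' (B : int -> obs S) : axis_ball L -> (forall k, ball (B k)) ->
  bounded (fun k => kern L (w * B k) v v').
Proof. by move=> bL bB; eexists => k; exact: kern_bound. Qed.

Lemma kernC L w v v' : kern L w v v' = kern L w v' v.
Proof.
elim: L w => //= -[g j] L IH w; apply: eq_mean => k.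
by rewrite IH; congr kern; rewrite [T _ g * _]mulrC.
Qed.

Lemma kern_shift L w v v' u : axis_ball L -> kern L w (v + u) (v' + u) = kern L w v v'.
Proof.
rewrite /axis_ball; elim: L w => //= -[g j] L IH w [bg bL].
rewrite -[RHS](mean_shift m0 (u 0 j)); last first.
  apply: (@kern_bounded _ w v v' (fun k => T (v 0 j + k) g * T (v' 0 j + k) g)) => // k.
  by ball.
apply: eq_mean => k; rewrite IH // !mxE; congr kern; congr (_ * (T _ _ * T _ _)); ring.
Qed.

Lemma tensor_norm_kern I L (s : seq I) (W : I -> obs S) (v : I -> 'rV[int]_l) :
  axis_ball L ->
  tensor_norm [seq (q.1, fun i => v i 0 q.2) | q <- L] s W =
  \sum_(i <- s) \sum_(j <- s) kern L (W i * W j) (v i) (v j).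
Proof.
rewrite /axis_ball; elim: L W => [|[g j] L IH] W /=.
  move=> _; rewrite expr2 mulr_suml state_sum; apply: eq_bigr => i _.
  by rewrite mulr_sumr state_sum.
move=> [bg bL].
have bk i i' : bounded (fun k => kern L (W i * W i' *
    (T (v i 0 j + k) g * T (v i' 0 j + k) g)) (v i) (v i')).
  by apply: (@kern_bounded _ _ _ _ (fun k => T (v i 0 j + k) g * T (v i' 0 j + k) g)) => // k; ball.
transitivity (m0 (fun k => \sum_(i <- s) \sum_(i' <- s) kern L (W i * W i' *
    (T (v i 0 j + k) g * T (v i' 0 j + k) g)) (v i) (v i'))).
  apply: eq_mean => k; rewrite IH //; apply: eq_bigr => i _; apply: eq_bigr => i' _.
  by congr kern; ring.
rewrite mean_sum => [|i]; last exact: bounded_sum.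
by apply: eq_bigr => i _; rewrite mean_sum.
Qed.

Lemma kernZ L c w v v' : axis_ball L -> kern L (sc c * w) v v' = c * kern L w v v'.
Proof.
rewrite /axis_ball; elim: L w => [|[g j] L IH] w /=; first by rewrite stateZ.
move=> [bg bL]; rewrite -mean_scale; last first.
  by apply: (@kern_bounded _ _ _ _ (fun k => T (v 0 j + k) g * T (v' 0 j + k) g)) => // k; ball.
by apply: eq_mean => k; rewrite -mulrA IH.
Qed.

Lemma kern_energy L (s : seq (R * 'rV[int]_l)) : axis_ball L ->
  tensor_norm [seq (q.1, fun p : R * 'rV[int]_l => p.2 0 q.2) | q <- L] s (fun p => sc p.1) =
  energy (fun v => kern L 1 v 0) s.
Proof.
move=> bL; rewrite (tensor_norm_kern s _ (fun p => p.2) bL).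
apply: eq_bigr => p _; apply: eq_bigr => q _.
rewrite -[sc p.1 * _]mulr1 -mulrA !kernZ // mulrA; congr (_ * _).
by rewrite -[RHS](kern_shift 1 (p.2 - q.2) 0 q.2 bL) subrK add0r.
Qed.

Lemma axis_balls I L (v : I -> 'rV[int]_l) : axis_ball L ->
  balls [seq (q.1, fun i => v i 0 q.2) | q <- L].
Proof. by rewrite /axis_ball; elim: L => //= q L IH [bq /IH]. Qed.

Lemma kern_pos_def L : axis_ball L -> pos_def (fun v => kern L 1 v 0).
Proof.
move=> bL; split=> [v|s].
  by rewrite -(kern_shift 1 (- v) 0 v bL) addNr add0r kernC.
rewrite -kern_energy //; apply: tensor_norm_ge0.
exact: (axis_balls (fun p : R * 'rV[int]_l => p.2) bL).
Qed.

Lemma tame_product C F (js : seq 'I_l) : 1 <= C -> (forall j, ball (F j)) ->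
  (forall j, j \in js -> tame C (F j)) ->
  exists2 L, axis_ball L & forall I (s : seq I) (W : I -> obs S) (v : I -> 'rV[int]_l),
    phi ((\sum_(i <- s) W i * \prod_(j <- js) T (v i 0 j) (F j)) ^+ 2) <=
    C ^+ size js * tensor_norm [seq (q.1, fun i => v i 0 q.2) | q <- L] s W.
Proof.
move=> C1 bF; have C0 : 0 <= C by lra.
elim: js => [|j js IH] tF.
  by exists [::] => // I s W v; rewrite expr0 mul1r /=; under eq_bigr do rewrite big_nil mulr1.
have [k ks|L bL LP] := IH; first by apply: tF; rewrite in_cons ks orbT.
have [gs bgs h] := tF j (mem_head _ _).
exists ([seq (g, j) | g <- gs] ++ L).
  rewrite /axis_ball map_cat -map_comp; apply: all_ball_cat => //.
  by rewrite (_ : map _ gs = gs) //; exact: map_id.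
move=> I s W v.
under eq_bigr do rewrite big_cons [T _ (F j) * _]mulrC mulrA.
apply: le_trans (h _ _ _ _) _.
rewrite exprS -mulrA ler_wpM2l // map_cat -map_comp.
apply: (tensor_norm_cat (exprn_ge0 _ C0) (balls_map (fun i => v i 0 j) bgs) (axis_balls v bL)).
  by move=> i; apply: ball_prod => k; ball.
by move=> W'; exact: LP.
Qed.

(** The product of the [F j], each translated along its own coordinate, except
    for the slot [i0] which is not moved.  By invariance, correlations along [a j] are
    the values of this function along the vector of the [a j - a i0]. *)
Definition joint (i0 : 'I_l) F v : R :=
  phi (\prod_j T (if j == i0 then 0 else v 0 j) (F j)).

Lemma jointE i0 F v j : joint i0 F v =
  phi (T (if j == i0 then 0 else v 0 j) (F j) *
    \prod_(k | k != j) T (if k == i0 then 0 else v 0 k) (F k)).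
Proof. by rewrite /joint (bigD1 j). Qed.

(** The Cauchy-Schwarz inequality removes the function in the slot [i0].  The others
    are tame, and the tensor norm that dominates them is the energy of the positive
    definite kernel [kern]. *)
Lemma joint_dominated i0 C F : 1 <= C -> (forall j, ball (F j)) ->
  (forall j, j != i0 -> tame C (F j)) ->
  exists K, [/\ pos_def K, K 0 <= C ^+ l * 2 & dominated (joint i0 F) K].
Proof.
move=> C1 bF tF; set js := [seq j <- enum 'I_l | j != i0].
have [j|L bL LP] := @tame_product C F js C1 bF.
  by rewrite mem_filter => /andP[/tF].
have C0 : 0 <= C ^+ l by apply: exprn_ge0; lra.
have pd := kern_pos_def bL.
exists (fun v => C ^+ l * kern L 1 v 0); split; first exact: scale_pos_def.
  rewrite ler_wpM2l //; apply: le_trans (ler_norm _) _.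
  have := kern_bound 1 0 0 bL (@ball1 R S).
  by rewrite mulr1 expr1n state1; lra.
move=> s.
have -> : \sum_(p <- s) p.1 * joint i0 F p.2 =
    phi (F i0 * \sum_(p <- s) sc p.1 * \prod_(j <- js) T (p.2 0 j) (F j)).
  rewrite mulr_sumr state_sum; apply: eq_bigr => p _.
  rewrite mulrCA stateZ; congr (_ * _); rewrite (jointE i0 F p.2 i0) eqxx act0; congr phi.
  congr (_ * _); rewrite /js big_filter big_enum_cond /=; apply: eq_bigr => j /negPf ->.
  by [].
apply: le_trans (ball_cauchy _ (bF i0)) _; apply: le_trans (LP _ _ _ _) _.
have EK : energy (fun v => C ^+ l * kern L 1 v 0) s = C ^+ l * energy (fun v => kern L 1 v 0) s.
  rewrite /energy mulr_sumr; apply: eq_bigr => p _.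
  by rewrite mulr_sumr; apply: eq_bigr => q _; ring.
rewrite kern_energy // EK ler_wpM2r //; first by case: pd.
rewrite ler_weXn2l // -[leqRHS](card_ord l) cardE size_filter; exact: count_size.
Qed.

(** A mean in the direction of the slot [j] averages [F j] and nothing else. *)
Lemma joint_iterated_mean i0 N F v (js : seq 'I_l) : uniq js -> (forall j, ball (F j)) ->
  iterated_mean m0 [seq N%:Z *: delta_mx 0 j | j <- js] (joint i0 F) v =
  joint i0 (fun j => if (j \in js) && (j != i0) then proj N (F j) else F j) v.
Proof.
move=> + bF; elim: js v => [|j js IH] v //= /andP[jjs ujs].
rewrite /invariant_part; under eq_mean do rewrite IH //.
set G := fun k : 'I_l => if (k \in js) && (k != i0) then proj N (F k) else F k.
set G' := fun k : 'I_l => _.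
have bG k : ball (G k) by rewrite /G; case: ifP => // _; exact: proj_ball.
have GG' k : k != j -> G' k = G k by move=> kj; rewrite /G' in_cons (negPf kj).
have Gj : G j = F j by rewrite /G (negPf jjs).
have cE k h : (v + (N%:Z *: delta_mx 0 j) *~ h) 0 k = v 0 k + (if k == j then N%:Z * h else 0).
  rewrite mxE -scaler_int !mxE eqxx /= intz; case: (k == j); rewrite ?mulr1 ?mulr0 ?addr0 //.
  by rewrite mulrC.
rewrite (jointE i0 G' v j); set B := \prod_(k | k != j) _.
transitivity (m0 (fun h => phi (T (if j == i0 then 0 else v 0 j + N%:Z * h) (F j) * B))).
  apply: eq_mean => h; rewrite (jointE i0 G _ j) Gj cE eqxx; congr phi; congr (_ * _).
  by apply: eq_bigr => k kj; rewrite cE (negPf kj) addr0 GG'.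
rewrite /G' mem_head /=; have [_|ji] := eqVneq j i0; first by rewrite mean_const.
rewrite [in RHS]state_actl projE //; apply: eq_mean => h.
by rewrite actD state_actl.
Qed.

End TameCorrelations.

(** * Correlations along independent polynomials *)

Section Correlations.
Context {R : realType} {S : msys R} (m0 : mean R) {l : nat} (a : 'I_l -> {poly R}).
Implicit Types (f g w : obs S) (F : 'I_l -> obs S) (A : {set 'I_l}).
Local Notation phi := (@state R S).
Local Notation T := (@act R S).
Local Notation proj := (proj m0).
Local Notation tame := (tame m0).

Definition correlation (m : mean R) F : R :=
  m (fun n => phi (\prod_j T (pval (a j) n) (F j))).

(** The coefficients add up to 0 because only the differences of the [a j] matter
    for a correlation, the state being invariant. *)
Definition affinely_independent := forall c : 'I_l -> int, \sum_j c j = 0 ->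
  (exists x : R, \sum_j (c j)%:~R *: a j = x%:P) -> forall j, c j = 0.

(** The claim of the induction over the slots: a function that contributes to a
    correlation correlates with functions invariant under a bounded power.  The
    slots outside [A] have been dealt with, and hold tame functions. *)
Definition periodic_part_large A i := forall (e C : R), 0 < e -> 1 <= C ->
  exists (r : nat) (c : R), [/\ (0 < r)%N, 0 < c & forall (m : mean R) F,
    (forall j, ball (F j)) -> (forall j, j \notin A -> tame C (F j)) ->
    e <= `|correlation m F| -> c <= phi (proj r (F i) ^+ 2)].

Hypothesis ia : forall j, integer_poly (a j).
Hypothesis inda : affinely_independent.

(** Weyl's theorem along the vector of the [a j - a i0] turns the correlation into an
    iterated mean, which replaces the functions in all slots except [i0] by their
    projections to the functions invariant under the [N]-th power.  Their product
    is invariant as well, so it only sees the projection of the function in slot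
    [i0]. *)
Lemma periodic_part_large_base A i0 i : A \subset [set i0] -> periodic_part_large A i.
Proof.
move=> sA e C e0 C1; pose b j := a j - a i0.
have ib j : integer_poly (b j) by exact: integer_polyB.
pose d := (\max_j size (b j))%N.
have sb j : (size (b j) <= d.+1)%N by apply: leqW; exact: (leq_bigmax j).
have ind : independent_mod [:: delta_mx 0 i0] b.
  move=> c cW [x cx]; have ci0 : c i0 = 0.
    have := cW _ (mem_head _ _); rewrite (bigD1 i0) //= mxE !eqxx mulr1 big1 ?addr0 //.
    by move=> j /negPf ji; rewrite mxE ji andbF mulr0.
  pose c' j := if j == i0 then - \sum_(k | k != i0) c k else c j.
  have c'0 : \sum_j c' j = 0.
    rewrite (bigD1 i0) //= /c' eqxx; rewrite (eq_bigr c) ?addNr // => j /negPf ->.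
    by [].
  move=> j; have [->//|ji] := eqVneq j i0.
  have := inda c'0 _ j; rewrite /c' (negPf ji); apply; exists x; rewrite -cx.
  rewrite (bigD1 i0) //= [RHS](bigD1 i0) //= /b subrr scaler0 add0r eqxx.
  rewrite (eq_bigr (fun k => (c k)%:~R *: b k + (c k)%:~R *: a i0)); last first.
    by move=> k /negPf ki; rewrite ki -scalerDr subrK.
  rewrite big_split /= -scaler_suml addrCA rmorphN /= scaleNr.
  by rewrite raddf_sum /= addNr addr0.
have C0 : 0 <= C ^+ l * 2 by rewrite mulr_ge0 // exprn_ge0 //; lra.
have [N0 [e' [e'0 wP]]] := weyl_orbit m0 ib sb ind e0 C0.
exists N0`!, (e' ^+ 2); split; [exact: fact_gt0|by rewrite exprn_gt0|] => m F bF tF eF.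
have [j ji|K [pK K0 dK]] := @joint_dominated R S m0 l i0 C F C1 bF.
  apply: tF; apply: contra ji => /(fintype.subsetP sA); by rewrite inE.
have iW (w v : 'rV[int]_l) : w \in [:: delta_mx 0 i0] -> joint i0 F (v + w) = joint i0 F v.
  rewrite inE => /eqP ->; congr phi; apply: eq_bigr => j _; rewrite !mxE eqxx /=.
  by case: (j == i0); rewrite ?addr0.
have eJ : e <= `|m (fun n => joint i0 F (orbit b n))|.
  rewrite (_ : m _ = correlation m F) //; apply: eq_mean => n.
  rewrite -[RHS](state_act (- pval (a i0) n)) act_prod; congr phi.
  apply: eq_bigr => j _; rewrite -actD addrC -pvalB // mxE /b.
  by have [->|//] := eqVneq j i0; rewrite subrr /pval horner0 floor0.
have [N [v [N1 N2 h]]] := wP K (joint i0 F) m pK K0 dK iW eJ.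
rewrite /axes joint_iterated_mean ?enum_uniq // in h.
have dN : (N %| N0`!)%N by apply: dvdn_fact; rewrite N1.
apply: le_trans _ (proj_sq_mono m0 dN (bF i)).
set G := (fun j : 'I_l => _) in h.
have bG j : ball (G j) by rewrite /G; case: ifP => // _; exact: proj_ball.
have h2 : e' ^+ 2 <= joint i0 G v ^+ 2.
  by apply: sqr_le_norm; [exact: ltW|].
apply: le_trans h2 _; rewrite (jointE i0 G v i); set B := \prod_(k | k != i) _.
have bB : ball B by apply: (big_ind (@ball R S)) => [|x y|j _]; ball.
have [ii|ii] := eqVneq i i0.
  rewrite act0 /G ii eqxx andbF mulrC; apply: invariant_cauchy => //.
  rewrite /B; apply: (big_ind (@invariant R S N)) => [|x y|j ji].
  - exact: invariant1.
  - exact: invariantM.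
  - apply: invariant_act; rewrite /G mem_enum ii in ji *; rewrite ji.
    exact: proj_invariant.
rewrite mulrC; apply: le_trans (ball_cauchy _ bB) _.
by rewrite expr2 -actM state_act /G mem_enum ii /= -expr2.
Qed.

End Correlations.

(** * Degree lowering *)

(** The terms below [e / 2] contribute at most half of the average, and no term
    exceeds 1, so the terms above [e / 2] have density at least [e / 2]. *)
Lemma avg_popular_in {R : realType} (I : eqType) (s : seq I) (x y : I -> R) e c :
  0 <= c -> (0 < size s)%N -> {in s, forall i, x i <= 1} -> {in s, forall i, 0 <= y i} ->
  {in s, forall i, e / 2 <= x i -> c <= y i} -> 0 <= e -> e <= avg s x -> c * (e / 2) <= avg s y.
Proof.
move=> c0 s0 x1 y0 xy e0 ex.
apply: le_trans (_ : avg s (fun i => c * x i + - (c * (e / 2))) <= _).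
  by rewrite avgD avgZ avg_cst //; nra.
apply: avg_le_in => i si; have [h|h] := lerP (e / 2) (x i).
  by have := xy i si h; have := x1 i si; nra.
by have := y0 i si; nra.
Qed.

Section DegreeLowering.
Context {R : realType} {S : msys R} (m0 : mean R) {l : nat} (a : 'I_l -> {poly R}).
Implicit Types (f g w : obs S) (F : 'I_l -> obs S) (A : {set 'I_l}) (j : 'I_l).
Local Notation phi := (@state R S).
Local Notation T := (@act R S).
Local Notation proj := (proj m0).
Local Notation tame := (tame m0).
Local Notation gow := (gow m0).
Local Notation correlation := (correlation a).
Local Notation periodic_part_large := (@periodic_part_large R S m0 l a).

Lemma wcube_tame (W : seq int -> obs S) hs hs' : (forall h, ball (W h)) -> (forall h, tame 1 (W h)) ->
  tame 1 (wcube W hs hs').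
Proof.
elim: hs hs' W => [|h hs IH] [|h' hs'] W bW tW //=; apply: IH => k; first by ball.
by rewrite -[1]mulr1; apply: tameM.
Qed.

Definition update F j g : 'I_l -> obs S := fun i => if i == j then g else F i.

Definition others F j (n : int) : obs S :=
  \prod_(i | i != j) T (pval (a i) n - pval (a j) n) (F i).

(** Pairing with this function replaces [F j] in the correlation. *)
Definition dual_function (m : mean R) F j := wlim m (others F j).

Lemma dual_function_ball m F j : ball (dual_function m F j).
Proof. exact: wlim_ball. Qed.
#[local] Hint Resolve dual_function_ball : ball.

Lemma others_ball F j n : (forall i, ball (F i)) -> ball (others F j n).
Proof. by move=> bF; apply: (big_ind (@ball R S)) => [|x y|i _]; ball. Qed.

Lemma correlation_update m F j g :
  correlation m (update F j g) = m (fun n => phi (others F j n * g)).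
Proof.
apply: eq_mean => n; rewrite (bigD1 j) //= /update eqxx.
rewrite -[LHS](state_act (- pval (a j) n)) actM -actD addNr act0 mulrC.
rewrite (big_morph _ (@actM R S _) (@act1 R S _)).
by congr phi; congr (_ * _); apply: eq_bigr => i /negPf ->; rewrite -actD addrC.
Qed.

Lemma dual_functionE m F j g : (forall i, ball (F i)) ->
  phi (dual_function m F j * g) = correlation m (update F j g).
Proof. by move=> bF; rewrite correlation_update wlimE // => n; exact: others_ball. Qed.

Lemma update_same F j : update F j (F j) = F.
Proof. by apply/funext => i; rewrite /update; case: eqP => // ->. Qed.

Lemma update_ball F j g : (forall i, ball (F i)) -> ball g -> forall i, ball (update F j g i).
Proof. by move=> bF bg i; rewrite /update; case: ifP. Qed.

Lemma correlation_bound m F : (forall i, ball (F i)) -> `|correlation m F| <= 1.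
Proof. by move=> bF; apply: mean_bound => n; apply: ball_norm; apply: ball_prod => i; ball. Qed.

Lemma others_cube F j n hs hs' :
  others (fun i => cube (F i) hs hs') j n = cube (others F j n) hs hs'.
Proof.
rewrite /others (big_morph (fun f => cube f hs hs') (fun f g => cubeM f g hs hs') (cube1 hs hs')).
by apply: eq_bigr => i _; rewrite cube_act.
Qed.

(** Write [f] for the dual function.  The last two of the averages that define the
    seminorm form a second order seminorm of a cube of [f], which is the pairing of
    this cube with its own dual function [D].  So [f] is correlated with functions
    [D hs] up to factors that ignore a variable.  Unfolding [f] into the other
    slots and applying the Gowers-Cauchy-Schwarz inequality removes these factors,
    and leaves correlations in which slot [j] holds cubes of the functions [D hs].
    Those are tame, so by hypothesis their projections to the functions invariant
    under the [r]-th power are large on average.  Now unfold one [D hs] into its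
    definition: a translate of [f], times factors that ignore a variable, is
    correlated with an invariant function, so its own projection is large.  A
    second use of the Gowers-Cauchy-Schwarz inequality removes the factors and
    leaves the seminorm of [f], of one order less, with step [r]. *)
Lemma lowering_step A j t (c C : R) : periodic_part_large A j -> 0 < c -> 1 <= C ->
  exists (r : nat) (c' : R), [/\ (0 < r)%N, 0 < c' & forall (m : mean R) F,
    (forall i, ball (F i)) -> (forall i, i != j -> i \notin A -> tame C (F i)) ->
    c <= gow t.+1 1 (dual_function m F j) -> c' <= gow t r (dual_function m F j)].
Proof.
move=> hA c0 C1; pose e := c ^+ (2 ^ t); have e0 : 0 < e by rewrite exprn_gt0.
have e2 : 0 < e / 2 by lra.
have C'1 : 1 <= C ^+ (2 ^ t) by rewrite exprn_ege1.
have [r [d [r0 d0 hd]]] := hA _ _ e2 C'1.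
pose c1 := d * (e / 2); have c1_0 : 0 < c1 by rewrite mulr_gt0.
exists r, (((c1 / 2) ^+ 2) ^+ (2 ^ t)); split=> // [|m F bF tF].
  by rewrite !exprn_gt0 // divr_gt0.
set f := dual_function m F j => cf; have bf : ball f by exact: dual_function_ball.
apply: cube_avg_le_gow => // b sb pb; have s0 := size_box pb.
have sz hs : hs \in box b -> size hs = t by move/size_mem_box ->.
(* one corner of the outer cube is fixed where the average is at least [c] *)
have [hs' bs' h1] : exists2 hs', hs' \in box b &
    c <= avg (box b) (fun hs => gow 1 1 (cube f hs hs')).
  apply: avg_exists_in => //; rewrite avg_exchange.
  by rewrite -addn1 -sb in cf; exact: le_trans cf (gow_le_cube_avg m0 1 1 bf pb).
pose sg (hs : seq int) : int := \sum_(h <- hs) h.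
have bcube hs k : ball (cube f hs k) by exact: cube_ball.
pose D hs := dual m0 (cube f hs hs').
have bD hs : ball (D hs) by exact: dual_ball.
(* as a function of [hs], the cube is its free vertex times factors ignoring a variable *)
have [low Llow lowE] := wcube_lower hs' (fun k => ball_act (sg k) bf).
rewrite (sz _ bs') in Llow lowE.
have cubeE hs : hs \in box b -> cube f hs hs' = T (sg hs) f * low hs.
  by move=> /sz hb; rewrite cube_wcube lowE.
have bo n : ball (others F j n) by exact: others_ball.
(* unfold the free copy of [f] into the slots other than [j] *)
have h2 : c <= m (fun n => avg (box b) (fun hs => phi (T (sg hs) (others F j n) * D hs * low hs))).
  rewrite (mean_avg m (box b) (x := fun hs n => phi (T (sg hs) (others F j n) * D hs * low hs)));
    last by move=> hs; apply: (@state_bounded _ _ (fun n => T (sg hs) (others F j n) * D hs)) => n; ball.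
  apply: le_trans h1 _; apply: le_of_eq.
  apply: eq_avg_in => hs hb; rewrite gow1_dual // -/(D hs) {1}cubeE // -mulrA state_actl.
  rewrite wlimE //; apply: eq_mean => n; rewrite -state_actl; congr phi; ring.
have bW n k : ball (T (sg k) (others F j n) * D k) by ball.
pose chi hs hs2 := wcube D hs hs2.
have bchi hs hs2 : ball (chi hs hs2) by exact: wcube_ball.
pose F' hs hs2 := update (fun i => cube (F i) hs hs2) j (chi hs hs2).
have bF' hs hs2 i : ball (F' hs hs2 i) by apply: update_ball => // k; exact: cube_ball.
(* after Gowers-Cauchy-Schwarz for each [n], every slot holds a cube *)
have h3 : e <= avg (box b) (fun hs => avg (box b) (fun hs2 => correlation m (F' hs hs2))).
  pose z n hs hs2 := phi (wcube (fun k => T (sg k) (others F j n) * D k) hs hs2).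
  have bz hs hs2 : bounded (fun n => z n hs hs2).
    by apply: ball_bounded => n; exact: wcube_ball.
  have -> : avg (box b) (fun hs => avg (box b) (fun hs2 => correlation m (F' hs hs2))) =
      m (fun n => avg (box b) (fun hs => avg (box b) (z n hs))).
    rewrite (mean_avg2 m (box b) (y := fun hs hs2 n => z n hs hs2)) //.
    apply: eq_avg => hs; apply: eq_avg => hs2; rewrite correlation_update; apply: eq_mean => n.
    by rewrite /z wcubeM -cube_wcube others_cube.
  have bav : bounded (fun n => avg (box b) (fun hs =>
      phi (T (sg hs) (others F j n) * D hs * low hs))).
    apply: (@bounded_avg _ _ (box b) (fun hs n => phi (T (sg hs) (others F j n) * D hs * low hs))).
    by move=> hs; apply: (@state_bounded _ _ (fun n => T (sg hs) (others F j n) * D hs)) => n; ball.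
  apply: le_trans (_ : m (fun n => avg (box b) (fun hs =>
      phi (T (sg hs) (others F j n) * D hs * low hs))) ^+ (2 ^ t) <= _).
    by rewrite /e lerXn2r ?nnegrE ?(ltW c0) // (le_trans (ltW c0)).
  apply: le_trans (mean_pow2 _ _ bav) _; apply: mean_mono => [||n]; first exact: boundedX.
    exact: (@bounded_avg2 _ _ (box b) (fun hs hs2 n => z n hs hs2)).
  by rewrite -sb; apply: gowers_cauchy_schwarz => //; rewrite sb.
(* fix the second corner, and apply the hypothesis to the popular first corners *)
rewrite avg_exchange in h3; have [hs2 bs2 {}h3] := avg_exists_in s0 h3.
have h4 : c1 <= avg (box b) (fun hs => phi (proj r (chi hs hs2) ^+ 2)).
  apply: (@avg_popular_in _ _ _ (fun hs => correlation m (F' hs hs2))) => //; try exact: ltW.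
  - by move=> hs _; apply: le_trans (ler_norm _) _; exact: correlation_bound.
  - by move=> hs _; exact: state_sq_ge0.
  - move=> hs hb ge; have := hd m (F' hs hs2) (bF' hs hs2) _ (le_trans ge (ler_norm _)).
    rewrite {2}/F' /update eqxx; apply=> i iA; rewrite /F' /update; case: (eqVneq i j) => ij.
      by apply: tame_mono C'1 _; apply: wcube_tame => // k; apply: dual_tame.
    by apply: tame_cube => //; [exact: sz|exact: tF].
(* unfold the free vertex of the cube of dual functions, at a single shift [k] *)
have [low2 Llow2 low2E] := wcube_lower hs2 bD.
rewrite (sz _ bs2) in Llow2 low2E.
pose X hs := cube f hs hs'.
pose y hs k := phi (proj 1 (X hs * T k (X hs)) * T k (X hs) * (proj r (chi hs hs2) * low2 hs)).
have b_y hs : bounded (y hs).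
  apply: (@state_bounded _ _ (fun k => proj 1 (X hs * T k (X hs)) * T k (X hs))) => k.
  by apply: ballM; [exact: proj_ball|ball].
have [k hk] : exists k, c1 / 2 <= avg (box b) (fun hs => y hs k).
  apply: (@mean_exists _ m0 c1 (fun k => avg (box b) (fun hs => y hs k))) => //.
    exact: (@bounded_avg _ _ (box b) y).
  rewrite (mean_avg m0 (box b) (x := y)) //; apply: le_trans h4 _.
  apply: le_of_eq; apply: eq_avg_in => hs hb.
  rewrite proj_sq // {2}/chi low2E ?sz // mulrCA dualE //; exact: bcube.
pose B hs := T k (low hs) * low2 hs.
have LB : lower t B by apply: lowerM => //; exact: lower_act.
pose G hs := T (k + sg hs) f * B hs.
have bG hs : hs \in box b -> ball (G hs).
  by move=> hb; apply: ballM; [ball|apply: lower_ball LB _; exact: sz].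
(* all the rest is invariant under the [r]-th power, and only sees a projection *)
have h5 : (c1 / 2) ^+ 2 <= avg (box b) (fun hs => phi (proj r (G hs) ^+ 2)).
  apply: le_trans (_ : avg (box b) (fun hs => y hs k) ^+ 2 <= _).
    by rewrite lerXn2r ?nnegrE //; lra.
  apply: le_trans (avg_sq _ _) _; apply: avg_le_in => hs hb.
  have -> : y hs k = phi ((proj 1 (X hs * T k (X hs)) * proj r (chi hs hs2)) * G hs).
    have XE : T k (X hs) = T (k + sg hs) f * T k (low hs) by rewrite /X cubeE // actM -actD.
    by rewrite /y; set p := proj 1 _; rewrite XE /G /B; congr phi; ring.
  apply: invariant_cauchy; last exact: bG.
    apply: invariantM; last exact: proj_invariant.
    apply: (invariant_dvd (dvd1n r)); apply: proj_invariant.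
    by apply: ballM; [|apply: ball_act]; exact: bcube.
  by apply: ballM; exact: proj_ball.
pose W n hs := T k (T (sg hs) (f * T (r%:Z * n) f)).
have bW' n hs : ball (W n hs) by rewrite /W; ball.
(* expand the projection as a mean over the multiples of [r] *)
have h6 : (c1 / 2) ^+ 2 <= m0 (fun n => avg (box b) (fun hs =>
    phi (W n hs * (T (r%:Z * n) (B hs) * B hs)))).
  pose x hs n := if hs \in box b then phi (W n hs * (T (r%:Z * n) (B hs) * B hs)) else 0.
  have bx hs : bounded (x hs).
    rewrite /x; have [hb|_] := boolP (hs \in box b); last by bdd.
    apply: ball_bounded => n; have := lower_ball LB (sz _ hb) => bB; ball.
  rewrite (_ : (fun n => _) = (fun n => avg (box b) (x^~ n))); last first.
    by apply/funext => n; apply: eq_avg_in => hs hb; rewrite /x hb.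
  rewrite mean_avg //; apply: le_trans h5 _; apply: le_of_eq.
  apply: eq_avg_in => hs hb; have bh := bG _ hb; rewrite proj_sq // projE //; apply: eq_mean => n.
  rewrite /x hb /G /W !actM -!actD [r%:Z * n + _]addrC; congr phi.
  by ring.
(* Gowers-Cauchy-Schwarz for each shift removes the factors [B] *)
have bz hs hs3 : bounded (fun n => phi (wcube (W n) hs hs3)).
  by apply: ball_bounded => n; exact: wcube_ball.
apply: le_trans (_ : m0 (fun n => avg (box b) (fun hs => avg (box b) (fun hs2 =>
    phi (wcube (W n) hs hs2)))) <= _).
  have bav : bounded (fun n => avg (box b) (fun hs =>
      phi (W n hs * (T (r%:Z * n) (B hs) * B hs)))).
    exists 1 => n; apply: le_trans (avg_norm _ _) _; rewrite -[leRHS](avg_cst 1 s0).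
    apply: avg_le_in => hs hb; apply: ball_norm.
    by have := lower_ball LB (sz _ hb) => bB; ball.
  apply: le_trans (_ : m0 (fun n => avg (box b) (fun hs =>
      phi (W n hs * (T (r%:Z * n) (B hs) * B hs)))) ^+ (2 ^ t) <= _).
    by rewrite lerXn2r ?nnegrE ?sqr_ge0 // (le_trans _ h6) ?sqr_ge0.
  apply: le_trans (mean_pow2 _ _ bav) _; apply: mean_mono => [||n]; first exact: boundedX.
    exact: (@bounded_avg2 _ _ (box b) (fun hs hs2 n => phi (wcube (W n) hs hs2))).
  rewrite -sb; apply: gowers_cauchy_schwarz => //; rewrite sb.
  by apply: lowerM => //; exact: lower_act.
rewrite (mean_avg2 m0 (box b) (y := fun hs hs2 n => phi (wcube (W n) hs hs2))) //.
apply: avg_le => hs; apply: avg_le => hs3; rewrite /=; apply: le_of_eq.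
apply: eq_mean => n; rewrite /W (wcube_act k (fun hs => T (sg hs) (f * T (r%:Z * n) f))).
by rewrite state_act -cube_wcube cubeM cube_act.
Qed.

(** Each reduction of the order introduces a step [r] for the innermost average,
    which [gow_dilate] removes before the next one.  The last [r] remains. *)
Lemma lowering A j t (c C : R) : periodic_part_large A j -> 0 < c -> 1 <= C ->
  exists (r : nat) (c' : R), [/\ (0 < r)%N, 0 < c' & forall (m : mean R) F,
    (forall i, ball (F i)) -> (forall i, i != j -> i \notin A -> tame C (F i)) ->
    c <= gow t 1 (dual_function m F j) -> c' <= gow 0 r (dual_function m F j)].
Proof.
move=> hA + C1; elim: t c => [|t IH] c c0; first by exists 1%N, c.
have [r [c' [r0 c'0 h]]] := lowering_step t hA c0 C1.
case: t IH h => [|t] IH h; first by exists r, c'.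
have rR : 0 < r%:R :> R by rewrite ltr0n.
have [r' [c2 [r'0 c20 h2]]] := IH (c' / r%:R) (divr_gt0 c'0 rR).
exists r', c2; split=> // m F bF tF cg; apply: h2 => //.
rewrite ler_pdivrMr // mulrC; apply: le_trans (h m F bF tF cg) _.
by apply: gow_dilate => //; ball.
Qed.

Hypothesis ia : forall j, integer_poly (a j).
Hypothesis inda : affinely_independent a.

Lemma affinely_independent_far i j : i != j -> (1 < size (a i - a j)%R)%N.
Proof.
move=> ij; rewrite ltnNge; apply/negP => /size1_polyC E.
pose c k : int := (k == i)%:R - (k == j)%:R.
have ci : c i = 0.
  apply: inda; last exists (a i - a j)`_0.
    rewrite big_split sumrN /= (bigD1 i) //= eqxx big1 => [|k /negPf -> //].
    by rewrite (bigD1 j) //= eqxx big1 => [|k /negPf -> //]; rewrite !addr0 subrr.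
  rewrite -E (bigD1 i) //= (bigD1 j) //=; last by rewrite eq_sym.
  rewrite big1 ?addr0 => [|k /andP[/negPf ki /negPf kj]]; last by rewrite /c ki kj subrr scale0r.
  by rewrite /c !eqxx [j == i]eq_sym (negPf ij) subr0 sub0r mulr1z scale1r rmorphN /= mulr1z scaleN1r.
by move: ci; rewrite /c eqxx (negPf ij).
Qed.

(** Removing a slot [j]: the dual function has a large uniformity seminorm, hence
    a large projection, and this projection can take the place of [F j]. *)
Lemma periodic_part_large_step A i j : j != i -> periodic_part_large (A :\ j) j ->
  periodic_part_large (A :\ j) i -> periodic_part_large A i.
Proof.
move=> ji hj hi e C e0 C1.
have iaj p : p \in [seq a k | k <- enum 'I_l & k != j] -> integer_poly p.
  by move=> /mapP[k _ ->].
have far p : p \in [seq a k | k <- enum 'I_l & k != j] -> (1 < size (p - a j)%R)%N.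
  by move=> /mapP[k]; rewrite mem_filter => /andP[kj _] ->; exact: affinely_independent_far.
have ee : 0 < e ^+ 2 by rewrite exprn_gt0.
have [t [c [c0 hc]]] := @polynomials_controlled R S m0 _ _ (ia j) iaj far _ ee.
have ct : 0 < c ^+ (2 ^ t) by rewrite exprn_gt0.
have [r [c' [r0 c'0 hl]]] := lowering t hj ct C1.
have C'1 : 1 <= Num.max C r%:R by rewrite le_max C1.
have [r' [d [r'0 d0 hd]]] := hi c' (Num.max C r%:R) c'0 C'1.
exists r', d; split=> // m F bF tF eF.
set f := dual_function m F j; have bf : ball f by exact: dual_function_ball.
have tF' k : k != j -> k \notin A :\ j -> tame C (F k).
  by move=> kj; rewrite in_setD1 kj => kA; exact: tF.
have h1 : e ^+ 2 <= phi (f ^+ 2).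
  apply: le_trans (_ : phi (F j * f) ^+ 2 <= _); last exact: ball_cauchy.
  rewrite mulrC dual_functionE // update_same.
  by apply: sqr_le_norm; [exact: ltW|].
pose L := [seq (a k, F k) | k <- enum 'I_l & k != j].
have bL : pair_balls L.
  have gen (s : seq 'I_l) : pair_balls [seq (a k, F k) | k <- s].
    by elim: s => // k s IH; split=> //; exact: bF.
  exact: gen.
have h2 : c ^+ (2 ^ t) <= gow t 1 f.
  apply: (hc m f L) => //; first by rewrite /L -map_comp.
  apply: le_trans h1 _; rewrite expr2 dual_functionE //; apply: le_trans (ler_norm _) _.
  apply: le_of_eq; congr `|_|.
  apply: eq_mean => n; rewrite term_cons /= (bigD1 j) //= /update eqxx; congr phi; congr (_ * _).
  by rewrite /term big_map big_filter big_enum_cond /=; apply: eq_bigr => k /negPf ->.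
have := hl m F bF tF' h2; rewrite gow0E // proj_sq // -/f mulrC dual_functionE // => h3.
have := hd m (update F j (proj r f)).
have -> : update F j (proj r f) i = F i by rewrite /update eq_sym (negPf ji).
apply.
- by apply: update_ball => //; exact: proj_ball.
- move=> k kA; rewrite /update; case: (eqVneq k j) => kj.
    apply: (@tame_mono _ _ m0 r%:R); first by rewrite le_max lexx orbT.
    by apply: invariant_tame => //; [exact: proj_ball|exact: proj_invariant].
  by apply: tame_mono (tF' k kj kA); rewrite le_max lexx.
- exact: le_trans h3 (ler_norm _).
Qed.

Lemma periodic_part_large_all A i : periodic_part_large A i.
Proof.
have [n] := ubnP #|A|; elim: n A i => // n IH A i; rewrite ltnS => An.
have [sA|/subsetPn[j jA]] := boolP (A \subset [set i]).
  exact: periodic_part_large_base sA.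
rewrite inE => ji; have small : (#|A :\ j| < n)%N by rewrite (cardsD1 j A) jA in An.
by apply: (periodic_part_large_step ji); exact: IH.
Qed.

End DegreeLowering.

(** With all slots in [A], the claim of the induction is about arbitrary functions
    of the unit ball. *)
Theorem correlation_periodic {R : realType} {S : msys R} (m0 : mean R) l
    (a : 'I_l -> {poly R}) (i : 'I_l) (e : R) :
  (forall j, integer_poly (a j)) -> affinely_independent a -> 0 < e ->
  exists (r : nat) (c : R), [/\ (0 < r)%N, 0 < c & forall (m : mean R) (F : 'I_l -> obs S),
    (forall j, ball (F j)) -> e <= `|correlation a m F| -> c <= state (proj m0 r (F i) ^+ 2)].
Proof.
move=> ia inda e0.
have [r [c [r0 c0 h]]] := @periodic_part_large_all R S m0 l a ia inda [set: 'I_l]%SET i e 1 e0 (lexx 1).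
by exists r, c; split=> // m F bF; apply: h => // j; rewrite inE.
Qed.

(** * Recurrence along a suitable progression *)

Section Periods.
Context {R : realType}.
Implicit Types p : {poly R}.

(** Integer polynomials are periodic modulo any integer: by induction on the
    degree their differences are, and then so is the polynomial itself up to a
    constant per period, which [r] periods kill. *)
Lemma pval_periodic d p (r : nat) : (size p <= d)%N -> integer_poly p -> (0 < r)%N ->
  exists2 q : nat, (0 < q)%N & forall n h : int, (r%:Z %| pval p (n + q%:Z * h) - pval p n)%Z.
Proof.
elim: d p r => [|d IH] p r sp ip r0.
  exists 1%N => // n h; move: sp; rewrite leqn0 size_poly_eq0 => /eqP ->.
  by rewrite /pval !horner0 subrr dvdz0.
pose dp := affine p 1 1 - affine p 1 0.
have idp : integer_poly dp by apply: integer_polyB; exact: integer_affine.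
have sdp : (size dp <= d)%N.
  exact: size_difference.
have [q q0 qP] := IH dp r sdp idp r0.
have dpE n : pval dp n = pval p (n + 1) - pval p n.
  by rewrite /dp pvalB ?pval_affine ?mul1r ?addr0 //; exact: integer_affine.
pose g n := pval p (n + q%:Z) - pval p n.
have g1 n : (r%:Z %| g (n + 1) - g n)%Z.
  have := qP n 1; rewrite !dpE mulr1 /g; congr (_ %| _)%Z.
  rewrite [n + 1 + q%:Z]addrAC; ring.
have gn n : (r%:Z %| g n - g 0)%Z.
  have up (j : nat) k : (r%:Z %| g (k + j%:Z) - g k)%Z.
    elim: j => [|j IHj]; first by rewrite addr0 subrr dvdz0.
    have -> : g (k + j.+1%:Z) - g k = (g (k + j%:Z) - g k) + (g (k + j%:Z + 1) - g (k + j%:Z)).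
      by rewrite (_ : k + j.+1%:Z = k + j%:Z + 1); [ring|lia].
    by apply: rpredD => //; exact: g1.
  have [n0|n0] := lerP 0 n; first by have := up `|n|%N 0; rewrite add0r gez0_abs.
  have := up `|n|%N n; rewrite ltz0_abs // subrr -rpredN opprB; exact.
exists (q * r)%N; first by rewrite muln_gt0 q0.
move=> n h.
have up (j : nat) k : (r%:Z %| pval p (k + q%:Z * j%:Z) - pval p k - j%:Z * g 0)%Z.
  elim: j => [|j IHj]; first by rewrite mulr0 addr0 mul0r subrr subr0 dvdz0.
  have -> : pval p (k + q%:Z * j.+1%:Z) - pval p k - j.+1%:Z * g 0 =
      (pval p (k + q%:Z * j%:Z) - pval p k - j%:Z * g 0) + (g (k + q%:Z * j%:Z) - g 0).
    have gE : g (k + q%:Z * j%:Z) = pval p (k + q%:Z * j%:Z + q%:Z) - pval p (k + q%:Z * j%:Z) by [].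
    rewrite gE (_ : k + q%:Z * j.+1%:Z = k + q%:Z * j%:Z + q%:Z); last by lia.
    by rewrite -addn1 PoszD; ring.
  by apply: rpredD => //; exact: gn.
have up' (j : nat) k : (r%:Z %| pval p (k + (q * r)%N%:Z * j%:Z) - pval p k)%Z.
  have := up (r * j)%N k; rewrite !PoszM mulrA => h'.
  rewrite -[X in (_ %| X)%Z](subrK (r%:Z * j%:Z * g 0)) rpredD //.
  by rewrite -mulrA dvdz_mulr.
have [h0|h0] := lerP 0 h; first by have := up' `|h|%N n; rewrite gez0_abs.
have := up' `|h|%N (n + (q * r)%N%:Z * h); rewrite ltz0_abs // mulrN addrK.
by rewrite -rpredN opprB.
Qed.

Lemma pval_multiples l (p : 'I_l -> {poly R}) (r : nat) :
  (forall i, integer_poly (p i)) -> (forall i, (p i).[0] = 0) -> (0 < r)%N ->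
  exists2 q : nat, (0 < q)%N & forall i (n : int), (r%:Z %| pval (p i) (q%:Z * n))%Z.
Proof.
move=> ip p0 r0.
have ex i : exists q : nat, (0 < q)%N /\ forall h : int, (r%:Z %| pval (p i) (q%:Z * h))%Z.
  have [q q0 qP] := pval_periodic (leqnn _) (ip i) r0; exists q; split=> // h.
  have := qP 0 h; rewrite add0r; have -> : pval (p i) 0 = 0 by rewrite /pval p0 floor0.
  by rewrite subr0.
have [q qP] := choice ex; exists (\prod_i q i)%N.
  by apply: prodn_gt0 => i; case: (qP i).
by move=> i n; rewrite (bigD1 i) //= PoszM -mulrA; case: (qP i).
Qed.

End Periods.

Section Recurrence.
Context {R : realType} {S : msys R} (m0 : mean R).
Implicit Types (f g u w : obs S).
Local Notation phi := (@state R S).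
Local Notation T := (@act R S).
Local Notation sc := (@scal R S).
Local Notation proj := (proj m0).

Lemma invariant_prod r u w I (s : seq I) (z : I -> int) : invariant r u ->
  phi ((\prod_(i <- s) T (r%:Z * z i) u) * w) = phi (u ^+ size s * w).
Proof.
move=> iu; elim: s w => [|i s IH] w; first by rewrite big_nil expr0.
by rewrite big_cons -mulrA iu mulrCA IH /= exprSr mulrA.
Qed.

(** The squared norms of the projections are bounded and increase with the step
    in the order of divisibility, so they are almost constant from some step on. *)
Lemma proj_stable f (e : R) : ball f -> 0 < e -> exists2 r : nat, (0 < r)%N &
  forall r' : nat, (0 < r')%N -> (r %| r')%N ->
    phi (proj r' f ^+ 2) <= phi (proj r f ^+ 2) + e.
Proof.
move=> bf e0; apply: contrapT => none.
have next r : (0 < r)%N -> exists r' : nat, (0 < r')%N /\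
    phi (proj r f ^+ 2) + e <= phi (proj r' f ^+ 2).
  move=> r0; apply: contrapT => H; apply: none; exists r => // r' r'0 _.
  rewrite leNgt; apply/negP => lt; apply: H; exists r'; split=> //; exact: ltW.
have many n : exists r : nat, (0 < r)%N /\ n%:R * e <= phi (proj r f ^+ 2).
  elim: n => [|n [r [r0 IH]]]; first by exists 1%N; rewrite mul0r state_sq_ge0.
  have [r' [r'0 h]] := next r r0; exists r'; split=> //.
  by apply: le_trans h; rewrite -addn1 natrD mulrDl mul1r lerD2r.
have [n _ hn] := natural_bound 2 e0; have [r [_ h]] := many n.
by have := ball_sq (proj_ball m0 r f); lra.
Qed.

Lemma proj_dist r r' f : (r %| r')%N -> ball f ->
  phi ((proj r' f - proj r f) ^+ 2) = phi (proj r' f ^+ 2) - phi (proj r f ^+ 2).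
Proof.
move=> rr' bf; have ir := proj_invariant m0 r bf; have ir' := invariant_dvd rr' ir.
have -> : (proj r' f - proj r f) ^+ 2 =
    proj r' f ^+ 2 - proj r f * proj r' f - proj r f * proj r' f + proj r f ^+ 2 by ring.
rewrite !(stateD, stateN) (proj_adjoint m0 ir' bf) (proj_sq m0 r bf); ring.
Qed.

(** The factor keeps the difference within the unit ball. *)
Lemma proj_complement r f : ball f ->
  phi (proj r (sc 2^-1 * (f - proj r f)) ^+ 2) = 0.
Proof.
move=> bf; have bp := proj_ball m0 r f; have bg := ball_half bf bp.
have ig := proj_invariant m0 r bg.
rewrite proj_sq // mulrCA stateZ mulrBr stateB (proj_adjoint m0 ig bf) subrr mulr0 //.
Qed.

(** Jensen's inequality for the powers of an average of nonnegative functions: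
    the moments are log-convex. *)
Lemma moment_ge u (n : nat) : (forall w, 0 <= phi (u * w ^+ 2)) ->
  phi u ^+ n <= phi (u ^+ n).
Proof.
move=> pu; pose s k := phi (u ^+ k).
have s_ge0 k : 0 <= s k.
  rewrite /s -(odd_double_half k) exprD -muln2 exprM; case: (odd k); rewrite ?expr1 ?expr0 ?mul1r.
    exact: pu.
  exact: state_sq_ge0.
have logc k : s k.+1 ^+ 2 <= s k * s k.+2.
  have gen w x y : (forall z, 0 <= phi (w * z ^+ 2)) ->
      phi (w * (x * y)) ^+ 2 <= phi (w * x ^+ 2) * phi (w * y ^+ 2).
    move=> pw; apply: discriminant_le => [|t]; first exact: pw.
    have -> : phi (w * x ^+ 2) * t ^+ 2 + 2 * phi (w * (x * y)) * t + phi (w * y ^+ 2) =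
        phi (w * (sc t * x + y) ^+ 2); last exact: pw.
    have -> : w * (sc t * x + y) ^+ 2 =
        sc t * (sc t * (w * x ^+ 2) + (w * (x * y) + w * (x * y))) + w * y ^+ 2 by ring.
    by rewrite !(stateD, stateZ); ring.
  have pw : forall z, 0 <= phi (u ^+ odd k * z ^+ 2).
    by move=> z; case: (odd k); rewrite ?expr1 ?expr0 ?mul1r // state_sq_ge0.
  have := gen _ (u ^+ k./2) (u ^+ k./2.+1) pw; rewrite -!exprM -!exprD /s.
  by have := odd_double_half k; set b := nat_of_bool _ => hk; congr (phi (u ^+ _) ^+ 2 <= phi (u ^+ _) * phi (u ^+ _)); lia.
have s0 : s 0%N = 1 by rewrite /s expr0 state1.
have s1 : s 1%N = phi u by rewrite /s expr1.
have := s_ge0 1%N; rewrite s1 le_eqVlt => /predU1P[<-|a0].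
  case: n => [|n]; first by rewrite !expr0 state1.
  by rewrite expr0n; exact: s_ge0.
have ratio k : 0 < s k /\ phi u * s k <= s k.+1.
  elim: k => [|k [sk IH]]; first by rewrite s0 s1 mulr1.
  have sk1 : 0 < s k.+1 by apply: lt_le_trans IH; exact: mulr_gt0.
  split=> //; rewrite -(ler_pM2l sk); apply: le_trans (logc k).
  by rewrite expr2 mulrCA mulrA ler_wpM2r // ltW.
elim: n => [|n IH]; first by rewrite !expr0 state1.
have [sn h] := ratio n; apply: le_trans h; rewrite exprS.
by rewrite ler_wpM2l // ltW.
Qed.

Lemma correlation_slot l (a : 'I_l -> {poly R}) (m : mean R) F i g h :
  (forall j, ball (F j)) ->
  correlation a m (update F i g) - correlation a m (update F i h) =
  phi (dual_function a m F i * (g - h)).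
Proof. by move=> bF; rewrite -!dual_functionE // mulrBr stateB. Qed.

Section Progression.
Context {k : nat} (p : 'I_k -> {poly R}) (f : obs S).
Hypothesis ip : forall i, integer_poly (p i).
Hypothesis indp : rationally_independent p.
Hypothesis p0 : forall i, (p i).[0] = 0.
Hypothesis bf : ball f.
Hypothesis ff : f * f = f.

(** The function that is not moved occupies a slot of its own, with the polynomial 0.
    Affine independence of the [a i] is then rational independence of the [p i]. *)
Let a (i : 'I_k.+1) := if unlift ord0 i is Some j then p j else 0.
Let aq (q : nat) i := affine (a i) q 0.

Let ia i : integer_poly (a i).
Proof. by rewrite /a; case: unliftP => [j _|_] // z; rewrite horner0. Qed.

Let a0 i : (a i).[0] = 0.
Proof. by rewrite /a; case: unliftP => [j _|_] //; rewrite horner0. Qed.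

Let iaq q i : integer_poly (aq q i).
Proof. exact: integer_affine. Qed.

Let aqE q i n : pval (aq q i) n = pval (a i) (q%:Z * n).
Proof. by rewrite /aq pval_affine // addr0. Qed.

Let a_independent q : (0 < q)%N -> affinely_independent (aq q).
Proof.
move=> q0 c c0 [x cx].
have sX : size ((q%:~R *: 'X + 0%:~R%:P) : {poly R}) = 2%N.
  rewrite mulr0z addr0 size_scale ?size_polyX //.
  by rewrite intr_eq0 eqz_nat -lt0n.
have cst : exists y : R, \sum_j (c j)%:~R *: a j = y%:P.
  exists (\sum_j (c j)%:~R *: a j)`_0; apply: size1_polyC.
  rewrite -(size_comp_poly2 _ sX) raddf_sum /=.
  rewrite (eq_bigr (fun j => (c j)%:~R *: aq q j)) ?cx ?size_polyC ?leq_b1 // => j _.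
  by rewrite comp_polyZ.
have cl j : c (lift ord0 j) = 0.
  apply/eqP; apply: contraT => cj; case: (@indp (fun j => c (lift ord0 j))).
    by exists j.
  case: cst => y yE; exists y; rewrite -yE big_ord_recl /a unlift_none scaler0 add0r.
  by apply: eq_bigr => i _; rewrite liftK.
move=> j; case: (unliftP ord0 j) => [i ->|->] //.
by move: c0; rewrite big_ord_recl big1 ?addr0 // => i _; exact: cl.
Qed.

(** In each slot [f = u + (f - proj r' f) + (proj r' f - u)].  The second part does
    not contribute by [correlation_periodic], and the third is small by the choice
    of [r].  When all slots hold [u], no translation along the multiples of [q]
    changes [u], and the correlation is [phi (u ^+ k.+1)]. *)
Theorem recurrence_along_progression (e : R) : 0 < e -> exists2 q : nat, (0 < q)%N &
  forall m : mean R, phi f ^+ k.+1 - e <=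
    m (fun n => phi (f * \prod_(i < k) T (pval (p i) (q%:Z * n)) f)).
Proof.
move=> e0; pose d := e / k.+1%:R; have d0 : 0 < d by rewrite divr_gt0 // ltr0n.
have d4 : 0 < d / 4 by lra.
have eta0 : 0 < (d / 2) ^+ 2 by rewrite exprn_gt0 //; lra.
have [r r0 stable] := proj_stable bf eta0; pose u := proj r f.
have bu : ball u by exact: proj_ball.
have [q q0 rq] := pval_multiples ia a0 r0.
exists q => // m.
have ex i : exists rc : nat * R, [/\ (0 < rc.1)%N, 0 < rc.2 &
    forall (m : mean R) (F : 'I_k.+1 -> obs S), (forall j, ball (F j)) ->
    d / 4 <= `|correlation (aq q) m F| -> rc.2 <= phi (proj rc.1 (F i) ^+ 2)].
  have [ri [ci [h1 h2 h3]]] := @correlation_periodic R S m0 _ _ i _ (iaq q) (a_independent q0) d4.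
  by exists (ri, ci).
have [rc rcP] := choice ex.
(* a common multiple of [r] and of the steps required by the slots *)
pose r' := (r * \prod_i (rc i).1)%N.
have r'0 : (0 < r')%N.
  by rewrite muln_gt0 r0 /=; apply: prodn_gt0 => i; case: (rcP i).
have rr' : (r %| r')%N by exact: dvdn_mulr.
have rir' i : ((rc i).1 %| r')%N by rewrite dvdn_mull // (bigD1 i) //= dvdn_mulr.
pose g := sc 2^-1 * (f - proj r' f); have bg : ball g by apply: ball_half => //; exact: proj_ball.
have slot F i : (forall j, ball (F j)) -> F i = f ->
    `|correlation (aq q) m F - correlation (aq q) m (update F i u)| <= d.
  move=> bF Fi; rewrite -{1}(update_same F i) correlation_slot // Fi.
  set D := dual_function _ _ _ _; have bD : ball D by exact: dual_function_ball.
  have h1 : `|phi (D * g)| <= d / 4.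
    rewrite leNgt; apply/negP => lt; have [_ c0 /(_ m (update F i g))] := rcP i.
    rewrite -dual_functionE // -/D => h; have := h (update_ball i bF bg) (ltW lt).
    have -> : update F i g i = g by rewrite /update eqxx.
    rewrite leNgt; apply/negP; rewrite negbK; apply: le_lt_trans c0.
    by rewrite -(proj_complement r' bf); exact: proj_sq_mono.
  have h2 : `|phi (D * (proj r' f - u))| <= d / 2.
    apply: norm_le_sqr; first by lra.
    apply: le_trans (ball_cauchy _ bD) _; rewrite proj_dist //.
    by rewrite lerBlDl; exact: stable.
  have -> : phi (D * (f - u)) = 2 * phi (D * g) + phi (D * (proj r' f - u)).
    rewrite /g [D * (sc _ * _)]mulrCA stateZ mulVKf // -stateD; congr phi; ring.
  apply: le_trans (ler_normD _ _) _; rewrite normrM ger0_norm //; lra.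
(* the slots are replaced one after the other *)
pose G (t : nat) (i : 'I_k.+1) := if (i < t)%N then u else f.
have bG t i : ball (G t i) by rewrite /G; case: ifP.
have tele t : (t <= k.+1)%N ->
    `|correlation (aq q) m (G 0%N) - correlation (aq q) m (G t)| <= t%:R * d.
  elim: t => [|t IH] tk; first by rewrite subrr normr0 mul0r.
  have GS : G t.+1 = update (G t) (Ordinal tk) u.
    apply/funext => i; rewrite /update /G ltnS leq_eqVlt.
    by rewrite -val_eqE /=; case: eqP.
  have Gt : G t (Ordinal tk) = f by rewrite /G /= ltnn.
  have := slot (G t) (Ordinal tk) (bG t) Gt; rewrite -GS => h1.
  have -> : t.+1%:R * d = t%:R * d + d by rewrite -addn1 natrD mulrDl mul1r.
  have h2 := IH (ltnW tk).
  by apply: le_trans (ler_distD (correlation (aq q) m (G t)) _ _) _; exact: lerD.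
have kd : k.+1%:R * d = e by rewrite /d mulrC divfK // pnatr_eq0.
have := tele k.+1 (leqnn _); rewrite kd.
have -> : correlation (aq q) m (G k.+1) = phi (u ^+ k.+1).
  rewrite /correlation -[RHS](mean_const m); apply: eq_mean => n.
  pose z i := (pval (a i) (q%:Z * n) %/ r%:Z)%Z.
  have := invariant_prod 1 (enum 'I_k.+1) z (proj_invariant m0 r bf).
  rewrite !mulr1 size_enum_ord => <-; congr phi; rewrite big_enum; apply: eq_bigr => i _.
  by rewrite /G ltn_ord aqE /z [r%:Z * _]mulrC divzK.
have -> : correlation (aq q) m (G 0%N) =
    m (fun n => phi (f * \prod_(i < k) T (pval (p i) (q%:Z * n)) f)).
  apply: eq_mean => n; rewrite big_ord_recl /G /= aqE /a unlift_none.
  rewrite (_ : pval 0 _ = 0); last by rewrite /pval horner0 floor0.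
  rewrite act0; congr (phi (_ * _)).
  by apply: eq_bigr => i _; rewrite aqE /a liftK.
have pu w : 0 <= phi (u * w ^+ 2).
  rewrite /u projE //; apply: mean_ge0 => [|n].
    by apply: (@state_bounded _ _ (fun k => T (r%:Z * k) f)) => n; ball.
  have -> : T (r%:Z * n) f * w ^+ 2 = (T (r%:Z * n) f * w) ^+ 2.
    by rewrite exprMn !expr2 -actM ff.
  exact: state_sq_ge0.
have := moment_ge k.+1 pu; rewrite proj_state // ler_norml => h /andP[h1 h2].
by lra.
Qed.

End Progression.

End Recurrence.

(** * Means along long intervals *)

Section IntervalMean.
Context {R : realType} (J : nat -> int).
Implicit Types x y : int -> R.
Local Open Scope classical_set_scope.

Lemma ultra_fmap (I V : Type) (f : I -> V) (U : set_system I) :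
  UltraFilter U -> UltraFilter (f @ U).
Proof.
move=> UU; split=> [|G PG sG]; first exact: fmap_proper_filter.
rewrite predeqE => A; split=> [GA|]; last exact: sG.
case: (in_ultra_setVsetC (f @^-1` A) UU) => // UC.
have GC : G (~` A) by apply: sG.
have : G set0 by rewrite -(setICr A); exact: filterI.
by move/filter_not_empty.
Qed.

(** Along an ultrafilter every bounded sequence of averages over intervals has a
    limit, and this limit is linear in the sequence.  Shifts change long averages
    by little, so the limit is invariant when it runs over longer and longer
    intervals. *)
Let U : set_system nat := projT1 (cid (ultraFilterLemma (@eventually_filter))).

#[local] Instance U_ultra : UltraFilter U.
Proof. by rewrite /U; case: cid => ? []. Qed.

Let U_eventually (A : set nat) : (\oo) A -> U A.
Proof. by rewrite /U; case: cid => /= V [_]; exact. Qed.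

Let block x (j : nat) : R := avg (iota 0 j.+1) (fun i : nat => x (J j + i%:Z)).

Let block_bound C x j : (forall n, `|x n| <= C) -> `|block x j| <= C.
Proof. by move=> xC; apply: avg_bound => //; exact: le_trans (xC 0). Qed.

Let block_cvg x : bounded x -> cvg (block x @ U).
Proof.
move=> [C xC]; have := @segment_compact R (- C) C; rewrite compact_ultra /=.
move=> /(_ (block x @ U) (ultra_fmap _ U_ultra)) [|l [_ cl]]; last by apply/cvg_ex; exists l.
apply: (@filterS _ U _ setT) => [j _|]; last exact: filterT.
by rewrite /= in_itv /= -ler_norml; exact: block_bound.
Qed.

Let along x := lim (block x @ U).

Let block_lim x l : block x @ U --> l -> along x = l.
Proof. by move=> h; apply: cvg_lim => //; exact: norm_hausdorff. Qed.

Let along_add x y : bounded x -> bounded y -> along (fun n => x n + y n) = along x + along y.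
Proof.
move=> bx b_y; apply: block_lim; rewrite (_ : block _ = block x \+ block y).
  by apply: cvgD; apply: block_cvg.
by apply/funext => j; exact: avgD.
Qed.

Let along_scale c x : bounded x -> along (fun n => c * x n) = c * along x.
Proof.
move=> bx; apply: block_lim; rewrite (_ : block _ = (fun j => c * block x j)).
  by apply: cvgM; [exact: cvg_cst|exact: block_cvg].
by apply/funext => j; exact: avgZ.
Qed.

Let along_le c x : bounded x -> (forall j (i : nat), (i <= j)%N -> x (J j + i%:Z) <= c) ->
  along x <= c.
Proof.
move=> bx h; apply: limr_le; first exact: block_cvg.
apply: nearW => j; rewrite -[leRHS](avg_cst c (s := iota 0 j.+1)) ?size_iota //.
by apply: avg_le_in => i; rewrite mem_iota add0n => /andP[_]; rewrite ltnS; exact: h.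
Qed.

Let along_mono x y : bounded x -> bounded y -> (forall n, x n <= y n) -> along x <= along y.
Proof.
move=> bx b_y h; apply: ler_lim; [exact: block_cvg..|].
by apply: nearW => j; apply: avg_le.
Qed.

Let along_const c : along (fun=> c) = c.
Proof.
apply: block_lim; rewrite (_ : block _ = (fun=> c)); first exact: cvg_cst.
by apply/funext => j; rewrite /block avg_cst ?size_iota.
Qed.

Let along_shift1 x : bounded x -> along (fun n => x (n + 1)) = along x.
Proof.
move=> bx; have [C xC] := bx; have C0 : 0 <= C by exact: le_trans (xC 0).
have bx1 : bounded (fun n => x (n + 1)) by exact: bounded_comp bx.
apply/eqP; rewrite -subr_eq0; apply/eqP.
have dE j : block (fun n => x (n + 1)) j - block x j =
    j.+1%:R^-1 * (x (J j + j.+1%:Z) - x (J j)).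
  rewrite /block /avg size_iota -mulrBr; congr (_ * _).
  exact: sum_iota_shift.
have c0 : (fun j => block (fun n => x (n + 1)) j - block x j) @ U --> (0 : R).
  apply/cvgrPdist_le => e e0.
  have : \forall j \near \oo, 2 * C / j.+1%:R <= e.
    have [n _ hn] := natural_bound (2 * C) e0; exists n => // j /= nj.
    rewrite ler_pdivrMr ?ltr0n //; apply: le_trans hn _.
    by rewrite mulrC ler_wpM2l ?(ltW e0) // ler_nat leqW.
  move=> /U_eventually; apply: (@filterS _ U) => j hj.
  rewrite sub0r normrN dE normrM ger0_norm ?invr_ge0 // mulrC.
  apply: le_trans hj; rewrite ler_wpM2r ?invr_ge0 //.
  by apply: le_trans (ler_normB _ _) _; have := xC (J j + j.+1%:Z); have := xC (J j); lra.
rewrite -(cvg_lim (@norm_hausdorff _ R) c0) /along; apply/esym/cvg_lim.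
  exact: norm_hausdorff.
by apply: cvgB; exact: block_cvg.
Qed.

Let along_shift x k : bounded x -> along (fun n => x (n + k)) = along x.
Proof. exact: shift_from_one along_shift1 x k. Qed.

Definition interval_mean : mean R :=
  Mean along_add along_scale along_mono along_const along_shift.

Lemma interval_mean_le c x : bounded x ->
  (forall j (i : nat), (i <= j)%N -> x (J j + i%:Z) <= c) -> interval_mean x <= c.
Proof. exact: along_le. Qed.

End IntervalMean.

(** * The algebra of bounded measurable functions *)

Section BoundedMeasurable.
Context {d : measure_display} (X : measurableType d) (R : realType).
Local Open Scope classical_set_scope.

Definition bounded_measurable : {pred X -> R} :=
  mem [set f : X -> R | measurable_fun setT f /\ exists C, forall x, `|f x| <= C].

Lemma bounded_measurable_subring : subring_closed bounded_measurable.
Proof.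
split=> [|f g|f g]; rewrite !inE /=.
- by split; [exact: measurable_cst|exists 1 => x; rewrite normr1].
- move=> [mf [C fC]] [mg [D gD]]; split; first exact: measurable_funB.
  by exists (C + D) => x; apply: le_trans (ler_normB _ _) _; exact: lerD.
- move=> [mf [C fC]] [mg [D gD]]; split; first exact: measurable_funM.
  by exists (C * D) => x; rewrite normrM; exact: ler_pM.
Qed.

HB.instance Definition _ := GRing.isSubringClosed.Build _
  bounded_measurable bounded_measurable_subring.

Record bfun := Bfun { bval :> X -> R ; _ : bval \in bounded_measurable }.

HB.instance Definition _ := [isSub for bval].
HB.instance Definition _ := [Choice of bfun by <:].
HB.instance Definition _ := [SubChoice_isSubComNzRing of bfun by <:].

End BoundedMeasurable.

Section BoundedFunctions.
Context {d : measure_display} {X : measurableType d} {R : realType}.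
Implicit Types f g : bfun X R.
Local Open Scope classical_set_scope.

(** The value is 0 when the function is not bounded and measurable. *)
Definition mkb (f : X -> R) : bfun X R := insubd (0 : bfun X R) f.

Lemma mkbE (f : X -> R) C : measurable_fun setT f -> (forall x, `|f x| <= C) ->
  forall x, mkb f x = f x.
Proof.
move=> mf fC x; rewrite /mkb -[LHS]/(val (insubd (0 : bfun X R) f) x) insubdK //.
by rewrite inE; split; [|exists C].
Qed.

Lemma bfun_eq f g : (forall x, f x = g x) -> f = g.
Proof. by move=> h; apply/val_inj/funext. Qed.

Lemma bfun_measurable f : measurable_fun setT f.
Proof. by case: f => f /=; rewrite inE => -[]. Qed.

Lemma bfun_bounded f : exists C, forall x, `|f x| <= C.
Proof. by case: f => f /=; rewrite inE => -[]. Qed.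

Lemma bfunD f g x : (f + g) x = f x + g x. Proof. by []. Qed.
Lemma bfunB f g x : (f - g) x = f x - g x. Proof. by []. Qed.
Lemma bfunM f g x : (f * g) x = f x * g x. Proof. by []. Qed.
Lemma bfun1 x : (1 : bfun X R) x = 1. Proof. by []. Qed.

Lemma bfunX f n x : (f ^+ n) x = f x ^+ n.
Proof. by elim: n => [|n IH]; rewrite ?expr0 // !exprS bfunM IH. Qed.

Lemma bfun_sum I (s : seq I) (F : I -> bfun X R) x :
  (\sum_(i <- s) F i) x = \sum_(i <- s) F i x.
Proof. by elim: s => [|i s IH]; rewrite ?big_nil // !big_cons bfunD IH. Qed.

Lemma bfun_prod I (s : seq I) (F : I -> bfun X R) x :
  (\prod_(i <- s) F i) x = \prod_(i <- s) F i x.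
Proof. by elim: s => [|i s IH]; rewrite ?big_nil // !big_cons bfunM IH. Qed.

Definition bcst (c : R) : bfun X R := mkb (cst c).

Lemma bcstE c x : bcst c x = c.
Proof. by rewrite /bcst (@mkbE _ `|c|). Qed.

Definition bind (B : set X) : bfun X R := mkb \1_B.

Lemma bindE B x : measurable B -> bind B x = \1_B x.
Proof.
move=> mB; apply: (@mkbE _ 1); first exact: measurable_indic.
by move=> y; rewrite indicE; case: (_ \in _); rewrite ?normr1 ?normr0.
Qed.

Definition unit_ball f := forall x, `|f x| <= 1.

Lemma unit_bind B : measurable B -> unit_ball (bind B).
Proof. by move=> mB x; rewrite bindE // indicE; case: (_ \in _); rewrite ?normr1 ?normr0. Qed.

(** A bounded linear functional is determined by its values at indicators: if
    [f] is bounded by [c], subtracting [c / 2] times the sign of [f] leaves a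
    function bounded by [c / 2]. *)
Lemma functional_eq0 (L : bfun X R -> R) K :
  (forall f g, L (f - g) = L f - L g) -> (forall c f, L (bcst c * f) = c * L f) ->
  (forall f c, (forall x, `|f x| <= c) -> `|L f| <= K * c) ->
  (forall B, measurable B -> L (bind B) = 0) -> forall f, L f = 0.
Proof.
move=> LB LZ Lb Li f; have [C fC] := bfun_bounded f.
have small n : forall c g, (forall x, `|g x| <= c) -> `|L g| <= K * (c / 2 ^+ n).
  elim: n => [|n IH] c g gc; first by rewrite expr0 divr1; exact: Lb.
  pose B := [set x | 0 <= g x].
  have mB : measurable B.
    rewrite (_ : B = setT `&` g @^-1` `[0, +oo[%classic).
      exact: bfun_measurable.
    by rewrite setTI; apply/seteqP; split=> x /=; rewrite in_itv /= andbT.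
  pose g' := g - (bcst c * bind B - bcst (c / 2) * bind setT).
  have <- : L g' = L g by rewrite /g' !LB !LZ !Li // !mulr0 !subr0.
  have -> : c / 2 ^+ n.+1 = c / 2 / 2 ^+ n by rewrite exprS invfM mulrA.
  apply: IH => x.
  rewrite /g' !bfunB !bfunM !bcstE !bindE // !indicE in_setT mulr1.
  have := gc x; rewrite !ler_norml => /andP[g1 g2].
  have [xB|xB] := boolP (x \in B).
    by move: xB; rewrite inE /B /= mulr1 => g0; apply/andP; split; lra.
  by move: xB; rewrite notin_setE /B /= mulr0 => /negP; rewrite -ltNge => g0; apply/andP; split; lra.
apply/eqP; rewrite -normr_le0; apply/ler_addgt0Pr => e e0; rewrite add0r.
have [n _ hn] := natural_bound (K * C) e0.
have := small n C f fC; move=> h; apply: le_trans h _.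
rewrite mulrA ler_pdivrMr ?exprn_gt0 //; apply: le_trans hn _.
by rewrite mulrC ler_wpM2l ?(ltW e0) // -natrX ler_nat ltnW // ltn_expl.
Qed.

End BoundedFunctions.

Section Expectation.
Context {d : measure_display} {X : measurableType d} {R : realType} (mu : probability X R).
Implicit Types f g : bfun X R.
Local Open Scope classical_set_scope.

Local Notation integ f := (mu.-integrable setT (EFin \o f)).

Lemma bounded_integrable (f : X -> R) C : measurable_fun setT f ->
  (forall x, `|f x| <= C) -> integ f.
Proof.
move=> mf fC; apply: measurable_bounded_integrable => //.
  by apply: (le_lt_trans (probability_le1 mu measurableT)); rewrite ltry.
exists C; split; first exact: num_real.
by move=> M CM x _; apply: le_trans (fC x) (ltW CM).
Qed.

Lemma bfun_integrable f : integ f.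
Proof.
have [C fC] := bfun_bounded f; exact: (bounded_integrable (bfun_measurable f) fC).
Qed.

Lemma integD (f g : X -> R) : integ f -> integ g -> integ (fun x => f x + g x).
Proof.
move=> fi gi; rewrite (_ : EFin \o _ = (EFin \o f) \+ (EFin \o g))%E //; exact: integrableD.
Qed.

Lemma integB (f g : X -> R) : integ f -> integ g -> integ (fun x => f x - g x).
Proof.
move=> fi gi; rewrite (_ : EFin \o _ = (EFin \o f) \- (EFin \o g))%E //; exact: integrableB.
Qed.

Definition ex f : R := \int[mu]_x f x.

Lemma exD f g : ex (f + g) = ex f + ex g.
Proof. by rewrite /ex -RintegralD //; exact: bfun_integrable. Qed.

Lemma exB f g : ex (f - g) = ex f - ex g.
Proof. by rewrite /ex -RintegralB //; exact: bfun_integrable. Qed.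

Lemma exZ c f : ex (bcst c * f) = c * ex f.
Proof.
rewrite /ex -RintegralZl //; last exact: bfun_integrable.
by apply: eq_Rintegral => x _; rewrite bfunM bcstE.
Qed.

Lemma ex_le f g : (forall x, f x <= g x) -> ex f <= ex g.
Proof. by move=> h; apply: le_Rintegral => //; exact: bfun_integrable. Qed.

Lemma ex_cst c : ex (bcst c) = c.
Proof.
rewrite /ex (@eq_Rintegral _ _ _ _ _ (fun=> c)) => [|x _]; last exact: bcstE.
rewrite Rintegral_cst // -[RHS]mulr1; congr (_ * _).
exact: (congr1 fine (@probability_setT _ _ _ mu)).
Qed.

Lemma ex_bound f c : (forall x, `|f x| <= c) -> `|ex f| <= c.
Proof.
move=> fc; rewrite ler_norml -{1}(ex_cst (- c)) -{2}(ex_cst c).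
by apply/andP; split; apply: ex_le => x; rewrite bcstE; have := fc x; rewrite ler_norml => /andP[].
Qed.

Lemma ex_bind B : measurable B -> ex (bind B) = fine (mu B).
Proof.
move=> mB; rewrite /ex (@eq_Rintegral _ _ _ _ _ \1_B) => [|x _]; last exact: bindE.
by rewrite /Rintegral integral_indic // setIT.
Qed.

Lemma bind_bigcup_ge (B : nat -> set X) n x : (forall i, measurable (B i)) ->
  trivIset setT B -> \sum_(0 <= i < n) \1_(B i) x <= \1_(\bigcup_i B i) x :> R.
Proof.
move=> mB tB; have [[k _ kx]|nx] := pselect ((\bigcup_i B i) x); last first.
  rewrite big1 ?indicE ?ler0n // => i _; rewrite indicE memNset // => ix.
  by apply: nx; exists i.
rewrite [leRHS]indicE mem_set; last by exists k.
have le1 m : \sum_(0 <= i < m) (i == k)%:R = (k < m)%:R :> R.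
  elim: m => [|m IH]; first by rewrite big_geq.
  rewrite big_nat_recr //= IH ltnS; case: (ltngtP m k) => h; rewrite ?addr0 ?add0r //.
apply: (@le_trans _ _ (\sum_(0 <= i < n) (i == k)%:R)); last by rewrite le1; case: (_ < _)%N.
apply: ler_sum => i _; rewrite indicE; have [->|ik] := eqVneq i k; first by case: (_ \in _).
rewrite memNset // => ix; move/trivIsetP: tB => /(_ i k I I ik) /seteqP[+ _].
by move=> /(_ x); apply.
Qed.

(** ** Weak limits *)

Section WeakLimit.
Context (m : mean R) (F : int -> bfun X R).
Hypothesis bF : forall n, unit_ball (F n).

Let rho (g : bfun X R) : R := m (fun n => ex (F n * g)).

Let bd g : bounded (fun n => ex (F n * g)).
Proof.
have [C gC] := bfun_bounded g; exists C => n; apply: ex_bound => x.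
rewrite bfunM normrM; apply: le_trans (gC x).
by rewrite -[leRHS]mul1r ler_wpM2r //; exact: bF.
Qed.

Let rhoB f g : rho (f - g) = rho f - rho g.
Proof. by rewrite /rho -(meanB m (bd f) (bd g)); apply: eq_mean => n; rewrite mulrBr exB. Qed.

Let rhoZ c f : rho (bcst c * f) = c * rho f.
Proof. by rewrite /rho -(mean_scale m c (bd f)); apply: eq_mean => n; rewrite mulrCA exZ. Qed.

Let rho_bound (g w : bfun X R) : (forall x, `|g x| <= w x) -> `|rho g| <= ex w.
Proof.
move=> gw; apply: mean_bound => n; rewrite ler_norml.
have e0 : ex (bcst (-1) * w) = - ex w by rewrite exZ mulN1r.
rewrite -e0; apply/andP; split; apply: ex_le => x; rewrite !bfunM ?bcstE ?mulN1r;
  have : `|F n x * g x| <= w x by rewrite normrM (le_trans _ (gw x)) // -[leRHS]mul1r ler_wpM2r //; exact: bF.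
all: by rewrite ler_norml => /andP[].
Qed.

Let rho_sum I (s : seq I) (G : I -> bfun X R) : rho (\sum_(i <- s) G i) = \sum_(i <- s) rho (G i).
Proof.
have rho0 : rho 0 = 0 by rewrite -(subrr 0) rhoB subrr.
have rhoN g : rho (- g) = - rho g by rewrite -sub0r rhoB rho0 sub0r.
elim: s => [|i s IH]; first by rewrite !big_nil.
by rewrite !big_cons -IH -[X in rho (_ + X)]opprK rhoB rhoN opprK.
Qed.

Definition limit_charge (B : set X) : \bar R := (rho (bind B))%:E.

Local Notation nu := limit_charge.

Let nu0 : nu set0 = 0%E.
Proof.
congr (_%:E); rewrite (_ : bind set0 = 0) ?rhoB.
  by rewrite -(subrr 0) rhoB subrr.
by apply: bfun_eq => x; rewrite bindE // indic0.
Qed.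

Let nu_finite B : measurable B -> nu B \is a fin_num. Proof. by []. Qed.

(** As [rho] is bounded by the expectation of any majorant, the tails of the series
    are dominated by those for [mu]. *)
Let nu_sigma_additive : semi_sigma_additive nu.
Proof.
move=> B mB tB mU; apply: cvg_EFin; first by apply: nearW => n; rewrite sumEFin.
have muc : (fun n => \sum_(0 <= i < n) fine (mu (B i))) @ \oo --> fine (mu (\bigcup_n B n)).
  have fin A : measurable A -> mu A \is a fin_num by move=> mA; exact: fin_num_measure.
  have h := @measure_semi_sigma_additive _ _ _ mu B mB tB mU.
  have {}h : (fun n => \sum_(0 <= i < n) mu (B i))%E @ \oo --> (fine (mu (\bigcup_n B n)))%:E.
    by rewrite fineK //; exact: fin.
  have fE : fine \o (fun n => \sum_(0 <= i < n) mu (B i))%E =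
      (fun n => \sum_(0 <= i < n) fine (mu (B i))).
    by apply/funext => n /=; rewrite sum_fine // => i _; exact: fin.
  by rewrite -fE; exact: fine_cvg h.
apply/cvgrPdist_le => e e0; have /cvgrPdist_le /(_ e e0) := muc.
apply: filterS => n hn /=; rewrite sumEFin /=.
rewrite -rho_sum -rhoB; apply: le_trans hn.
set w := bind _ - _; apply: le_trans (_ : ex w <= _).
  apply: rho_bound => x; rewrite ger0_norm // /w bfunB bfun_sum subr_ge0 bindE //.
  under eq_bigr do rewrite bindE //.
  exact: bind_bigcup_ge.
have exs (t : seq nat) : ex (\sum_(i <- t) bind (B i)) = \sum_(i <- t) fine (mu (B i)).
  elim: t => [|i t IH]; last by rewrite !big_cons exD IH ex_bind.
  by rewrite !big_nil; have := exB 0 0; rewrite !subrr.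
by rewrite /w exB ex_bind // exs ler_norm.
Qed.

HB.instance Definition _ := isCharge.Build _ _ _ nu nu0 nu_finite nu_sigma_additive.

Let rho_bind B : measurable B -> `|rho (bind B)| <= ex (bind B).
Proof.
move=> mB; apply: rho_bound => x; rewrite ger0_norm // bindE // indicE; exact: ler0n.
Qed.

Let nu_mu : nu `<< mu.
Proof.
apply/null_content_dominatesP => B mB muB; congr (_%:E).
have := rho_bind mB; rewrite ex_bind // -[mu B]/(_ B) muB /=.
by rewrite normr_le0 => /eqP.
Qed.

Let h x : R := fine (Radon_Nikodym nu mu x).

Let hE : EFin \o h = Radon_Nikodym nu mu.
Proof. by apply/funext => x /=; rewrite fineK //; exact: Radon_Nikodym_fin_num. Qed.

Let h_integrable : integ h.
Proof. by rewrite hE; exact: Radon_Nikodym_integrable. Qed.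

Let h_measurable : measurable_fun setT h.
Proof. by apply/measurable_EFinP; exact: measurable_int h_integrable. Qed.

Let h_bind_integrable B : measurable B -> integ (fun x => h x * \1_B x).
Proof.
move=> mB; apply: (le_integrable measurableT _ _ h_integrable).
  by apply/measurable_EFinP/measurable_funM => //; exact: measurable_indic.
move=> x _ /=; rewrite lee_fin normrM -[leRHS]mulr1 ler_wpM2l // indicE.
by case: (_ \in _); rewrite ?normr1 ?normr0.
Qed.

Let h_density B : measurable B -> \int[mu]_x (h x * \1_B x) = rho (bind B).
Proof.
move=> mB; have := Radon_Nikodym_integral nu_mu mB; rewrite -hE.
move=> /(congr1 fine) /= ->; rewrite -[RHS]/(\int[mu]_(x in B) h x) [RHS]Rintegral_mkcond.
by apply: eq_Rintegral => x _; rewrite patch_indic.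
Qed.

(** The density is bounded by 1 almost everywhere, but the unit ball asks for a
    bound everywhere. *)
Let clamp x := Num.max (-1) (Num.min (h x) 1).

Let clamp_bound x : `|clamp x| <= 1.
Proof.
rewrite /clamp ler_norml le_max lexx ge_max /= ge_min lexx orbT andbT.
by lra.
Qed.

Let clamp_measurable : measurable_fun setT clamp.
Proof. by apply: measurable_maxr => //; apply: measurable_minr. Qed.

(** Where the density exceeds 1 in absolute value, the excess integrates to at most
    0, because the charge is dominated by the measure. *)
Let clamp_dist : \int[mu]_x `|h x - clamp x| <= 0.
Proof.
pose A := [set x | 1 < h x]; pose A' := [set x | h x < -1].
have mA : measurable A.
  rewrite (_ : A = setT `&` h @^-1` `]1, +oo[%classic); first exact: h_measurable.
  by rewrite setTI; apply/seteqP; split=> x /=; rewrite in_itv /= andbT.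
have mA' : measurable A'.
  rewrite (_ : A' = setT `&` h @^-1` `]-oo, -1[%classic); first exact: h_measurable.
  by rewrite setTI; apply/seteqP; split=> x /=; rewrite in_itv.
have -> : \int[mu]_x `|h x - clamp x| =
    \int[mu]_x ((h x * \1_A x - bind A x) - (h x * \1_A' x + bind A' x)).
  apply: eq_Rintegral => x _; rewrite !bindE // !indicE /clamp.
  have [xA|xA] := boolP (x \in A); have [xA'|xA'] := boolP (x \in A').
  - by move: xA xA'; rewrite !inE /A /A' /=; lra.
  - move: xA; rewrite inE /A /= => h1; rewrite min_r ?(ltW h1) // max_r; last by lra.
    by rewrite ger0_norm; lra.
  - move: xA'; rewrite inE /A' /= => h1; rewrite min_l; last by lra.
    by rewrite max_l ?(ltW h1) // ler0_norm; lra.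
  - move: xA xA'; rewrite !notin_setE /A /A' /= => /negP h1 /negP h2.
    rewrite -!leNgt in h1 h2; rewrite min_l // max_r // subrr normr0; ring.
have i1 := h_bind_integrable mA; have i2 := h_bind_integrable mA'.
have i3 := bfun_integrable (bind A); have i4 := bfun_integrable (bind A').
rewrite RintegralB //; first last.
- exact: integD.
- exact: integB.
rewrite RintegralB // RintegralD // !h_density //.
have := rho_bind mA; have := rho_bind mA'; rewrite !ler_norml -!/(ex _).
by move=> /andP[h1 h2] /andP[h3 h4]; lra.
Qed.

Let lim_bind B : measurable B -> ex (mkb clamp * bind B) = rho (bind B).
Proof.
move=> mB; rewrite -h_density //; apply/eqP; rewrite -subr_eq0 -normr_le0.
have ic : integ (fun x => clamp x * \1_B x).
  apply: (@bounded_integrable _ 1).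
    by apply: measurable_funM => //; exact: measurable_indic.
  move=> x; rewrite normrM -[leRHS]mulr1 ler_pM // indicE.
  by case: (_ \in _); rewrite ?normr1 ?normr0.
have -> : ex (mkb clamp * bind B) = \int[mu]_x (clamp x * \1_B x).
  by apply: eq_Rintegral => x _; rewrite bfunM bindE // (mkbE clamp_measurable clamp_bound).
have ib := h_bind_integrable mB.
rewrite -RintegralB //; apply: le_trans (le_normr_Rintegral _ _) _ => //.
  exact: integB.
apply: le_trans clamp_dist; apply: le_Rintegral => //.
- by apply: (integrable_norm (f := fun x => clamp x * \1_B x - h x * \1_B x)); exact: integB.
- apply: (integrable_norm (f := fun x => h x - clamp x)); apply: integB => //.
  exact: (bounded_integrable clamp_measurable clamp_bound).
move=> x _; rewrite -mulrBl normrM distrC -[leRHS]mulr1 ler_wpM2l // indicE.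
by case: (_ \in _); rewrite ?normr1 ?normr0.
Qed.

(** The limit is the density of the charge that [B |-> lim E(F_n 1_B)] defines. *)
Lemma weak_limit_exists : exists f, unit_ball f /\
  forall g, ex (f * g) = m (fun n => ex (F n * g)).
Proof.
have cE := mkbE clamp_measurable clamp_bound.
exists (mkb clamp); split=> [x|g]; first by rewrite cE.
apply/eqP; rewrite -subr_eq0; apply/eqP.
apply: (@functional_eq0 _ X R (fun g => ex (mkb clamp * g) - rho g) 2) => [f f'|c f|f c fc|B mB].
- by rewrite mulrBr exB rhoB; ring.
- by rewrite mulrCA exZ rhoZ; ring.
- apply: le_trans (ler_normB _ _) _; rewrite mulr_natl mulr2n; apply: lerD.
    apply: ex_bound => x; rewrite bfunM normrM; apply: le_trans (fc x).
    by rewrite -[leRHS]mul1r ler_wpM2r // cE.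
  rewrite -(ex_cst c); apply: rho_bound => x; rewrite bcstE; exact: fc.
- by rewrite lim_bind // subrr.
Qed.

End WeakLimit.

(** ** The system *)

Section System.
Context (T Tinv : X -> X).
Hypothesis hT : measure_preserving mu T.
Hypothesis hTinv : measurable_inverse T Tinv.

Lemma iterzS a x : iterz T Tinv (a + 1) x = T (iterz T Tinv a x).
Proof.
case: a => [n|[|n]]; first by rewrite /= addn1.
- by rewrite /= (inv_cancel_r hTinv).
- have -> : Negz n.+1 + 1 = Negz n by lia.
  by rewrite /= (inv_cancel_r hTinv).
Qed.

Lemma iterzD a b x : iterz T Tinv (a + b) x = iterz T Tinv a (iterz T Tinv b x).
Proof.
elim/int_ind: a => [|n IH|n IH]; first by rewrite add0r.
  have -> : n.+1%:Z + b = n%:Z + b + 1 by lia.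
  rewrite iterzS IH -iterzS; congr (iterz _ _ _ _); lia.
have inj : injective T by exact: can_inj (inv_cancel_l hTinv).
apply: inj; rewrite -!iterzS.
have -> : - n.+1%:Z + b + 1 = - n%:Z + b by lia.
by rewrite IH; congr (iterz _ _ _ _); lia.
Qed.

Lemma iterz_measurable a : measurable_fun setT (iterz T Tinv a).
Proof.
have it (u : X -> X) n : measurable_fun setT u -> measurable_fun setT (iter n u).
  move=> mu_; elim: n => [|n IH]; first exact: measurable_id.
  by rewrite (_ : iter n.+1 u = u \o iter n u) //; exact: measurableT_comp.
case: a => n; apply: it; [exact: mp_measurable hT|exact: inv_measurable hTinv].
Qed.

Lemma iterz_preserving a B : measurable B -> mu (iterz T Tinv a @^-1` B) = mu B.
Proof.
have step c C : measurable C -> mu (iterz T Tinv (c + 1) @^-1` C) = mu (iterz T Tinv c @^-1` C).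
  move=> mC; have -> : iterz T Tinv (c + 1) @^-1` C = T @^-1` (iterz T Tinv c @^-1` C).
    by apply/funext => x /=; congr (C _); rewrite iterzD.
  apply: (mp_preserving hT); rewrite -[X in measurable X]setTI; exact: iterz_measurable.
move=> mB; elim/int_ind: a => [//|n IH|n IH].
  by rewrite -addn1 PoszD step.
have := step (- n.+1%:Z) B mB; rewrite (_ : - n.+1%:Z + 1 = - n%:Z); last by lia.
by move=> <-.
Qed.

(** With this sign the indicator of [A] goes to the indicator of [T^a A]. *)
Definition translate (a : int) f : bfun X R := mkb (fun x => f (iterz T Tinv (- a) x)).

Lemma translateE a f x : translate a f x = f (iterz T Tinv (- a) x).
Proof.
have [C fC] := bfun_bounded f; apply: (@mkbE _ _ _ _ C) => //.
by apply: measurableT_comp; [exact: bfun_measurable|exact: iterz_measurable].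
Qed.

Lemma translate_ex a f : ex (translate a f) = ex f.
Proof.
apply/eqP; rewrite -subr_eq0; apply/eqP.
apply: (@functional_eq0 _ X R (fun f => ex (translate a f) - ex f) 2) => [g g'|c g|g c gc|B mB].
- have -> : translate a (g - g') = translate a g - translate a g'.
    by apply: bfun_eq => x; rewrite bfunB !translateE.
  by rewrite !exB; ring.
- have -> : translate a (bcst c * g) = bcst c * translate a g.
    by apply: bfun_eq => x; rewrite bfunM !translateE bfunM !bcstE.
  by rewrite !exZ; ring.
- apply: le_trans (ler_normB _ _) _; rewrite mulr_natl mulr2n.
  by apply: lerD; apply: ex_bound => x; rewrite ?translateE.
- have mB' : measurable (iterz T Tinv (- a) @^-1` B).
    by rewrite -[X in measurable X]setTI; exact: iterz_measurable.
  have -> : translate a (bind B) = bind (iterz T Tinv (- a) @^-1` B).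
    by apply: bfun_eq => x; rewrite translateE !bindE.
  by rewrite !ex_bind // iterz_preserving // subrr.
Qed.

Lemma unit_ball_half f g : unit_ball f -> unit_ball g -> unit_ball (bcst 2^-1 * (f - g)).
Proof.
move=> bf bg x; rewrite bfunM bfunB bcstE normrM ger0_norm // mulrC ler_pdivrMr // mul1r.
by apply: le_trans (ler_normB _ _) _; have := bf x; have := bg x; lra.
Qed.

Definition system : msys R.
Proof.
refine (@MSys R (bfun X R) bcst ex translate unit_ball _ _ _ _ _ _ _ _ _ _ _ _ _ _ _ _ _ _).
- by apply: bfun_eq => x; rewrite bcstE.
- exact: exD.
- exact: exZ.
- rewrite -[RHS](ex_cst 1); congr ex; by apply: bfun_eq => x; rewrite bcstE.
- move=> f; rewrite -(ex_cst 0); apply: ex_le => x; rewrite bcstE bfunX; exact: sqr_ge0.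
- by move=> f; apply: bfun_eq => x; rewrite translateE oppr0.
- by move=> a b f; apply: bfun_eq => x; rewrite !translateE opprD addrC iterzD.
- by move=> a f g; apply: bfun_eq => x; rewrite bfunD !translateE.
- by move=> a f g; apply: bfun_eq => x; rewrite bfunM !translateE.
- by move=> a; apply: bfun_eq => x; rewrite translateE.
- by move=> a c; apply: bfun_eq => x; rewrite translateE !bcstE.
- exact: translate_ex.
- by move=> x; rewrite bfun1 normr1.
- move=> f g bf bg x; rewrite bfunM normrM -[leRHS]mulr1; exact: ler_pM.
- by move=> a f bf x; rewrite translateE.
- exact: unit_ball_half.
- move=> f g bf; apply: ex_le => x; rewrite !bfunX bfunM exprMn -[leRHS]mul1r.
  by rewrite ler_wpM2r ?sqr_ge0 // -[leRHS](expr1n _ 2) -real_normK ?num_real // lerXn2r ?nnegrE.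
- by move=> m F bF; exact: weak_limit_exists.
Defined.

End System.
End Expectation.

(** * Polynomial recurrence *)

Local Open Scope classical_set_scope.

Section Intersections.
Context {d : measure_display} {X : measurableType d} {R : realType} (mu : probability X R).
Context (T Tinv : X -> X).
Hypothesis hT : measure_preserving mu T.
Hypothesis hTinv : measurable_inverse T Tinv.

Lemma image_iterz a (A : set X) : iterz T Tinv a @` A = iterz T Tinv (- a) @^-1` A.
Proof.
apply/seteqP; split=> [_ [x Ax <-]|x Ax] /=.
  by rewrite -(iterzD hTinv) addNr.
by exists (iterz T Tinv (- a) x); rewrite // -(iterzD hTinv) subrr.
Qed.

Lemma measurable_image_iterz a (A : set X) : measurable A -> measurable (iterz T Tinv a @` A).
Proof.
by move=> mA; rewrite image_iterz -[X in measurable X]setTI; exact: (iterz_measurable hT hTinv).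
Qed.

Lemma state_intersection (k : nat) (z : 'I_k -> int) (A : set X) : measurable A ->
  @state R (system hT hTinv) (bind A * \prod_(i < k) @act R (system hT hTinv) (z i) (bind A)) =
  fine (mu (A `&` \bigcap_(i : 'I_k) (iterz T Tinv (z i) @` A))).
Proof.
move=> mA; set B := A `&` _.
have mB : measurable B.
  apply: measurableI => //; apply: fin_bigcap_measurable => [|i _]; first exact: finite_finset.
  exact: measurable_image_iterz.
rewrite -ex_bind //; congr (ex _ _); apply: bfun_eq => x.
rewrite bfunM bfun_prod !bindE //.
have tE i : act (z i) (bind A : obs (system hT hTinv)) x = \1_A (iterz T Tinv (- z i) x) :> R.
  by rewrite /= (translateE hT hTinv) bindE.
under eq_bigr do rewrite tE.
have BP : B x <-> A x /\ forall i, A (iterz T Tinv (- z i) x).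
  rewrite /B; split=> [[Ax h]|[Ax h]]; split=> // i; first by have := h i I; rewrite image_iterz.
  by move=> _; rewrite image_iterz; exact: h.
rewrite !indicE; have [Bx|nB] := pselect (B x).
  have [Ax h] := BP.1 Bx; rewrite !mem_set // mul1r big1 // => i _.
  by rewrite indicE mem_set.
rewrite [in RHS]memNset //; have [Ax|nA] := pselect (A x); last by rewrite memNset // mul0r.
have [i ni] : exists i, ~ A (iterz T Tinv (- z i) x).
  by apply: contrapT => /forallNP h; apply: nB; apply/BP; split=> // i; exact: contrapT.
by rewrite (bigD1 i) //= indicE (memNset ni) mul0r mulr0.
Qed.

End Intersections.

Theorem theorem1p3 (R : realType) (d : measure_display) (X : measurableType d)
    (mu : probability X R) (T Tinv : X -> X)
    (hT : measure_preserving mu T) (hTinv : measurable_inverse T Tinv)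
    (k : nat) (hk : (0 < k)%N) (p : 'I_k -> {poly R})
    (hint : forall i : 'I_k, integer_poly (p i))
    (hindep : rationally_independent p)
    (h0 : forall i : 'I_k, (p i).[0] = 0)
    (A : set X) (hA : measurable A) (eps : R) (heps : 0 < eps) :
  syndetic [set n : nat | (0 < n)%N /\
    (mu A ^+ k.+1 - eps%:E <=
     mu (A `&` \bigcap_(i : 'I_k)
           (iterz T Tinv (poly_int_val (p i) n) @` A)))%E].
Proof.
set L := [set n | _]; apply: contrapT => nsyn.
have gap M : (0 < M)%N -> exists a l : nat, [/\ (0 < a)%N, (M < l)%N &
    forall n : nat, (a <= n < a + l)%N -> ~ L n].
  move=> M0; apply: contrapT => H; apply: nsyn; exists M => // a l a0 Ml.
  apply: contrapT => none; apply: H; exists a, l; split=> // n hn Ln.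
  by apply: none; exists n.
pose f : obs (system hT hTinv) := bind A.
have bf : ball f by exact: unit_bind.
have ff : f * f = f.
  by apply: bfun_eq => x; rewrite bfunM bindE // indicE; case: (_ \in _); rewrite ?mulr1 ?mulr0.
have e2 : 0 < eps / 2 by lra.
have [q q0 hq] := recurrence_along_progression (interval_mean (fun=> 0)) hint hindep h0 bf ff e2.
(* a gap longer than [q * j.+2] contains [j.+1] consecutive multiples of [q] *)
have gap' j : exists J : nat, forall i : nat, (i <= j)%N -> (0 < q * (J + i))%N /\ ~ L (q * (J + i))%N.
  have [|a [l [a0 Ml nL]]] := gap (q * j.+2)%N; first by rewrite muln_gt0 q0.
  exists (a %/ q).+1 => i ij; split; first by rewrite muln_gt0 q0 addSn.
  apply: nL; have := divn_eq a q; have := ltn_pmod a q0.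
  move: (a %/ q)%N (a %% q)%N => u v vq ->; apply/andP; split; nia.
have [J JP] := choice gap'.
(* this mean only sees multiples of [q] that lie in gaps *)
pose m := interval_mean (R := R) (fun j => (J j)%:Z).
have muE B : measurable B -> mu B = (fine (mu B))%:E.
  by move=> mB; rewrite fineK //; exact: fin_num_measure.
have := hq m; set x := (fun n : int => _).
have bx : bounded x.
  apply: ball_bounded => n; apply: ballM => //; apply: ball_prod => i; exact: ball_act.
have fE : @state R (system hT hTinv) f = fine (mu A) by exact: ex_bind.
have : m x <= fine (mu A) ^+ k.+1 - eps.
  apply: interval_mean_le => // j i ij; have [N0 nL] := JP j i ij.
  rewrite /x state_intersection //.
  set B := A `&` _; have mB : measurable B.
    apply: measurableI => //; apply: fin_bigcap_measurable => [|i' _]; first exact: finite_finset.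
    exact: (measurable_image_iterz hT hTinv).
  rewrite leNgt; apply/negP => lt; apply: nL; split=> //.
  have pE i' : poly_int_val (p i') (q * (J j + i))%N = pval (p i') (q%:Z * ((J j)%:Z + i%:Z)).
    by rewrite /poly_int_val /pval -PoszD -PoszM -pmulrn.
  rewrite (_ : A `&` _ = B); last by congr (_ `&` _); apply: eq_bigcapr => i' _; rewrite pE.
  rewrite (muE _ hA) (muE _ mB) -EFin_expe -EFinB lee_fin; exact: ltW.
by rewrite fE; lra.
Qed.
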